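(* Let $1<p<\infty$ and $\alpha>0$. The following embeddings hold. (a) If $p<\frac N\alpha$, then $L^{\alpha,p}\hookrightarrow L^q$ for $p\le q\le p^*$, where $\frac1{p^*}=\frac1p-\frac\alpha N$. (b) If $p=\frac N\alpha$, then $L^{\alpha,p}\hookrightarrow L^q$ for $p\le q<\infty$. If in addition $\alpha<1$, then $L^{\alpha,p}\hookrightarrow BMO$. (c) If $p>\frac N\alpha$, then $L^{\alpha,p}\hookrightarrow L^q$ for $p\le q\le\infty$. If in addition $\alpha<1+N/p$, then $L^{\alpha,p}\hookrightarrow C^{\alpha-N/p}$.
   Context: Setting: $(X,d,m)$ is a metric space with a Borel measure $m$ such that $m(X)=\infty$ and, for some $N>0$ (Ahlfors $N$-regularity), $c^{-1}r^N\le m(B(x,r))\le c\,r^N$ for all $x\in X$, $r>0$, with $c$ independent of $x,r$. Approximation of the identity: fix a non-negative decreasing $C^\infty$ function $h:[0,\infty)\to\mathbb{R}$ with $h\equiv1$ on $[0,1/2]$ and $h\equiv0$ on $[2,\infty)$. For $t>0$ let $T_tf(x)=t^{-N}\int_X h(d(x,y)/t)f(y)\,dm(y)$, $\varphi(x,t)=1/T_t1(x)$, $\psi(x,t)=1/T_t\left(\frac{1}{T_t1}\right)(x)$, and $$s(x,y,t)=\frac{\varphi(x,t)\varphi(y,t)}{t^{2N}}\int_X h\left(\tfrac{d(x,z)}{t}\right)h\left(\tfrac{d(y,z)}{t}\right)\psi(z,t)\,dm(z).$$ Bessel potential: for $\alpha>0$, $k_\alpha(x,y)=\alpha\int_0^\infty\frac{t^\alpha}{(1+t^\alpha)^2}s(x,y,t)\frac{dt}{t}$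 and $J_\alpha g(x)=\int_X g(z)k_\alpha(x,z)\,dm(z)$; $J_\alpha$ is a contraction on $L^p$, $1\le p\le\infty$. Potential space: $L^{\alpha,p}=J_\alpha(L^p)$ with norm $\|f\|_{\alpha,p}=\|f\|_p+\inf\{\|g\|_p: g\in L^p,\ J_\alpha g=f\}$. $BMO$ is equipped with $\|f\|_{BMO}=\sup_B\frac1{m(B)}\int_B|f-f_B|\,dm$, supremum over balls $B$, $f_B=\frac1{m(B)}\int_Bf\,dm$. $C^\beta$ is the space of bounded functions with $[f]_\beta=\sup_{x\neq y}|f(x)-f(y)|/d(x,y)^\beta<\infty$, normed by $\|f\|_\infty+[f]_\beta$ (functions identified if equal a.e.). $A\hookrightarrow B$ means $A\subset B$ with continuous inclusion. *)

(* Defs.v *)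
From HB Require Import structures.
From mathcomp Require Import all_boot all_order all_algebra.
From mathcomp Require Import all_classical all_reals all_analysis.

Set Implicit Arguments.
Unset Strict Implicit.
Unset Printing Implicit Defensive.
Import Order.TTheory GRing.Theory Num.Theory.
Import numFieldNormedType.Exports.

Local Open Scope classical_set_scope.
Local Open Scope ring_scope.

(* The two structures are not related here: that the measurable sets are the
   Borel sets of the metric is the separate predicate [borel_measurable].
   [measurableType] is pointed, so X is nonempty; this is no restriction for
   a space of infinite measure. *)
#[short(type="metricMeasurableType")]
HB.structure Definition MetricMeasurable (d : measure_display) (R : realType) :=
  {X of Metric R X & Measurable d X}.

Section setting.
Context {d : measure_display} {R : realType}.

Definition borel_measurable (X : metricMeasurableType d R) : Prop :=
  @measurable d X = <<s @open X >>.

Definition ahlfors_regular (X : metricMeasurableType d R)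
    (m : {measure set X -> \bar R}) (N : R) : Prop :=
  exists2 c : R, 0 < c & forall (x : X) (r : R), 0 < r ->
    ((c^-1 * r `^ N)%:E <= m (ball x r) <= (c * r `^ N)%:E)%E.

(* Only the values of [h] on [0, +oo[ matter. Smoothness at 0 is automatic
   since [h] is constant on [0, 1/2]. *)
Definition cutoff (h : R -> R) : Prop :=
  [/\ forall x : R, 0 <= x -> 0 <= h x,
      forall x y : R, 0 <= x -> x <= y -> h y <= h x,
      forall (n : nat) (x : R), 0 < x -> derivable (derive1n n h) x 1,
      forall x : R, 0 <= x <= 2^-1 -> h x = 1 &
      forall x : R, 2 <= x -> h x = 0].

End setting.

Section kernels.
Context {d : measure_display} {R : realType} {X : metricMeasurableType d R}.
Variables (m : {measure set X -> \bar R}) (N : R) (h : R -> R).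

Definition approx_avg (t : R) (f : X -> R) (x : X) : R :=
  t `^ (- N) * \int[m]_y (h (mdist x y / t) * f y).

Definition approx_phi (x : X) (t : R) : R := (approx_avg t (cst 1) x)^-1.

Definition approx_psi (x : X) (t : R) : R :=
  (approx_avg t (fun y => (approx_avg t (cst 1) y)^-1) x)^-1.

Definition approx_kernel (x y : X) (t : R) : R :=
  approx_phi x t * approx_phi y t / t `^ (2 * N) *
  \int[m]_z (h (mdist x z / t) * h (mdist y z / t) * approx_psi z t).

(* Extended-real valued: the kernel is infinite on the diagonal when
   alpha <= N. *)
Definition bessel_kernel (alpha : R) (x y : X) : \bar R :=
  (alpha%:E * \int[lebesgue_measure]_(t in `]0%R, +oo[)
    (t `^ alpha / (1 + t `^ alpha) ^+ 2 * approx_kernel x y t / t)%:E)%E.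

Definition bessel_potential (alpha : R) (g : X -> R) (x : X) : \bar R :=
  (\int[m]_z ((g z)%:E * bessel_kernel alpha x z))%E.

End kernels.

(* A space of functions modulo a.e. equality, given by the representatives of
   its members and by the norm as a function of a representative. *)
Record fun_space (X : Type) (R : realType) := FunSpace {
  members : set (X -> R) ;
  fnorm : (X -> R) -> \bar R }.

(* A `<=` B and the identity map is continuous for the norms. *)
Definition continuously_embedded (X : Type) (R : realType)
    (A B : fun_space X R) : Prop :=
  members A `<=` members B /\
  forall f, members A f -> forall e : R, 0 < e ->
    exists2 r : R, 0 < r & forall g, members A g ->
      (fnorm A (g \- f)%R < r%:E)%E -> (fnorm B (g \- f)%R < e%:E)%E.

Notation "A '\hookrightarrow' B" := (continuously_embedded A B)
  (at level 70, no associativity).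

Section spaces.
Context {d : measure_display} {R : realType} {X : metricMeasurableType d R}.
Variable m : {measure set X -> \bar R}.
Local Open Scope ereal_scope.

Definition Lebesgue_space (p : \bar R) : fun_space X R :=
  FunSpace [set f | f \in Lfun m p] (fun f => 'N[m]_p[EFin \o f]).

Definition is_bessel_potential (N : R) (h : R -> R) (alpha p : R)
    (f g : X -> R) : Prop :=
  g \in Lfun m p%:E /\ EFin \o f = bessel_potential m N h alpha g %[ae m].

Definition potential_space (N : R) (h : R -> R) (alpha p : R) :
    fun_space X R :=
  FunSpace
    [set f | measurable_fun setT f /\
             exists g, is_bessel_potential N h alpha p f g]
    (fun f => 'N[m]_p%:E[EFin \o f] +
       ereal_inf [set 'N[m]_p%:E[EFin \o g] |
                  g in is_bessel_potential N h alpha p f]).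

Definition mean (B : set X) (f : X -> R) : R :=
  ((fine (m B))^-1 * \int[m]_(y in B) f y)%R.

Definition mean_oscillation (B : set X) (f : X -> R) : \bar R :=
  ((fine (m B))^-1)%:E * \int[m]_(y in B) `|f y - mean B f|%:E.

Definition BMO_norm (f : X -> R) : \bar R :=
  ereal_sup [set z | exists x : X, exists2 r : R, (0 < r)%R &
                       z = mean_oscillation (ball x r) f].

Definition BMO_space : fun_space X R :=
  FunSpace
    [set f | [/\ measurable_fun setT f,
       forall (x : X) (r : R), (0 < r)%R -> m.-integrable (ball x r) (EFin \o f)
       & BMO_norm f < +oo]]
    BMO_norm.

Definition Hoelder_seminorm (beta : R) (f : X -> R) : \bar R :=
  ereal_sup [set z | exists x, exists2 y, x <> y &
                       z = (`|f x - f y| / mdist x y `^ beta)%:E].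

Definition Hoelder_norm (beta : R) (f : X -> R) : \bar R :=
  ereal_sup [set `|f x|%:E | x in [set: X]] + Hoelder_seminorm beta f.

(* Norm of the class of [f]: since members are only identified up to a.e.
   equality, it is computed on a representative. *)
Definition Hoelder_space (beta : R) : fun_space X R :=
  FunSpace
    [set f | measurable_fun setT f /\
       exists2 f' : X -> R, Hoelder_norm beta f' < +oo & f = f' %[ae m]]
    (fun f => ereal_inf [set Hoelder_norm beta f' |
                         f' in [set f' : X -> R | f = f' %[ae m]]]).

End spaces.

(* Main.v *)
(* The kernel s(x, z, t) is at most C t^-N, vanishes for d(x, z) >= 4 t, and is
   Lipschitz in x with constant C t^-(N+1).  Hence |J g|(x) is dominated by
   \int w(t) A_t|g|(x) dt, where A_t is the average over the ball of radius 4 t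
   and w(t) <= t^(b-1) for every |b| <= alpha.
   - L^p -> L^p: at the point x, truncate g at a small multiple of (J g)(x), using
     g <= s + s^(1-p) g^p; the bounded part is absorbed and the rest is the
     L^1 estimate for g^p.
   - L^p -> L^q, q > p: take b = N/p - N/q. Given y = (J g)(x), cut the scales at
     a radius rho(y) beyond which Hoelder bounds the integral by y/4, and below
     rho(y) cut g at a height tau(y) so that the part under tau(y) also
     contributes y/4. Multiplying what is left by y^(q-1) and integrating in x
     first gives a bound by \int g^p, with no maximal function.
   - BMO and Hoelder bounds: split the scales at the radius of the ball, resp. at
     the distance of the two points; small scales are bounded by the size of the
     kernel and large ones by its Lipschitz constant. *)
From HB Require Import structures.
Require Import Defs.
From mathcomp Require Import all_boot all_order all_algebra.
From mathcomp Require Import all_classical all_reals all_analysis.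
From mathcomp Require Import measurable_realfun ess_sup_inf ring lra.
Import Order.TTheory GRing.Theory Num.Theory.
Import numFieldNormedType.Exports.
Local Open Scope classical_set_scope.
Local Open Scope ring_scope.

Set Implicit Arguments.
Unset Strict Implicit.
Unset Printing Implicit Defensive.

(** Every estimate exchanges integrals over X x X and over X x R, so the distance has to be
    measurable for the product sigma-algebra, which in a general metric space may be smaller than
    the Borel sets of the product. Regularity removes this obstacle: it makes bounded sets totally
    bounded, hence X separable, hence the distance jointly measurable.

    The truncation inequality also stands in for Hoelder's inequality: with height G r^(-N/p) it
    gives the bound for averages over balls. With a height tied to the value being estimated it
    becomes an absorption argument, and this needs a finite value to absorb into. The bounds are
    therefore stated for a real-valued f dominated almost everywhere by a potential that may itself
    be infinite.

    The kernel of the Bessel potential can be infinite on the diagonal. Differences are thus never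
    taken of whole kernels or whole potentials, only of the parts coming from scales above a
    positive radius; the small scales are estimated in absolute value. *)

Section sigma_finite_alias.
Context {d : measure_display} {T : measurableType d} {R : realType}.

(* An alias of [m] carrying the sigma-finiteness that the library's Fubini-Tonelli
   theorem takes as a canonical structure. *)
Definition sfin_measure {m : {measure set T -> \bar R}}
  (sm : sigma_finite setT m) : set T -> \bar R := m.

Variables (m : {measure set T -> \bar R}) (sm : sigma_finite setT m).
HB.instance Definition _ := Measure.copy (sfin_measure sm) m.
HB.instance Definition _ :=
  Measure_isSigmaFinite.Build _ _ _ (sfin_measure sm) sm.
End sigma_finite_alias.

Lemma measurable_natr {d : measure_display} {T : measurableType d}
    {R : realType} (D : set T) (f : T -> bool) :
  measurable_fun D f -> measurable_fun D (fun x => (f x)%:R : R).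
Proof.
move=> mf mD; move: (mD).
rewrite (_ : (fun x => _) = fun x => if f x then 1 else 0 : R).
  exact: measurable_fun_if.
by apply/funext => x; case: (f x).
Qed.

Lemma measurable_powR_comp {d : measure_display} {T : measurableType d}
    {R : realType} (g : T -> R) p :
  measurable_fun setT g -> measurable_fun setT (fun z => g z `^ p).
Proof. by move=> mg; apply: (measurableT_comp (measurable_powR _)). Qed.

Lemma measurable_norm_comp {d : measure_display} {T : measurableType d}
    {R : realType} (g : T -> R) :
  measurable_fun setT g -> measurable_fun setT (fun z => `|g z|).
Proof. by move=> mg; exact: measurableT_comp. Qed.

Lemma measurable_tensor {d1 d2 : measure_display} {T1 : measurableType d1}
    {T2 : measurableType d2} {R : realType} (u : T2 -> R) (g : T1 -> R) :
  measurable_fun setT u -> measurable_fun setT g ->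
  measurable_fun [set: T1 * T2] (fun w => u w.2 * g w.1).
Proof.
by move=> mu_ mg; apply: measurable_funM;
  [apply: (measurableT_comp mu_)|apply: (measurableT_comp mg)].
Qed.

Lemma ge0_integralZl_real {d : measure_display} {T : measurableType d}
    {R : realType} (m : {measure set T -> \bar R}) (D : set T) (f : T -> R) k :
  measurable D -> 0 <= k -> (forall x, D x -> 0 <= f x) -> measurable_fun D f ->
  (\int[m]_(x in D) (k * f x)%:E = k%:E * \int[m]_(x in D) (f x)%:E)%E.
Proof.
move=> mD k0 f0 mf; under eq_integral do rewrite EFinM.
rewrite ge0_integralZl//.
- exact/measurable_EFinP.
Qed.

(** * Tonelli's theorem with one variable confined to a measurable set *)

Section tonelli.
Context {d1 d2 : measure_display} {T1 : measurableType d1}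
  {T2 : measurableType d2} {R : realType}.
Variables (m1 : {measure set T1 -> \bar R}) (m2 : {measure set T2 -> \bar R}).
Hypotheses (sm1 : sigma_finite setT m1) (sm2 : sigma_finite setT m2).
Local Open Scope ereal_scope.

Lemma tonelli_setT (f : T1 * T2 -> \bar R) :
  measurable_fun setT f -> (forall z, 0 <= f z) ->
  \int[m1]_x \int[m2]_y f (x, y) = \int[m2]_y \int[m1]_x f (x, y).
Proof.
move=> mf f0.
exact: (@fubini_tonelli _ _ _ _ _ (sfin_measure sm1) (sfin_measure sm2)).
Qed.

Lemma measurable_tonelli_setT (f : T1 * T2 -> \bar R) :
  measurable_fun setT f -> (forall z, 0 <= f z) ->
  measurable_fun setT (fun x => \int[m2]_y f (x, y)).
Proof.
move=> mf f0.
exact: (@measurable_fun_fubini_tonelli_F _ _ _ _ _ (sfin_measure sm2)).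
Qed.

Let patchX (D : set T2) (f : T1 * T2 -> \bar R) x y :
  ((fun y => f (x, y)) \_ D) y = (f \_ (setT `*` D)) (x, y).
Proof. by rewrite !patchE/= in_setX/= in_setT. Qed.

Let patch_ge0 (D : set T2) (f : T1 * T2 -> \bar R) :
  (forall x y, D y -> 0 <= f (x, y)) -> forall z, 0 <= (f \_ (setT `*` D)) z.
Proof.
by move=> f0 [x y]; rewrite patchE; case: ifPn => //; rewrite inE => -[_ /f0].
Qed.

(** Extension by zero outside D reduces this to whole spaces. Sign and measurability are asked only
    on D because the integrand of the Bessel kernel, with its factor 1 / t, is controlled for t > 0
    only. *)
Lemma tonelli (D : set T2) (f : T1 -> T2 -> \bar R) :
  measurable D ->
  measurable_fun (setT `*` D) (fun z : T1 * T2 => f z.1 z.2) ->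
  (forall x y, D y -> 0 <= f x y) ->
  \int[m1]_x \int[m2]_(y in D) f x y = \int[m2]_(y in D) \int[m1]_x f x y.
Proof.
move=> mD mf f0; set F := fun z : T1 * T2 => f z.1 z.2 in mf.
have mFD : measurable_fun setT (F \_ (setT `*` D)).
  by apply/(measurable_restrictT _ _).1 => //; exact: measurableX.
transitivity (\int[m1]_x \int[m2]_y (F \_ (setT `*` D)) (x, y)).
  apply: eq_integral => x _; rewrite integral_mkcond.
  by apply: eq_integral => y _; rewrite -patchX.
rewrite tonelli_setT//; last exact: patch_ge0.
rewrite [RHS]integral_mkcond; apply: eq_integral => y _.
rewrite patchE; case: ifPn => yD; last first.
  by rewrite integral0_eq// => x _; rewrite -patchX patchE (negbTE yD).
by apply: eq_integral => x _; rewrite -patchX patchE yD.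
Qed.

Lemma measurable_tonelli (D : set T2) (f : T1 -> T2 -> \bar R) :
  measurable D ->
  measurable_fun (setT `*` D) (fun z : T1 * T2 => f z.1 z.2) ->
  (forall x y, D y -> 0 <= f x y) ->
  measurable_fun setT (fun x => \int[m2]_(y in D) f x y).
Proof.
move=> mD mf f0; set F := fun z : T1 * T2 => f z.1 z.2 in mf.
have mFD : measurable_fun setT (F \_ (setT `*` D)).
  by apply/(measurable_restrictT _ _).1 => //; exact: measurableX.
rewrite (_ : (fun x => _) = fun x => \int[m2]_y (F \_ (setT `*` D)) (x, y)).
  by apply: measurable_tonelli_setT => //; exact: patch_ge0.
apply/funext => x; rewrite integral_mkcond.
by apply: eq_integral => y _; rewrite -patchX.
Qed.

Lemma measurable_tonelli_in (D : set T2) (f : T1 -> T2 -> \bar R) :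
  measurable D ->
  measurable_fun (setT `*` D) (fun z : T1 * T2 => f z.1 z.2) ->
  (forall x y, D y -> 0 <= f x y) ->
  measurable_fun D (fun y => \int[m1]_x f x y).
Proof.
move=> mD mf f0; set F := fun z : T1 * T2 => f z.1 z.2 in mf.
have mFD : measurable_fun setT (F \_ (setT `*` D)).
  by apply/(measurable_restrictT _ _).1 => //; exact: measurableX.
apply: (eq_measurable_fun (fun y => \int[m1]_x (F \_ (setT `*` D)) (x, y))).
  move=> y yD; apply: eq_integral => x _.
  by rewrite -patchX patchE yD.
apply: measurable_funTS.
apply: (@measurable_fun_fubini_tonelli_G _ _ _ _ _ (sfin_measure sm1)
  (F \_ (setT `*` D))) => //; exact: patch_ge0.
Qed.

End tonelli.

(** * Integrals of powers near 0 and near infinity *)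

Section power_integrals.
Context {R : realType}.
Local Notation mu := (@lebesgue_measure R).

Let integral_powR_cc (a b c : R) : 0 < a -> a < b -> c != 0 ->
  (\int[mu]_(t in `[a, b]) (t `^ (c - 1))%:E = ((b `^ c - a `^ c) / c)%:E)%E.
Proof.
move=> a0 ab c0.
have der (t : R) : 0 < t -> is_derive t 1 (fun x : R => x `^ c / c) (t `^ (c - 1)).
  move=> t0; have Hd := is_derive1_powR c t0.
  have := is_deriveZ c^-1 Hd.
  rewrite /GRing.scale/= mulrA mulVf// mul1r.
  rewrite (_ : c^-1 \*: _ = fun x => x `^ c / c)//.
  by apply/funext => x; rewrite /= mulrC.
have ct (t e : R) : 0 < t -> {for t, continuous (fun x : R => x `^ e)}.
  move=> t0; apply: differentiable_continuous; apply/derivable1_diffP.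
  by have [] := is_derive1_powR e t0.
have ctF (t : R) : 0 < t -> {for t, continuous (fun x : R => x `^ c / c)}.
  move=> t0; apply: differentiable_continuous; apply/derivable1_diffP.
  by have [] := der _ t0.
rewrite (@continuous_FTC2 _ _ (fun x => x `^ c / c))//.
- by rewrite -EFinB mulrBl.
- apply: continuous_in_subspaceT => t; rewrite inE/= in_itv/= => /andP[at_ _].
  by apply: ct; exact: lt_le_trans at_.
- split.
  + move=> t; rewrite in_itv/= => /andP[at_ _].
    by have [] := der _ (lt_trans a0 at_).
  + by apply: cvg_at_right_filter; exact: ctF.
  + by apply: cvg_at_left_filter; apply: ctF; exact: lt_trans ab.
- move=> t; rewrite in_itv/= => /andP[at_ _]; rewrite derive1E.
  by have [_ ->] := der _ (lt_trans a0 at_).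
Qed.

Let le_limit_set (F : (set R)^nat) (f : R -> \bar R) (C : \bar R) :
  {homo F : n m / (n <= m)%N >-> (n <= m)%O} ->
  (forall i, measurable (F i)) ->
  (forall i, measurable_fun (F i) f) -> (forall x, (0 <= f x)%E) ->
  (forall i, (\int[mu]_(x in F i) f x <= C)%E) ->
  (\int[mu]_(x in \bigcup_i F i) f x <= C)%E.
Proof.
move=> ndF mF mf f0 FC.
have H : (\int[mu]_(x in F i) f x)%E @[i --> \oo] -->
    (\int[mu]_(x in \bigcup_i F i) f x)%E.
  exact: ge0_nondecreasing_set_cvg_integral.
rewrite -(cvg_lim _ H)//; apply: lime_le; first by apply/cvg_ex; eexists; exact: H.
by apply: nearW.
Qed.

Lemma integral_powR_le (c b : R) : 0 < c -> 0 < b ->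
  (\int[mu]_(t in `]0%R, +oo[) ((t <= b)%R%:R * t `^ (c - 1))%:E
    <= (b `^ c / c)%:E)%E.
Proof.
(* With [n.+2] the left endpoint lies strictly below b already for n = 0, as the integration over a
   compact interval requires. *)
move=> c0 b0; pose F (n : nat) : set R := `[b / n.+2%:R, b]%classic.
have -> : (\int[mu]_(t in `]0%R, +oo[) ((t <= b)%R%:R * t `^ (c - 1))%:E =
           \int[mu]_(t in \bigcup_n F n) (t `^ (c - 1))%:E)%E.
  rewrite integral_mkcond [RHS]integral_mkcond; apply: eq_integral => t _.
  rewrite !patchE; case: ifPn => tI; case: ifPn => tU => //.
  - move: tU; rewrite inE => -[n _]; rewrite /F/= in_itv/= => /andP[_ ->].
    by rewrite mul1r.
  - have [tb|] := leP t b; last by rewrite mul0r.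
    move: tI tU; rewrite inE/= in_itv/= andbT => t0.
    rewrite notin_setE => -[]; exists (Num.trunc (b / t)) => //=.
    rewrite /F/= in_itv/= tb andbT ler_pdivrMr// -ler_pdivrMl// mulrC.
    have := @truncnS_gt R (b / t); set k := Num.trunc _ => Hk.
    by rewrite (le_trans (ltW Hk))// ler_nat.
  - move: tU tI; rewrite inE => -[n _]; rewrite /F/= in_itv/= => /andP[bt _].
    rewrite notin_setE => -[] /=; rewrite in_itv/= andbT.
    by rewrite (lt_le_trans _ bt)// divr_gt0.
apply: le_limit_set => //.
- move=> n k nk; apply/subsetPset => x; rewrite /F/= !in_itv/= => /andP[bx ->].
  rewrite andbT (le_trans _ bx)// ler_pM2l// lef_pV2 ?posrE//.
  by rewrite ler_nat !ltnS.
- by move=> n; exact: measurable_itv.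
- by move=> n; apply/measurable_EFinP/measurable_funTS; exact: measurable_powR.
- by move=> x; rewrite lee_fin powR_ge0.
- move=> n; rewrite integral_powR_cc ?gt_eqF ?divr_gt0//; last first.
    by rewrite ltr_pdivrMr// ltr_pMr// ltr1n.
  by rewrite lee_fin ler_pM2r ?invr_gt0// gerBl powR_ge0.
Qed.

Lemma integral_powR_gt (c b : R) : 0 < c -> 0 < b ->
  (\int[mu]_(t in `]0%R, +oo[) ((b < t)%R%:R * t `^ (- c - 1))%:E
    <= (b `^ (- c) / c)%:E)%E.
Proof.
(* Including the endpoint b can only enlarge the integral, so compact intervals may be used for an
   upper bound. *)
move=> c0 b0; pose F (n : nat) : set R := `[b, b + n.+1%:R]%classic.
apply: (@le_trans _ _
    (\int[mu]_(t in \bigcup_n F n) (t `^ (- c - 1))%:E)%E).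
  rewrite integral_mkcond [leRHS]integral_mkcond; apply: ge0_le_integral => //.
  - move=> t _; rewrite patchE; case: ifPn => // _.
    by rewrite lee_fin mulr_ge0// powR_ge0.
  - apply/(measurable_restrictT _ _).1 => //; apply/measurable_EFinP.
    apply: measurable_funM; last by apply: measurable_funTS; exact: measurable_powR.
    by apply: measurable_natr; exact: measurable_fun_ltr.
  - apply/(measurable_restrictT _ _).1;
    first by apply: bigcup_measurable => n _; exact: measurable_itv.
    by apply/measurable_EFinP/measurable_funTS; exact: measurable_powR.
  - move=> t _; rewrite !patchE; case: ifPn => tI; case: ifPn => tU => //.
    + by rewrite lee_fin ler_piMl ?powR_ge0//; case: ltP.
    + have [bt|] := ltP b t; last by rewrite mul0r.
      move: tU; rewrite notin_setE => -[]; exists (Num.trunc (t - b)) => //=.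
      rewrite /F/= in_itv/= (ltW bt)/= -lerBlDl.
      by rewrite ltW// truncnS_gt.
    + by rewrite lee_fin powR_ge0.
apply: le_limit_set => //.
- move=> n k nk; apply/subsetPset => x; rewrite /F/= !in_itv/= => /andP[-> bx].
  by rewrite (le_trans bx)// lerD2l ler_nat ltnS.
- by move=> n; exact: measurable_itv.
- by move=> n; apply/measurable_EFinP/measurable_funTS; exact: measurable_powR.
- by move=> x; rewrite lee_fin powR_ge0.
- move=> n; rewrite integral_powR_cc ?ltrDl ?oppr_eq0 ?gt_eqF//.
  rewrite invrN mulrN -mulNr lee_fin ler_pM2r ?invr_gt0//.
  by rewrite opprB gerBl powR_ge0.
Qed.
End power_integrals.

(** * Balls, separability and joint measurability of the distance *)

Section geometry.
Context {d : measure_display} {R : realType} {X : metricMeasurableType d R}.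
Hypothesis (X_borel : borel_measurable X).

Lemma measurable_ball_borel (x : X) (r : R) : measurable (ball x r).
Proof.
rewrite X_borel; apply: sub_sigma_algebra.
rewrite /= openE => y; rewrite ballEmdist/= => xy.
apply/nbhs_ballP; exists (r - mdist x y); first by rewrite /= subr_gt0.
move=> z; rewrite !ballEmdist/= ltrBrDl; apply: le_lt_trans.
exact: metric_triangle.
Qed.

Lemma measurable_mdistr (x : X) : measurable_fun setT (fun y : X => mdist x y).
Proof.
apply: (measurability _ (RGenInftyO.measurableE R)) => //.
move=> _ [_ [r ->] <-]; rewrite setTI (_ : _ @^-1` _ = ball x r).
  exact: measurable_ball_borel.
by apply/seteqP; split => y; rewrite ballEmdist/= in_itv.
Qed.

Section packing.
Variables (m : {measure set X -> \bar R}) (N : R).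
Hypothesis (m_regular : ahlfors_regular m N).

Lemma ahlfors_sigma_finite : sigma_finite setT m.
Proof.
have [c c0 cm] := m_regular; have x0 : X := point.
exists (fun n => ball x0 n.+1%:R).
  apply/esym/seteqP; split => // y _; exists (Num.trunc (mdist x0 y)) => //.
  by rewrite ballEmdist/= truncnS_gt.
move=> n; split; first exact: measurable_ball_borel.
by have /andP[_ /le_lt_trans] := cm x0 n.+1%:R (ltr0Sn _ _); apply; exact: ltry.
Qed.

(** Volume packing: without a finite net one could keep choosing e-separated points in the ball;
    their balls of radius e / 2 are disjoint, have measure at least [c1] each, and all lie in one
    ball of finite measure. *)
Lemma ball_net (x : X) (r e : R) : 0 < e ->
  exists s : seq X, forall y, mdist x y < r -> exists2 z, z \in s & mdist z y < e.
Proof.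
move=> e0; have [c c0 cm] := m_regular.
apply: contrapT => /forallNP noS.
have {}noS (s : seq X) :
    exists2 y, mdist x y < r & forall z, z \in s -> e <= mdist z y.
  move: (noS s) => /existsNP[y /not_implyP[xy nz]]; exists y => // z zs.
  by rewrite leNgt; apply/negP => zy; apply: nz; exists z.
pose U (s : seq X) := \big[setU/set0]_(z <- s) ball z (e / 2).
have mU s : measurable (U s).
  by apply: bigsetU_measurable => z _; exact: measurable_ball_borel.
pose c1 := c^-1 * (e / 2) `^ N.
have c1_gt0 : 0 < c1 by rewrite mulr_gt0 ?invr_gt0// powR_gt0// divr_gt0.
have pack k : exists s : seq X, (forall z, z \in s -> mdist x z < r) /\
    ((k%:R * c1)%:E <= m (U s))%E.
  elim: k => [|k [s [sr sm]]]; first by exists [::]; rewrite mul0r.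
  have [y xy yz] := noS s; exists (y :: s); split.
    by move=> z; rewrite inE => /predU1P[->|/sr].
  rewrite /U big_cons measureU; [|exact: measurable_ball_borel|exact: mU|]; last first.
    apply/seteqP; split => // w [yw]; rewrite /U => sw.
    have : exists2 z, z \in s & ball z (e / 2) w.
      by move: sw; rewrite -bigcup_seq => -[z zs zw]; exists z.
    move=> [z zs zw]; have := yz _ zs; rewrite leNgt => /negP; apply.
    move: zw yw; rewrite !ballEmdist/= => zw yw.
    rewrite (le_lt_trans (metric_triangle _ w _))// (splitr e) ltrD//.
    by rewrite metric_sym.
  rewrite -natr1 mulrDl mul1r EFinD addeC leeD//.
  by have /andP[] := cm y _ (divr_gt0 e0 (ltr0n R 2)).
(* The absolute value is there because r has no prescribed sign, while regularity speaks of positive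
   radii. *)
pose M := c * (`|r| + e) `^ N.
have bound s : (forall z, z \in s -> mdist x z < r) -> (m (U s) <= M%:E)%E.
  move=> sr.
  have re : 0 < `|r| + e by rewrite ltr_wpDl.
  have /andP[_] := cm x _ re; apply: le_trans; apply: le_measure.
  - by rewrite inE.
  - by rewrite inE; exact: measurable_ball_borel.
  - rewrite /U -bigcup_seq => w [z /= zs]; rewrite !ballEmdist/= => zw.
    rewrite (le_lt_trans (metric_triangle _ z _))// ltrD//.
      by rewrite (lt_le_trans (sr _ zs))// ler_norm.
    by rewrite (lt_trans zw)// ltr_pdivrMr// ltr_pMr// ltr1n.
have [s [/bound]] := pack (Num.trunc (M / c1)).+1.
move=> /[swap] /le_trans/[apply]; rewrite lee_fin -ler_pdivlMr//.
by rewrite leNgt truncnS_gt.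
Qed.

(** The union over n and k of finite nets of mesh 1 / (k + 1) in the ball of radius n about a base
    point. A natural number codes n, k and a position in the net; numbers that code nothing are sent
    to the base point. *)
Lemma ahlfors_dense :
  exists e : nat -> X, forall x r, 0 < r -> exists n, mdist x (e n) < r.
Proof.
have x0 : X := point.
have /choice[s sP] : forall nk : nat * nat, exists s : seq X, forall y,
    mdist x0 y < nk.1%:R -> exists2 z, z \in s & mdist z y < nk.2.+1%:R^-1.
  by move=> nk; apply: ball_net; rewrite invr_gt0.
exists (fun j => if unpickle j is Some (n, k, i) then nth x0 (s (n, k)) i else x0).
move=> x r r0.
pose n := (Num.trunc (mdist x0 x)).+1; pose k := Num.trunc r^-1.
have [|z zs zx] := sP (n, k) x; first by rewrite truncnS_gt.
exists (pickle (n, k, index z (s (n, k)))); rewrite pickleK nth_index//.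
rewrite metric_sym (lt_le_trans zx)// -[leRHS]invrK lef_pV2 ?posrE ?invr_gt0//.
by rewrite ltW// truncnS_gt.
Qed.

(** By density, d(x, y) < r exactly when d(e_n, x) + d(e_n, y) < r for some n. This writes the
    sublevel set as a countable union of sets defined by distances to fixed points. *)
Lemma measurable_mdist :
  measurable_fun setT (fun z : X * X => mdist z.1 z.2).
Proof.
have [e eP] := ahlfors_dense.
apply: (measurability _ (RGenInftyO.measurableE R)) => //.
move=> _ [_ [r ->] <-]; rewrite setTI.
rewrite (_ : _ @^-1` _ = \bigcup_n
    [set z : X * X | mdist (e n) z.1 + mdist (e n) z.2 < r]).
  apply: bigcup_measurable => n _; rewrite -[X in measurable X]setTI.
  pose f (z : X * X) := mdist (e n) z.1 + mdist (e n) z.2.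
  rewrite (_ : [set z | _] = f @^-1` `]-oo, r[); last first.
    by apply/seteqP; split => z; rewrite /= in_itv.
  suff: measurable_fun setT f by apply => //; exact: measurable_itv.
  by apply: measurable_funD; apply: measurableT_comp => //; exact: measurable_mdistr.
apply/seteqP; split => -[x y]/=; rewrite in_itv/=.
  move=> xy; have [|n xn] := eP x ((r - mdist x y) / 2).
    by rewrite divr_gt0// subr_gt0.
  exists n => //=; have yn := metric_triangle (e n) x y.
  by move: xn yn; rewrite (metric_sym x (e n)) /=; lra.
move=> [n _ /=]; apply: le_lt_trans.
by rewrite [mdist (e n) x]metric_sym; exact: metric_triangle.
Qed.

End packing.
End geometry.

(** * Potentials of the model kernel *)

Section potentials.
Context {d : measure_display} {R : realType} {X : metricMeasurableType d R}.
Variables (m : {measure set X -> \bar R}) (N c : R).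
Hypotheses (X_borel : borel_measurable X)
  (m_regular : ahlfors_regular m N) (c_gt0 : 0 < c)
  (m_ball : forall (x : X) r, 0 < r -> (m (ball x r) <= (c * r `^ N)%:E)%E).
Local Notation mu := (@lebesgue_measure R).
Local Notation P := (`]0%R, +oo[%classic : set R).

Definition ball_kernel (x z : X) (t : R) : R :=
  t `^ (- N) * (mdist x z < 4 * t)%R%:R.

(** The density B depends on z and t jointly, and not only through a product u t * g z, because the
    majorant in the (p, q) estimate ties the scale to the height of g. *)
Definition ball_potential (B : X -> R -> R) (x : X) : \bar R :=
  (\int[m]_z \int[mu]_(t in P) (B z t * ball_kernel x z t)%:E)%E.

Let sm := ahlfors_sigma_finite X_borel m_regular.
Let smu : sigma_finite setT mu := @sigma_finiteT _ _ _ mu.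
Let mX := measurable_mdist X_borel m_regular.

Lemma ball_kernel_ge0 x z t : 0 <= ball_kernel x z t.
Proof. by rewrite mulr_ge0 ?powR_ge0. Qed.

Lemma measurable_ball_kernel d' (T : measurableType d') (f g : T -> X) (h : T -> R) :
  measurable_fun setT f -> measurable_fun setT g -> measurable_fun setT h ->
  measurable_fun setT (fun w => ball_kernel (f w) (g w) (h w)).
Proof.
move=> mf mg mh; apply: measurable_funM.
  by apply: (measurableT_comp (measurable_powR _)).
apply: measurable_natr; apply: measurable_fun_ltr.
  exact: (measurableT_comp mX (measurable_fun_pair mf mg)).
exact: measurable_funM.
Qed.

Lemma integral_ball_indic (x : X) (r : R) :
  (\int[m]_z ((mdist x z < r)%R%:R)%:E = m (ball x r))%E.
Proof.
rewrite -[ball x r]setIT -integral_indic//; last exact: measurable_ball_borel.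
apply: eq_integral => z _; rewrite indicE.
suff -> : (z \in (ball x r : set X)) = (mdist x z < r) by [].
by apply/idP/idP; rewrite inE ballEmdist.
Qed.

Let c4 := c * 4 `^ N.
Let c4_gt0 : 0 < c4. Proof. by rewrite mulr_gt0// powR_gt0. Qed.

Lemma integral_ball_kernel_le x t : 0 < t ->
  (\int[m]_z (ball_kernel x z t)%:E <= c4%:E)%E.
Proof.
move=> t0; rewrite /ball_kernel.
rewrite ge0_integralZl_real ?powR_ge0//; last first.
  apply: measurable_natr; apply: measurable_fun_ltr => //.
  exact: measurable_mdistr.
rewrite integral_ball_indic.
have t4 : 0 < 4 * t by rewrite mulr_gt0.
apply: (@le_trans _ _ ((t `^ (- N))%:E * (c * (4 * t) `^ N)%:E)%E).
  by rewrite lee_pmul2l ?lte_fin ?powR_gt0//; exact: m_ball.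
rewrite -EFinM lee_fin powRM ?ler0n ?(ltW t0)//.
rewrite (_ : t `^ (- N) * _ = c4 * (t `^ (- N) * t `^ N)); last by rewrite /c4; ring.
by rewrite -powRD ?addNr ?powRr0 ?mulr1 ?(gt_eqF t0) ?implybT//.
Qed.

Section joint.
Variable B : X -> R -> R.
Hypotheses (mB : measurable_fun [set: X * R] (fun w => B w.1 w.2))
  (B0 : forall z t, 0 <= B z t).

Lemma measurable_ball_integrand x :
  measurable_fun setT (fun w : X * R => (B w.1 w.2 * ball_kernel x w.1 w.2)%:E).
Proof.
apply/measurable_EFinP; apply: measurable_funM => //.
exact: measurable_ball_kernel.
Qed.

Lemma measurable_ball_slice x z :
  measurable_fun P (fun t => (B z t * ball_kernel x z t)%:E).
Proof.
apply: measurable_funTS; apply/measurable_EFinP.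
apply: measurable_funM; last exact: measurable_ball_kernel.
by apply: (measurableT_comp mB (measurable_fun_pair _ _)).
Qed.

Lemma measurable_ball_inner x :
  measurable_fun setT
    (fun z => \int[mu]_(t in P) (B z t * ball_kernel x z t)%:E)%E.
Proof.
apply: measurable_tonelli => //.
- by apply: measurable_funTS; exact: measurable_ball_integrand.
- by move=> z t _; rewrite lee_fin mulr_ge0// ball_kernel_ge0.
Qed.

Lemma measurable_ball_inner2 :
  measurable_fun setT (fun w : X * X =>
    \int[mu]_(t in P) (B w.2 t * ball_kernel w.1 w.2 t)%:E)%E.
Proof.
apply: (@measurable_tonelli _ _ _ _ _ mu smu P
  (fun (w : X * X) t => (B w.2 t * ball_kernel w.1 w.2 t)%:E)) => //; last first.
  by move=> z t _; rewrite lee_fin mulr_ge0// ball_kernel_ge0.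
apply: measurable_funTS; apply/measurable_EFinP; apply: measurable_funM => //.
  apply: (measurableT_comp mB (measurable_fun_pair _ _)) => //.
  exact: measurableT_comp.
apply: measurable_ball_kernel => //; exact: measurableT_comp.
Qed.

Lemma measurable_ball_potential : measurable_fun setT (ball_potential B).
Proof.
apply: (@measurable_tonelli _ _ _ _ _ m sm setT (fun x z =>
  \int[mu]_(t in P) (B z t * ball_kernel x z t)%:E)%E) => //.
- by apply: measurable_funTS; exact: measurable_ball_inner2.
- move=> x z _; apply: integral_ge0 => t _.
  by rewrite lee_fin mulr_ge0// ball_kernel_ge0.
Qed.

Lemma ball_potential_swap x : (ball_potential B x =
  \int[mu]_(t in P) \int[m]_z (B z t * ball_kernel x z t)%:E)%E.
Proof.
apply: (tonelli sm smu) => //.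
- by apply: measurable_funTS; exact: measurable_ball_integrand.
- by move=> z t _; rewrite lee_fin mulr_ge0// ball_kernel_ge0.
Qed.

Lemma ball_potential_ge0 x : (0 <= ball_potential B x)%E.
Proof.
apply: integral_ge0 => z _; apply: integral_ge0 => t _.
by rewrite lee_fin mulr_ge0// ball_kernel_ge0.
Qed.

(** B does not involve x, so x can be integrated first; the distance being symmetric, the kernel has
    mass at most [c4] in its first variable too. *)
Lemma integral_ball_potential_le : (\int[m]_x ball_potential B x <=
  c4%:E * \int[m]_z \int[mu]_(t in P) (B z t)%:E)%E.
Proof.
have mBin : measurable_fun setT (fun z => \int[mu]_(t in P) (B z t)%:E)%E.
  apply: measurable_tonelli => //.
    by apply: measurable_funTS; exact/measurable_EFinP.
  by move=> z t _; rewrite lee_fin.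
rewrite (tonelli sm sm)//; last 2 first.
- by apply: measurable_funTS; exact: measurable_ball_inner2.
- move=> x z _; apply: integral_ge0 => t _.
  by rewrite lee_fin mulr_ge0// ball_kernel_ge0.
rewrite -ge0_integralZl//; last 2 first.
- by move=> z _; apply: integral_ge0 => t _; rewrite lee_fin.
- by rewrite lee_fin ltW.
apply: ge0_le_integral => //.
- move=> z _; apply: integral_ge0 => x _; apply: integral_ge0 => t _.
  by rewrite lee_fin mulr_ge0// ball_kernel_ge0.
- apply: (measurable_tonelli_in sm) => //.
    by apply: measurable_funTS; exact: measurable_ball_inner2.
  move=> x z _; apply: integral_ge0 => t _.
  by rewrite lee_fin mulr_ge0// ball_kernel_ge0.
- exact: measurable_funeM.
move=> z _.
have mBK : measurable_fun setT
    (fun w : X * R => (B z w.2 * ball_kernel w.1 z w.2)%:E).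
  apply/measurable_EFinP; apply: measurable_funM.
    by apply: (measurableT_comp mB (measurable_fun_pair _ _)).
  by apply: measurable_ball_kernel.
have mBz : measurable_fun setT (fun t => (B z t)%:E).
  apply/measurable_EFinP.
  by apply: (measurableT_comp mB (measurable_fun_pair _ _)).
rewrite (tonelli sm smu)//; last 2 first.
- exact: measurable_funTS.
- by move=> x t _; rewrite lee_fin mulr_ge0// ball_kernel_ge0.
rewrite -ge0_integralZl//; last 3 first.
- exact: measurable_funTS.
- by move=> t _; rewrite lee_fin.
- by rewrite lee_fin ltW.
apply: ge0_le_integral => //.
- move=> t _; apply: integral_ge0 => x _.
  by rewrite lee_fin mulr_ge0// ball_kernel_ge0.
- apply: (measurable_tonelli_in sm) => //; first exact: measurable_funTS.
  by move=> x t _; rewrite lee_fin mulr_ge0// ball_kernel_ge0.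
- by apply: measurable_funeM; exact: measurable_funTS.
move=> t; rewrite /= in_itv/= andbT => t0.
rewrite ge0_integralZl_real//; last 2 first.
- by move=> x _; exact: ball_kernel_ge0.
- exact: measurable_ball_kernel.
rewrite muleC lee_wpmul2r ?lee_fin//.
apply: le_trans (integral_ball_kernel_le z t0).
by under eq_integral do rewrite /ball_kernel metric_sym.
Qed.

End joint.

(** Pairs with d(x, z) >= 4 t do not contribute, so B2 may be a version of B1 cut off in space. This
    is how g gets localized near a ball. *)
Lemma le_ball_potential_near (B1 B2 : X -> R -> R) x :
  measurable_fun [set: X * R] (fun w => B1 w.1 w.2) ->
  measurable_fun [set: X * R] (fun w => B2 w.1 w.2) ->
  (forall z t, 0 <= B1 z t) -> (forall z t, 0 <= B2 z t) ->
  (forall z t, 0 < t -> mdist x z < 4 * t -> B1 z t <= B2 z t) ->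
  (ball_potential B1 x <= ball_potential B2 x)%E.
Proof.
move=> mB1 mB2 B10 B20 B12; apply: ge0_le_integral => //.
- move=> z _; apply: integral_ge0 => t _.
  by rewrite lee_fin mulr_ge0// ball_kernel_ge0.
- exact: measurable_ball_inner.
- exact: measurable_ball_inner.
move=> z _; apply: ge0_le_integral => //.
- by move=> t _; rewrite lee_fin mulr_ge0// ball_kernel_ge0.
- exact: measurable_ball_slice.
- exact: measurable_ball_slice.
move=> t; rewrite /= in_itv/= andbT => t0.
rewrite lee_fin; have [xz|xz] := ltP (mdist x z) (4 * t).
  by rewrite ler_wpM2r ?ball_kernel_ge0// B12.
by rewrite /ball_kernel ltNge xz /= !mulr0.
Qed.

Lemma le_ball_potential (B1 B2 : X -> R -> R) x :
  measurable_fun [set: X * R] (fun w => B1 w.1 w.2) ->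
  measurable_fun [set: X * R] (fun w => B2 w.1 w.2) ->
  (forall z t, 0 <= B1 z t) -> (forall z t, 0 <= B2 z t) ->
  (forall z t, 0 < t -> B1 z t <= B2 z t) ->
  (ball_potential B1 x <= ball_potential B2 x)%E.
Proof.
move=> mB1 mB2 B10 B20 B12; apply: le_ball_potential_near => // z t t0 _.
exact: B12.
Qed.

Lemma ball_potentialD (B1 B2 : X -> R -> R) x :
  measurable_fun [set: X * R] (fun w => B1 w.1 w.2) ->
  measurable_fun [set: X * R] (fun w => B2 w.1 w.2) ->
  (forall z t, 0 <= B1 z t) -> (forall z t, 0 <= B2 z t) ->
  (ball_potential (fun z t => B1 z t + B2 z t)%R x =
   ball_potential B1 x + ball_potential B2 x)%E.
Proof.
move=> mB1 mB2 B10 B20; rewrite /ball_potential -ge0_integralD//; last 4 first.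
- move=> z _; apply: integral_ge0 => t _.
  by rewrite lee_fin mulr_ge0// ball_kernel_ge0.
- exact: measurable_ball_inner.
- move=> z _; apply: integral_ge0 => t _.
  by rewrite lee_fin mulr_ge0// ball_kernel_ge0.
- exact: measurable_ball_inner.
apply: eq_integral => z _; rewrite -ge0_integralD//; last 4 first.
- by move=> t _; rewrite lee_fin mulr_ge0// ball_kernel_ge0.
- exact: measurable_ball_slice.
- by move=> t _; rewrite lee_fin mulr_ge0// ball_kernel_ge0.
- exact: measurable_ball_slice.
by apply: eq_integral => t _; rewrite -EFinD -mulrDl.
Qed.

Lemma ball_potentialZ (B : X -> R -> R) k x :
  measurable_fun [set: X * R] (fun w => B w.1 w.2) ->
  (forall z t, 0 <= B z t) -> 0 <= k ->
  (ball_potential (fun z t => k * B z t)%R x = k%:E * ball_potential B x)%E.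
Proof.
move=> mB B0 k0; rewrite /ball_potential -ge0_integralZl//; last 2 first.
- exact: measurable_ball_inner.
- move=> z _; apply: integral_ge0 => t _.
  by rewrite lee_fin mulr_ge0// ball_kernel_ge0.
apply: eq_integral => z _; rewrite -ge0_integralZl//; last 2 first.
- exact: measurable_ball_slice.
- by move=> t _; rewrite lee_fin mulr_ge0// ball_kernel_ge0.
by apply: eq_integral => t _; rewrite -EFinM -mulrA.
Qed.

End potentials.

(** * Powers and the truncation inequality *)

Section powR_lemmas.
Context {R : realType}.
Implicit Types t r s x y : R.

Lemma powR_add t r s : 0 < t -> t `^ (r + s) = t `^ r * t `^ s.
Proof. by move=> t0; rewrite powRD// (gt_eqF t0) implybT. Qed.

Lemma powR_le_neg x y r : 0 < x -> x <= y -> r <= 0 -> y `^ r <= x `^ r.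
Proof.
move=> x0 xy r0; rewrite -[r]opprK !(powRN _ (- r)).
rewrite lef_pV2 ?posrE ?powR_gt0 ?(lt_le_trans x0 xy)//.
by rewrite ge0_ler_powR ?oppr_ge0// nnegrE ltW// (lt_le_trans x0 xy).
Qed.

Lemma powR_le x y r : 0 <= x -> x <= y -> 0 <= r -> x `^ r <= y `^ r.
Proof. by move=> x0 xy r0; rewrite ge0_ler_powR// nnegrE// (le_trans x0 xy). Qed.

(** Above the height s the factor (x / s)^(p-1) is at least 1. The freedom in s is the point: it is
    chosen anew at each use. *)
Lemma le_truncation x s p : 0 <= x -> 0 < s -> 1 <= p ->
  x <= s + s `^ (1 - p) * x `^ p.
Proof.
move=> x0 s0 p1; have [xs|sx] := leP x s.
  by rewrite (le_trans xs)// lerDl mulr_ge0// powR_ge0.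
have {}x0 : 0 < x by exact: lt_trans sx.
apply: (@le_trans _ _ (x `^ (1 - p) * x `^ p)).
  by rewrite -powR_add// subrK powRr1// ltW.
apply: (@le_trans _ _ (s `^ (1 - p) * x `^ p)); last by rewrite lerDr ltW.
by rewrite ler_wpM2r ?powR_ge0// powR_le_neg ?subr_le0 ?(ltW sx).
Qed.

End powR_lemmas.

(** * Potentials of L^p, bounded and integrable densities *)

Section estimates.
Context {d : measure_display} {R : realType} {X : metricMeasurableType d R}.
Variables (m : {measure set X -> \bar R}) (N c : R).
Hypotheses (X_borel : borel_measurable X) (N_gt0 : 0 < N)
  (m_regular : ahlfors_regular m N) (c_gt0 : 0 < c)
  (m_ball : forall (x : X) r, 0 < r -> (m (ball x r) <= (c * r `^ N)%:E)%E).
Local Notation mu := (@lebesgue_measure R).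
Local Notation P := (`]0%R, +oo[%classic : set R).
Local Notation pot := (ball_potential m N).
Local Notation c4 := (c * 4 `^ N).

Lemma integral_ball_le (g : X -> R) p G x r : 1 < p -> measurable_fun setT g ->
  (forall z, 0 <= g z) -> 0 < G -> 0 < r ->
  (\int[m]_z (g z `^ p)%:E <= (G `^ p)%:E)%E ->
  (\int[m]_z ((mdist x z < r)%R%:R * g z)%:E <=
    ((c + 1) * G * r `^ (N - N / p))%:E)%E.
Proof.
move=> p1 mg g0 G0 r0 gG.
(* At this height both terms of the truncation scale like G r^(N - N/p); they account for the c and
   the 1 in the constant. *)
pose s := G * r `^ (- (N / p)).
have s0 : 0 < s by rewrite mulr_gt0// powR_gt0.
have mb : measurable_fun setT (fun z => (mdist x z < r)%R%:R : R).
  by apply: measurable_natr; apply: measurable_fun_ltr => //; exact: measurable_mdistr.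
apply: (@le_trans _ _ (\int[m]_z (s * (mdist x z < r)%R%:R +
    s `^ (1 - p) * g z `^ p)%:E)%E).
  apply: ge0_le_integral => //.
  - by move=> z _; rewrite lee_fin mulr_ge0.
  - by apply/measurable_EFinP; exact: measurable_funM.
  - apply/measurable_EFinP; apply: measurable_funD; apply: measurable_funM => //.
    exact: measurable_powR_comp.
  - move=> z _; rewrite lee_fin; case: ltP => _ /=.
      by rewrite mul1r mulr1 le_truncation ?(ltW p1).
    by rewrite mul0r mulr0 add0r mulr_ge0 ?powR_ge0.
under eq_integral do rewrite EFinD.
rewrite ge0_integralD//; last 4 first.
- by move=> z _; rewrite lee_fin mulr_ge0// ltW.
- by apply/measurable_EFinP; exact: measurable_funM.
- by move=> z _; rewrite lee_fin mulr_ge0// powR_ge0.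
- by apply/measurable_EFinP; apply: measurable_funM => //; exact: measurable_powR_comp.
rewrite !ge0_integralZl_real ?powR_ge0 ?(ltW s0)//; last 2 first.
- by move=> z _; exact: powR_ge0.
- exact: measurable_powR_comp.
rewrite integral_ball_indic//.
have H1 : (s%:E * m (ball x r) <= (s * (c * r `^ N))%:E)%E.
  by rewrite [leRHS]EFinM lee_pmul2l ?lte_fin//; exact: m_ball.
have H2 : ((s `^ (1 - p))%:E * \int[m]_z (g z `^ p)%:E <=
    (s `^ (1 - p) * G `^ p)%:E)%E.
  by rewrite [leRHS]EFinM lee_pmul2l ?lte_fin ?powR_gt0.
apply: le_trans (leeD H1 H2) _; rewrite -EFinD lee_fin le_eqVlt; apply/orP; left.
have p0 : p != 0 by rewrite gt_eqF// (lt_trans ltr01).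
have -> : s `^ (1 - p) * G `^ p = G * r `^ (N - N / p).
  rewrite /s powRM ?powR_ge0 ?(ltW G0)// -powRrM mulrAC -powR_add//.
  rewrite subrK powRr1 ?(ltW G0)//; congr (_ * _ `^ _).
  by field.
by rewrite addrC (powR_add _ _ r0) /s; apply/eqP; ring.
Qed.

(** At each scale Hoelder's inequality on the ball of radius 4 t yields the factor t^(-N/p). Whether
    the remaining integral converges is left to u, so the lemma serves for large scales, small
    scales and all scales alike. *)
Lemma potential_far_le (u : R -> R) (g : X -> R) p G x : 1 < p ->
  measurable_fun setT u -> (forall t, 0 <= u t) ->
  measurable_fun setT g -> (forall z, 0 <= g z) -> 0 < G ->
  (\int[m]_z (g z `^ p)%:E <= (G `^ p)%:E)%E ->
  (pot (fun z t => u t * g z)%R x <=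
   ((c + 1) * 4 `^ (N - N / p) * G)%:E *
   \int[mu]_(t in P) (u t * t `^ (- (N / p)))%:E)%E.
Proof.
move=> p1 mu_ u0 mg g0 G0 gG.
have mB := measurable_tensor mu_ mg.
have B0 z t : 0 <= u t * g z by rewrite mulr_ge0.
have mut e : measurable_fun setT (fun t => u t * t `^ e).
  by apply: measurable_funM => //; exact: measurable_powR.
rewrite (ball_potential_swap X_borel m_regular mB B0).
rewrite -ge0_integralZl_real//; last 3 first.
- by rewrite !mulr_ge0 ?powR_ge0 ?addr_ge0 ?(ltW G0) ?(ltW c_gt0).
- by move=> t _; rewrite mulr_ge0 ?powR_ge0.
- by apply: measurable_funTS; exact: mut.
apply: ge0_le_integral => //.
- move=> t _; apply: integral_ge0 => z _.
  by rewrite lee_fin mulr_ge0// ball_kernel_ge0.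
- apply: (measurable_tonelli_in (ahlfors_sigma_finite X_borel m_regular)) => //.
    by apply: measurable_funTS;
      exact: (measurable_ball_integrand X_borel m_regular (B := fun z t => u t * g z) mB x).
  by move=> z t _; rewrite lee_fin mulr_ge0// ball_kernel_ge0.
- apply: measurable_funTS; apply/measurable_EFinP.
  by apply: measurable_funM => //; exact: mut.
move=> t; rewrite /= in_itv/= andbT => t0.
rewrite (_ : (fun z => _) =
    fun z => (u t * t `^ (- N) * ((mdist x z < 4 * t)%R%:R * g z))%:E); last first.
  by apply/funext => z; rewrite /ball_kernel; congr EFin; ring.
have t4 : 0 < 4 * t by rewrite mulr_gt0.
rewrite ge0_integralZl_real ?mulr_ge0 ?powR_ge0//; last 2 first.
- by move=> z _; rewrite mulr_ge0.
- apply: measurable_funM => //; apply: measurable_natr.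
  by apply: measurable_fun_ltr => //; exact: measurable_mdistr.
apply: le_trans; first apply: lee_wpmul2l.
- by rewrite lee_fin mulr_ge0// powR_ge0.
- exact: (@integral_ball_le g p G x _ p1 mg g0 G0 t4 gG).
rewrite -EFinM lee_fin le_eqVlt; apply/orP; left; apply/eqP.
rewrite powRM ?(ltW t0)//.
rewrite [t `^ (N - _)]powR_add//.
rewrite (_ : u t * t `^ (- N) * _ = (c + 1) * 4 `^ (N - N / p) * G *
  (u t * (t `^ (- N) * t `^ N * t `^ (- (N / p))))); last by ring.
by rewrite -powR_add// addNr powRr0 mul1r.
Qed.

Lemma potential_cst_le (u : R -> R) s x : measurable_fun setT u -> (forall t, 0 <= u t) ->
  0 <= s ->
  (pot (fun z t => u t * s)%R x <= (c4 * s)%:E * \int[mu]_(t in P) (u t)%:E)%E.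
Proof.
move=> mu_ u0 s0.
have mB := measurable_tensor mu_ (@measurable_cst _ _ X _ setT s).
have B0 (z : X) t : 0 <= u t * s by rewrite mulr_ge0.
rewrite (ball_potential_swap X_borel m_regular mB B0).
have c40 : 0 <= c4 by rewrite mulr_ge0 ?powR_ge0// ltW.
rewrite -ge0_integralZl_real//; last 2 first.
- by rewrite mulr_ge0.
- exact: measurable_funTS.
apply: ge0_le_integral => //.
- move=> t _; apply: integral_ge0 => z _.
  by rewrite lee_fin mulr_ge0 ?(B0 x) ?ball_kernel_ge0.
- apply: (measurable_tonelli_in (ahlfors_sigma_finite X_borel m_regular)) => //.
    by apply: measurable_funTS;
      exact: (measurable_ball_integrand X_borel m_regular (B := fun=> fun t => u t * s) mB x).
  by move=> z t _; rewrite lee_fin mulr_ge0 ?(B0 x) ?ball_kernel_ge0.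
- by apply: measurable_funTS; apply/measurable_EFinP; exact: measurable_funM.
move=> t; rewrite /= in_itv/= andbT => t0.
rewrite ge0_integralZl_real//; last 2 first.
- by move=> z _; exact: ball_kernel_ge0.
- exact: (measurable_ball_kernel X_borel m_regular).
apply: le_trans; first apply: lee_wpmul2l.
- by rewrite lee_fin mulr_ge0.
- exact: (integral_ball_kernel_le X_borel m_ball x t0).
by rewrite -EFinM lee_fin mulrC [u t * s]mulrC mulrA.
by rewrite mulr_ge0.
Qed.

Lemma integral_potential_le (u : R -> R) (g : X -> R) :
  measurable_fun setT u -> (forall t, 0 <= u t) ->
  measurable_fun setT g -> (forall z, 0 <= g z) ->
  (\int[m]_x pot (fun z t => u t * g z)%R x <=
   c4%:E * (\int[mu]_(t in P) (u t)%:E * \int[m]_z (g z)%:E))%E.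
Proof.
move=> mu_ u0 mg g0.
have mB := measurable_tensor mu_ mg.
have B0 z t : 0 <= u t * g z by rewrite mulr_ge0.
apply: le_trans (integral_ball_potential_le X_borel m_regular c_gt0 m_ball mB B0) _.
apply: lee_wpmul2l; first by rewrite lee_fin mulr_ge0 ?powR_ge0// ltW.
rewrite -ge0_integralZl//; last 3 first.
- exact/measurable_EFinP.
- by move=> z _; rewrite lee_fin.
- by apply: integral_ge0 => t _; rewrite lee_fin.
rewrite le_eqVlt; apply/orP; left; apply/eqP; apply: eq_integral => z _.
rewrite muleC -ge0_integralZl_real//; last exact: measurable_funTS.
by apply: eq_integral => t _; rewrite mulrC.
Qed.

End estimates.

(** * The bound from L^p to L^p *)

Section schur.
Context {d : measure_display} {R : realType} {X : metricMeasurableType d R}.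
Variables (m : {measure set X -> \bar R}) (N c : R).
Hypotheses (X_borel : borel_measurable X) (N_gt0 : 0 < N)
  (m_regular : ahlfors_regular m N) (c_gt0 : 0 < c)
  (m_ball : forall (x : X) r, 0 < r -> (m (ball x r) <= (c * r `^ N)%:E)%E).
Local Notation mu := (@lebesgue_measure R).
Local Notation P := (`]0%R, +oo[%classic : set R).
Local Notation pot := (ball_potential m N).
Local Notation c4 := (c * 4 `^ N).

(** The truncation height follows f x from point to point. The absorption is legitimate because f x
    is a real number, even where the potential of g is infinite. *)
Lemma strong_type_pp (u : R -> R) (I k p : R) : 1 < p ->
  measurable_fun setT u -> (forall t, 0 <= u t) ->
  0 < I -> (\int[mu]_(t in P) (u t)%:E <= I%:E)%E -> 0 < k ->
  exists2 C : R, 0 < C & forall f g : X -> R,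
    measurable_fun setT f -> (forall x, 0 <= f x) ->
    measurable_fun setT g -> (forall x, 0 <= g x) ->
    {ae m, forall x, ((f x)%:E <= k%:E * pot (fun z t => u t * g z)%R x)%E} ->
    (\int[m]_x (f x `^ p)%:E <= C%:E * \int[m]_x (g x `^ p)%:E)%E.
Proof.
move=> p1 mu_ u0 I0 uI k0.
have p0 : 0 < p by exact: lt_trans p1.
have c40 : 0 < c4 by rewrite mulr_gt0// powR_gt0.
(* With this [e], truncating [g] at [e * f x] makes the bounded part contribute
   at most [f x / 2]. *)
pose e := (2 * k * c4 * I)^-1.
have e0 : 0 < e by rewrite invr_gt0 !mulr_gt0.
pose D := 2 * k * e `^ (1 - p).
have D0 : 0 < D by rewrite !mulr_gt0// powR_gt0.
exists (D * (c4 * I)); first by rewrite mulr_gt0// mulr_gt0.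
move=> f g mf f0 mg g0 fg.
have mgp := measurable_powR_comp p mg.
have gp0 x : 0 <= g x `^ p by exact: powR_ge0.
have mBp := measurable_tensor mu_ mgp.
have Bp0 z t : 0 <= u t * g z `^ p by rewrite mulr_ge0.
have mcst s : measurable_fun [set: X * R] (fun w => u w.2 * s).
  by apply: measurable_funM => //; exact: (measurableT_comp mu_).
have pointwise x : ((f x)%:E <= k%:E * pot (fun z t => u t * g z)%R x)%E ->
    ((f x `^ p)%:E <= D%:E * pot (fun z t => u t * g z `^ p)%R x)%E.
  have := f0 x; rewrite le_eqVlt => /predU1P[<- _|fx0].
    rewrite powR0 ?gt_eqF// mule_ge0 ?lee_fin ?(ltW D0)//.
    exact: ball_potential_ge0.
  pose s := e * f x; have s0 : 0 < s by rewrite mulr_gt0.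
  have H : (pot (fun z t => u t * g z)%R x <= (c4 * s * I)%:E +
      (s `^ (1 - p))%:E * pot (fun z t => u t * g z `^ p)%R x)%E.
    apply: (@le_trans _ _ (pot (fun z t => u t * s +
        s `^ (1 - p) * (u t * g z `^ p))%R x)).
      apply: (le_ball_potential X_borel m_regular) => //.
      - exact: measurable_tensor.
      - apply: measurable_funD; first exact: mcst.
        by apply: measurable_funM.
      - by move=> z t; rewrite mulr_ge0.
      - by move=> z t; rewrite addr_ge0// mulr_ge0 ?powR_ge0// ltW.
      - move=> z t _; rewrite [s `^ _ * _]mulrCA -mulrDr ler_wpM2l//.
        by apply: le_truncation => //; exact: ltW.
    rewrite (@ball_potentialD _ _ _ _ _ X_borel m_regular (fun=> fun t => u t * s)
      (fun z t => s `^ (1 - p) * (u t * g z `^ p)) x (mcst s) _ _ _); last 3 first.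
    - by apply: measurable_funM.
    - by move=> z t; rewrite mulr_ge0// ltW.
    - by move=> z t; rewrite mulr_ge0 ?powR_ge0.
    rewrite (@ball_potentialZ _ _ _ _ _ X_borel m_regular
      (fun z t => u t * g z `^ p))// ?powR_ge0//.
    apply: leeD => //.
    apply: le_trans (potential_cst_le X_borel m_regular c_gt0 m_ball x mu_ u0 (ltW s0)) _.
    rewrite [leRHS]EFinM; apply: lee_wpmul2l => //.
    by rewrite lee_fin mulr_ge0 ?(ltW s0) ?(ltW c40).
  (* If the potential of g^p is infinite there is nothing to prove; otherwise all terms are real and
     f x / 2 can be subtracted. *)
  have := ball_potential_ge0 m N Bp0 x.
  set Q := pot (fun z t => u t * g z `^ p) x in H *; move: H; case: Q => [Q| |]//;
    last first.
    by move=> _ _ _; rewrite gt0_muley ?lte_fin// leey.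
  move=> H _ fk; have kE : (0 <= k%:E)%E by rewrite lee_fin ltW.
  move: (le_trans fk (lee_wpmul2l kE H)).
  rewrite -!EFinM !lee_fin => {}H.
  have H2 : k * (c4 * s * I) = f x / 2.
    rewrite /s /e; field; do ?[apply/andP; split]; exact: lt0r_neq0.
  have {H2} H3 : f x <= 2 * k * s `^ (1 - p) * Q.
    by move: H; rewrite mulrDr H2; lra.
  (* Multiplication by (f x)^(p-1) cancels the power (f x)^(1-p) contained in s^(1-p). *)
  rewrite -(mulr_powRB1 (ltW fx0) p0).
  apply: (@le_trans _ _ (2 * k * s `^ (1 - p) * Q * f x `^ (p - 1))).
    by rewrite ler_wpM2r ?powR_ge0.
  rewrite /s powRM ?(ltW e0) ?(ltW fx0)// le_eqVlt; apply/orP; left; apply/eqP.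
  transitivity (D * Q * (f x `^ (1 - p) * f x `^ (p - 1))); first by rewrite /D; ring.
  by rewrite -powR_add// addrC subrKA subrr powRr0 mulr1.
apply: (@le_trans _ _ (\int[m]_x (D%:E * pot (fun z t => u t * g z `^ p)%R x))%E).
  apply: ae_ge0_le_integral => //.
  - by move=> x _; rewrite lee_fin powR_ge0.
  - by apply/measurable_EFinP; exact: measurable_powR_comp.
  - by move=> x _; rewrite mule_ge0 ?lee_fin ?(ltW D0)// ball_potential_ge0.
  - by apply: measurable_funeM; exact: (measurable_ball_potential X_borel m_regular).
  - by apply: filterS fg => x fgx _; exact: pointwise.
rewrite ge0_integralZl//; last 3 first.
- exact: (measurable_ball_potential X_borel m_regular).
- by move=> x _; exact: ball_potential_ge0.
- by rewrite lee_fin ltW.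
have -> S : ((D * (c4 * I))%:E * S = D%:E * (c4%:E * (I%:E * S)))%E.
  by rewrite !muleA -!EFinM !mulrA.
apply: lee_wpmul2l; first by rewrite lee_fin ltW.
apply: le_trans (integral_potential_le X_borel m_regular c_gt0 m_ball mu_ u0 mgp gp0) _.
apply: lee_wpmul2l; first by rewrite lee_fin ltW.
apply: lee_wpmul2r => //.
by apply: integral_ge0 => x _; rewrite lee_fin.
Qed.

End schur.

(** * The bound from L^p to L^q for q > p, of Hardy-Littlewood-Sobolev type *)

Section hls.
Context {d : measure_display} {R : realType} {X : metricMeasurableType d R}.
Variables (m : {measure set X -> \bar R}) (N c : R).
Hypotheses (X_borel : borel_measurable X) (N_gt0 : 0 < N)
  (m_regular : ahlfors_regular m N) (c_gt0 : 0 < c)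
  (m_ball : forall (x : X) r, 0 < r -> (m (ball x r) <= (c * r `^ N)%:E)%E).
Local Notation mu := (@lebesgue_measure R).
Local Notation P := (`]0%R, +oo[%classic : set R).
Local Notation pot := (ball_potential m N).
Local Notation c4 := (c * 4 `^ N).

Variables (p q k : R).
Hypotheses (p_gt1 : 1 < p) (pq : p < q) (k_gt0 : 0 < k).

Let a := N / p - N / q.
Let b := N - N / p.
(** The solution of (q / p) * e = q - 1: it converts a bound on y^(q/p) into one on y^(q-1). *)
Let e := p * (q - 1) / q.
Let K1 := (c + 1) * 4 `^ (N - N / p).
Let K2 := 4 * k * K1 * (q / N).
(** [K2] and [K3] are read off the two thresholds chosen further on: the radius satisfies rho^(-N/q)
    = y / K2, and inserting this in the height gives tau = y^(q/p) / K3. *)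
Let K3 := 4 * k * c4 * K2 `^ (q / p - 1) / a.
Let C1 := K3 `^ e.
Let C2 := K2 `^ (q - 1).

Let p0 : 0 < p. Proof. exact: lt_trans p_gt1. Qed.
Let q1 : 1 < q. Proof. exact: lt_trans pq. Qed.
Let q0 : 0 < q. Proof. exact: lt_trans q1. Qed.
Let a0 : 0 < a.
Proof. by rewrite subr_gt0 ltr_pM2l// ltf_pV2 ?posrE. Qed.
Let b0 : 0 < b.
Proof. by rewrite subr_gt0 ltr_pdivrMr// ltr_pMr. Qed.
Let e0 : 0 < e. Proof. by rewrite divr_gt0// mulr_gt0// subr_gt0. Qed.
Let c40 : 0 < c4. Proof. by rewrite mulr_gt0// powR_gt0. Qed.
Let K10 : 0 < K1. Proof. by rewrite mulr_gt0 ?powR_gt0// addr_gt0. Qed.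
Let K20 : 0 < K2. Proof. by rewrite mulr_gt0 ?divr_gt0// mulr_gt0// mulr_gt0. Qed.
Let K30 : 0 < K3. Proof.
by rewrite divr_gt0// mulr_gt0 ?powR_gt0// mulr_gt0 ?c40// mulr_gt0.
Qed.
Let C10 : 0 < C1. Proof. exact: powR_gt0. Qed.
Let C20 : 0 < C2. Proof. exact: powR_gt0. Qed.
Let N_neq0 : N != 0. Proof. by rewrite gt_eqF. Qed.
Let p_neq0 : p != 0. Proof. by rewrite gt_eqF. Qed.
Let q_neq0 : q != 0. Proof. by rewrite gt_eqF. Qed.

Let lo (r t : R) : R := (t <= r)%R%:R * t `^ (a - 1).
Let hi (r t : R) : R := (r < t)%R%:R * t `^ (a - 1).

Let mlo r : measurable_fun setT (lo r).
Proof.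
apply: measurable_funM; last exact: measurable_powR.
by apply: measurable_natr; exact: measurable_fun_ler.
Qed.
Let mhi r : measurable_fun setT (hi r).
Proof.
apply: measurable_funM; last exact: measurable_powR.
by apply: measurable_natr; exact: measurable_fun_ltr.
Qed.
Let lo0 r t : 0 <= lo r t. Proof. by rewrite mulr_ge0// powR_ge0. Qed.
Let hi0 r t : 0 <= hi r t. Proof. by rewrite mulr_ge0// powR_ge0. Qed.

(* Where [t <= rho] and [tau < g z], the second condition bounds [y] by a power
   of [g z] and the first by a power of [t]; the two bounds cross over at
   [t = g z `^ (- (p / N))]. *)
Definition hls_majorant (g : X -> R) (z : X) (t : R) : R :=
  C1 * (g z * g z `^ e) * ((t <= g z `^ (- (p / N)))%R%:R * t `^ (a - 1)) +
  C2 * g z * ((g z `^ (- (p / N)) < t)%R%:R * t `^ (- b - 1)).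

Lemma hls_majorant_ge0 g z t : (forall z, 0 <= g z) -> 0 <= hls_majorant g z t.
Proof.
move=> g0; rewrite addr_ge0// mulr_ge0//.
- by rewrite mulr_ge0 ?(ltW C10)// mulr_ge0 ?powR_ge0.
- by rewrite mulr_ge0 ?powR_ge0.
- by rewrite mulr_ge0 ?(ltW C20).
- by rewrite mulr_ge0 ?powR_ge0.
Qed.

Lemma measurable_hls_majorant g : measurable_fun setT g ->
  measurable_fun [set: X * R] (fun w => hls_majorant g w.1 w.2).
Proof.
move=> mg.
have mg1 : measurable_fun [set: X * R] (fun w => g w.1) by exact: measurableT_comp.
have mgp r : measurable_fun [set: X * R] (fun w => g w.1 `^ r).
  by apply: (measurableT_comp (measurable_powR _)).
have mtp r : measurable_fun [set: X * R] (fun w => w.2 `^ r).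
  by apply: (measurableT_comp (measurable_powR _)).
apply: measurable_funD; apply: measurable_funM.
- by apply: measurable_funM => //; exact: measurable_funM.
- apply: measurable_funM => //; apply: measurable_natr.
  exact: measurable_fun_ler.
- exact: measurable_funM.
- apply: measurable_funM => //; apply: measurable_natr.
  exact: measurable_fun_ltr.
Qed.

Section pointwise.
Variables (g : X -> R) (x : X) (y : R).
Hypotheses (mg : measurable_fun setT g) (g0 : forall z, 0 <= g z)
  (g1 : (\int[m]_z (g z `^ p)%:E <= 1)%E) (y0 : 0 < y).

(* [rho] is the scale beyond which Hoelder's inequality leaves only [y / (4 k)],
   and [tau] the height at which the part of [g] below it contributes as much
   at the scales up to [rho]. *)
Let rho := (K2 / y) `^ (q / N).
Let tau := a * y / (4 * k * c4 * rho `^ a).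

Let K2y : 0 < K2 / y. Proof. exact: divr_gt0. Qed.
Let rho0 : 0 < rho. Proof. exact: powR_gt0. Qed.
Let rhoa0 : 0 < rho `^ a. Proof. exact: powR_gt0. Qed.
Let tau0 : 0 < tau. Proof.
apply: divr_gt0; first exact: mulr_gt0.
by apply: mulr_gt0 => //; apply: mulr_gt0 => //; exact: mulr_gt0.
Qed.

Let rho_exp : rho `^ (- (N / q)) = y / K2.
Proof.
rewrite /rho -powRrM (_ : q / N * _ = -1); last by field; rewrite ?N_neq0 ?q_neq0.
by rewrite powR_inv1 ?(ltW K2y)// invf_div.
Qed.

Let rho_a : rho `^ a = K2 `^ (q / p - 1) * y `^ (- (q / p - 1)).
Proof.
rewrite /rho -powRrM (_ : q / N * a = q / p - 1); last first.
  by rewrite /a; field; rewrite ?N_neq0 ?q_neq0 ?p_neq0.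
rewrite powRM ?invr_ge0 ?(ltW K20) ?(ltW y0)//; congr (_ * _).
by rewrite -[y^-1]powR_inv1 ?(ltW y0)// -powRrM mulN1r.
Qed.

Lemma hls_far : (pot (fun z t => hi rho t * g z)%R x <= (y / (4 * k))%:E)%E.
Proof.
have := potential_far_le X_borel m_regular c_gt0 m_ball x p_gt1 (mhi rho) (hi0 rho)
  mg g0 (@ltr01 R).
rewrite powR1 => /(_ g1); rewrite mulr1 => /le_trans; apply.
apply: (@le_trans _ _ (K1%:E * (rho `^ (- (N / q)) / (N / q))%:E)%E).
  apply: lee_wpmul2l; first by rewrite lee_fin ltW.
  apply: le_trans (integral_powR_gt (divr_gt0 N_gt0 q0) rho0).
  rewrite le_eqVlt; apply/orP; left; apply/eqP; apply: eq_integral => t.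
  rewrite inE/= in_itv/= andbT => t0; congr EFin.
  rewrite /hi -mulrA -powR_add//; congr (_ * _ `^ _).
  by rewrite /a; ring.
rewrite -EFinM lee_fin rho_exp le_eqVlt; apply/orP; left; apply/eqP.
rewrite /K2; field; rewrite !gt_eqF//.
Qed.

Lemma hls_low : (pot (fun z t => lo rho t * tau)%R x <= (y / (4 * k))%:E)%E.
Proof.
have := potential_cst_le X_borel m_regular c_gt0 m_ball x (mlo rho) (lo0 rho) (ltW tau0).
move/le_trans; apply.
apply: (@le_trans _ _ ((c4 * tau)%:E * (rho `^ a / a)%:E)%E).
  apply: lee_wpmul2l; first by rewrite lee_fin mulr_ge0 ?ltW.
  exact: (integral_powR_le a0 rho0).
rewrite -EFinM lee_fin le_eqVlt; apply/orP; left; apply/eqP.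
rewrite /tau; field; rewrite !gt_eqF//.
Qed.

Let gtau z := (tau < g z)%R%:R * g z.

Lemma hls_main z t : 0 < t ->
  y `^ (q - 1) * (lo rho t * gtau z) <= hls_majorant g z t.
Proof.
move=> t0; rewrite /lo /gtau.
have [tr|tr] := leP t rho; last first.
  by rewrite !mul0r mulr0 hls_majorant_ge0.
have [gt|gt] := ltP tau (g z); last first.
  by rewrite !mul0r !mulr0 hls_majorant_ge0.
rewrite !mul1r.
have gz0 : 0 < g z by exact: lt_trans gt.
have q10 : 0 <= q - 1 by rewrite subr_ge0 ltW.
have [tg|tg] := leP t (g z `^ (- (p / N))).
- rewrite /hls_majorant tg ltNge tg /= mul0r mulr0 addr0 mul1r.
  have yg : y `^ (q / p) <= K3 * g z.
    rewrite /K3; move: gt; rewrite /tau rho_a ltr_pdivrMr; last first.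
      by rewrite -rho_a !mulr_gt0.
    move=> /ltW H; rewrite mulrAC ler_pdivlMr//.
    rewrite (_ : q / p = 1 + (q / p - 1)); last by ring.
    rewrite powR_add// powRr1 ?(ltW y0)// (_ : 1 + _ - 1 = q / p - 1); last by ring.
    have := ler_wpM2r (powR_ge0 y (q / p - 1)) H.
    rewrite (_ : y * _ * a = a * y * y `^ (q / p - 1)); last by ring.
    move/le_trans; apply.
    rewrite [leLHS](_ : _ = 4 * k * c4 * K2 `^ (q / p - 1) * g z *
      (y `^ (- (q / p - 1)) * y `^ (q / p - 1))); last by ring.
    by rewrite -powR_add// addNr powRr0 mulr1.
  have ye : y `^ (q - 1) <= C1 * g z `^ e.
    have := powR_le (powR_ge0 _ _) yg (ltW e0).
    rewrite -powRrM (_ : q / p * e = q - 1);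
      last by rewrite /e; field; rewrite ?N_neq0 ?q_neq0 ?p_neq0.
    by rewrite powRM ?(ltW K30).
  rewrite (_ : C1 * _ * _ = C1 * g z `^ e * (t `^ (a - 1) * g z)); last by ring.
  by rewrite ler_wpM2r// mulr_ge0 ?powR_ge0.
- rewrite /hls_majorant (leNgt t (g z `^ _)) tg /= mul0r mulr0 add0r mul1r.
  have yt : y <= K2 * t `^ (- (N / q)).
    have : rho `^ (- (N / q)) <= t `^ (- (N / q)).
      by rewrite powR_le_neg// oppr_le0 divr_ge0// ltW.
    by rewrite rho_exp ler_pdivrMr// mulrC.
  have yq : y `^ (q - 1) <= C2 * t `^ (- (N / q) * (q - 1)).
    have := powR_le (ltW y0) yt q10.
    by rewrite powRM ?powR_ge0 ?(ltW K20)// -powRrM.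
  (* The terms in q cancel: the bound on y^(q-1) together with the weight t^(a-1) leaves the decay
     rate N - N/p, whatever q is. *)
  rewrite (_ : - b - 1 = - (N / q) * (q - 1) + (a - 1)); last first.
    by rewrite /a /b; field; rewrite ?N_neq0 ?q_neq0 ?p_neq0.
  rewrite (powR_add (- (N / q) * (q - 1)))//.
  rewrite (_ : C2 * _ * _ = C2 * t `^ (- (N / q) * (q - 1)) *
    (t `^ (a - 1) * g z)); last by ring.
  by rewrite ler_wpM2r// mulr_ge0 ?powR_ge0.
Qed.

(** The large scales and the part of g below tau cost y / (4 k) each, hence y / 2 together after
    multiplication by k. Absorbing them leaves y <= 2 k M, which is then multiplied by y^(q-1). *)
Lemma hls_pointwise :
  (y%:E <= k%:E * pot (fun z t => t `^ (a - 1) * g z)%R x)%E ->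
  ((y `^ q)%:E <= (2 * k)%:E * pot (hls_majorant g) x)%E.
Proof.
move=> yk.
have mgtau : measurable_fun setT gtau.
  apply: measurable_funM => //; apply: measurable_natr.
  exact: measurable_fun_ltr.
have gtau_ge0 z : 0 <= gtau z by rewrite mulr_ge0.
have mtau : measurable_fun [set: X * R] (fun w => lo rho w.2 * tau).
  by apply: measurable_funM => //; exact: (measurableT_comp (mlo rho)).
have mhig : measurable_fun [set: X * R] (fun w => hi rho w.2 * g w.1).
  exact: measurable_tensor.
have mlog : measurable_fun [set: X * R] (fun w => lo rho w.2 * gtau w.1).
  exact: measurable_tensor.
have hig0 (z : X) t : 0 <= hi rho t * g z by rewrite mulr_ge0.
have lotau0 (z : X) t : 0 <= lo rho t * tau by rewrite mulr_ge0// ltW.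
have log0 (z : X) t : 0 <= lo rho t * gtau z by rewrite mulr_ge0.
set M := pot (fun z t => lo rho t * gtau z) x.
have H : (pot (fun z t => t `^ (a - 1) * g z)%R x <=
    (y / (4 * k))%:E + ((y / (4 * k))%:E + M))%E.
  apply: (@le_trans _ _ (pot (fun z t =>
      hi rho t * g z + (lo rho t * tau + lo rho t * gtau z))%R x)).
    apply: (le_ball_potential X_borel m_regular) => //.
    - by apply: (@measurable_tensor _ _ _ _ _ (fun t => t `^ (a - 1))) => //;
        exact: measurable_powR.
    - by apply: measurable_funD => //; exact: measurable_funD.
    - by move=> z t; rewrite mulr_ge0 ?powR_ge0.
    - by move=> z t; rewrite addr_ge0 ?hig0// addr_ge0 ?log0// (lotau0 z).
    - move=> z t t0; rewrite /hi /lo /gtau; case: (ltP rho t) => rt.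
        by rewrite mul1r !mul0r !addr0.
      rewrite !mul0r add0r !mul1r -mulrDr ler_wpM2l ?powR_ge0//.
      by case: ltP => gt; rewrite ?mul1r ?mul0r ?addr0// lerDr ltW.
  rewrite (@ball_potentialD _ _ _ _ _ X_borel m_regular (fun z t => hi rho t * g z)
    (fun z t => lo rho t * tau + lo rho t * gtau z) x mhig _ hig0 _); last 2 first.
  - exact: measurable_funD.
  - by move=> z t; rewrite addr_ge0 ?log0// (lotau0 z).
  rewrite (@ball_potentialD _ _ _ _ _ X_borel m_regular
    (fun=> fun t => lo rho t * tau)
    (fun z t => lo rho t * gtau z) x mtau mlog lotau0 log0).
  apply: leeD; first exact: hls_far.
  by apply: leeD => //; exact: hls_low.
apply: (@le_trans _ _ ((2 * k)%:E * ((y `^ (q - 1))%:E * M))%E).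
  have M0 : (0 <= M)%E by exact: ball_potential_ge0.
  have kE : (0 <= k%:E)%E by rewrite lee_fin ltW.
  move: H M0; case: M => [M| |]// H M0; last first.
    by rewrite gt0_muley ?lte_fin ?powR_gt0// gt0_muley ?lte_fin ?mulr_gt0// leey.
  move: (le_trans yk (lee_wpmul2l kE H)).
  rewrite -!EFinD -!EFinM !lee_fin => {}H.
  have {}H : y <= 2 * k * M.
    move: H; rewrite !mulrDr (_ : k * (y / (4 * k)) = y / 4); first lra.
    by field; rewrite gt_eqF.
  rewrite -(mulr_powRB1 (ltW y0) q0) (_ : 2 * k * (_ * M) = 2 * k * M * y `^ (q - 1)).
    by rewrite ler_wpM2r ?powR_ge0.
  by ring.
apply: lee_wpmul2l; first by rewrite lee_fin ltW// mulr_gt0.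
rewrite /M -(ball_potentialZ X_borel m_regular) ?powR_ge0//.
apply: (le_ball_potential X_borel m_regular) => //.
- exact: measurable_funM.
- exact: measurable_hls_majorant.
- by move=> z t; rewrite mulr_ge0 ?powR_ge0.
- by move=> z t; exact: hls_majorant_ge0.
- exact: hls_main.
Qed.

End pointwise.

(** The two halves integrate to powers of g z with exponents 1 + e - (p / N) a and 1 + (p / N) b,
    and both are equal to p. Convergence at 0 is a > 0, that is p < q; convergence at infinity is b
    > 0, that is 1 < p. *)
Lemma integral_hls_majorant g z : (forall z, 0 <= g z) ->
  (\int[mu]_(t in P) (hls_majorant g z t)%:E <= ((C1 / a + C2 / b) * g z `^ p)%:E)%E.
Proof.
move=> g0; have := g0 z; rewrite le_eqVlt => /predU1P[gz|gz].
  (* At g z = 0 the crossover scale takes the conventional value 0 instead of +oo, but each half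
     carries a factor g z and vanishes. *)
  rewrite integral0_eq;
    first by rewrite lee_fin mulr_ge0 ?powR_ge0// addr_ge0// divr_ge0// ltW.
  by move=> t _; rewrite /hls_majorant -gz !(mul0r,mulr0) addr0.
have mtp (r : R) : measurable_fun P (fun t => t `^ r).
  by apply: measurable_funTS; exact: measurable_powR.
have m1 : measurable_fun P (fun t => (t <= g z `^ (- (p / N)))%R%:R * t `^ (a - 1)).
  by apply: measurable_funM => //; apply: measurable_natr; exact: measurable_fun_ler.
have m2 : measurable_fun P (fun t => (g z `^ (- (p / N)) < t)%R%:R * t `^ (- b - 1)).
  by apply: measurable_funM => //; apply: measurable_natr; exact: measurable_fun_ltr.
have D10 : 0 <= C1 * (g z * g z `^ e).
  by rewrite mulr_ge0 ?(ltW C10)// mulr_ge0 ?powR_ge0.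
have D20 : 0 <= C2 * g z by rewrite mulr_ge0 ?(ltW C20).
rewrite /hls_majorant; under eq_integral do rewrite EFinD.
rewrite ge0_integralD//; last 4 first.
- by move=> t _; rewrite lee_fin mulr_ge0// mulr_ge0 ?powR_ge0.
- by apply/measurable_EFinP; exact: measurable_funM.
- by move=> t _; rewrite lee_fin mulr_ge0// mulr_ge0 ?powR_ge0.
- by apply/measurable_EFinP; exact: measurable_funM.
rewrite !ge0_integralZl_real//; last 2 first.
- by move=> t _; rewrite mulr_ge0 ?powR_ge0.
- by move=> t _; rewrite mulr_ge0 ?powR_ge0.
have r0 : 0 < g z `^ (- (p / N)) by exact: powR_gt0.
have H1 := @lee_wpmul2l _ (C1 * (g z * g z `^ e))%:E D10 _ _ (integral_powR_le a0 r0).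
have H2 := @lee_wpmul2l _ (C2 * g z)%:E D20 _ _ (integral_powR_gt b0 r0).
apply: le_trans (leeD H1 H2) _; rewrite -!EFinM -EFinD lee_fin.
rewrite -!powRrM le_eqVlt; apply/orP; left; apply/eqP.
rewrite (_ : C1 * _ * _ = C1 / a * (g z `^ 1 * g z `^ e * g z `^ (- (p / N) * a)));
  last first.
  by rewrite powRr1 ?g0//; ring.
rewrite (_ : C2 * _ * _ = C2 / b * (g z `^ 1 * g z `^ (- (p / N) * - b))); last first.
  by rewrite powRr1 ?g0//; ring.
rewrite -!powR_add// mulrDl; congr (_ * _ `^ _ + _ * _ `^ _).
- by rewrite /a /e; field; rewrite ?N_neq0 ?p_neq0 ?q_neq0.
- by rewrite /b; field; rewrite ?N_neq0 ?p_neq0.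
Qed.

(** The normalization puts 1 in place of the norm of g in the choice of rho; a general g is reached
    by dividing f and g by the same constant. *)
Lemma hls_normalized : exists2 C : R, 0 < C & forall f g : X -> R,
    measurable_fun setT f -> (forall x, 0 <= f x) ->
    measurable_fun setT g -> (forall x, 0 <= g x) ->
    (\int[m]_z (g z `^ p)%:E <= 1)%E ->
    {ae m, forall x,
      ((f x)%:E <= k%:E * pot (fun z t => t `^ (a - 1) * g z)%R x)%E} ->
    (\int[m]_x (f x `^ q)%:E <= C%:E)%E.
Proof.
pose C3 := C1 / a + C2 / b.
have C30 : 0 < C3 by rewrite addr_gt0// divr_gt0.
exists (2 * k * (c4 * C3)); first by rewrite mulr_gt0 ?mulr_gt0// mulr_gt0.
move=> f g mf f0 mg g0 g1 fg.
have mB := measurable_hls_majorant mg.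
have B0 z t := @hls_majorant_ge0 g z t g0.
have k2 : 0 <= 2 * k by rewrite mulr_ge0// ltW.
apply: (@le_trans _ _ (\int[m]_x ((2 * k)%:E * pot (hls_majorant g) x))%E).
  apply: ae_ge0_le_integral => //.
  - by move=> x _; rewrite lee_fin powR_ge0.
  - by apply/measurable_EFinP; exact: measurable_powR_comp.
  - by move=> x _; rewrite mule_ge0// ball_potential_ge0.
  - by apply: measurable_funeM; exact: (measurable_ball_potential X_borel m_regular).
  - apply: filterS fg => x fgx _.
    have := f0 x; rewrite le_eqVlt => /predU1P[<-|fx0]; last exact: hls_pointwise.
    by rewrite powR0// mule_ge0// ball_potential_ge0.
rewrite ge0_integralZl//; last 2 first.
- exact: (measurable_ball_potential X_borel m_regular).
- by move=> x _; exact: ball_potential_ge0.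
rewrite [leRHS]EFinM; apply: lee_wpmul2l => //.
apply: le_trans (integral_ball_potential_le X_borel m_regular c_gt0 m_ball mB B0) _.
rewrite [leRHS]EFinM; apply: lee_wpmul2l; first by rewrite lee_fin ltW.
apply: (@le_trans _ _ (\int[m]_z (C3 * g z `^ p)%:E)%E).
  apply: ge0_le_integral => //.
  - by move=> z _; apply: integral_ge0 => t _; rewrite lee_fin.
  - apply: measurable_tonelli => //.
    + exact: sigma_finiteT.
    + by apply: measurable_funTS; exact/measurable_EFinP.
    + by move=> z t _; rewrite lee_fin.
  - by apply/measurable_EFinP; apply: measurable_funM => //; exact: measurable_powR_comp.
  - by move=> z _; exact: integral_hls_majorant.
rewrite ge0_integralZl_real ?(ltW C30)//; last 2 first.
- by move=> z _; exact: powR_ge0.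
- exact: measurable_powR_comp.
by rewrite -[leRHS]mule1; apply: lee_wpmul2l => //; rewrite lee_fin ltW.
Qed.

End hls.

(** * The cutoff as a Lipschitz function on the line *)

Section cutoff_functions.
Context {R : realType}.

(** All that the kernel estimates use of the cutoff. The range and the Lipschitz bound concern the
    whole line, which makes H continuous and so measurable. *)
Definition lipschitz_cutoff (H : R -> R) (L : R) : Prop :=
  [/\ forall x, 0 <= H x <= 1, forall x y, `|H x - H y| <= L * `|x - y|,
      forall x, 0 <= x <= 2^-1 -> H x = 1 & forall x, 2 <= x -> H x = 0].

(** On [1/2, 2] the derivative is continuous, hence bounded, and the mean value theorem applies.
    Outside this interval h is constant, so clamping two points to it preserves the values of h and
    does not increase their distance. *)
Lemma cutoff_lipschitz (h : R -> R) : cutoff h ->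
  exists2 L : R, 0 < L & lipschitz_cutoff (fun x => h `|x|) L.
Proof.
move=> [h0 hdec hder h1 h2].
have der (x : R) : 0 < x -> is_derive x 1 h ((derive1 h) x).
  move=> x0; have := hder 0%N x x0; rewrite derive1n0 => dx.
  by rewrite derive1E; apply: DeriveDef.
have [c _ hc] : exists2 c : R, c \in `[2^-1, 2] &
    forall t, t \in `[2^-1, 2] -> `|(derive1 h) t| <= `|(derive1 h) c|.
  apply: (@EVT_max R (fun t => `|(derive1 h) t|)).
    by rewrite (@le_trans _ _ 1)// ?invf_le1// ler1n.
  apply: continuous_in_subspaceT => t; rewrite inE/= in_itv/= => /andP[t2 _].
  have t0 : 0 < t by rewrite (lt_le_trans _ t2).
  apply: continuous_comp; last exact: norm_continuous.
  apply: differentiable_continuous; apply/derivable1_diffP.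
  by have := hder 1%N t t0; rewrite derive1n1.
pose L := `|(derive1 h) c| + 1.
have L0 : 0 < L by rewrite ltr_pwDr.
have lip x y : 0 <= x -> x <= y -> `|h x - h y| <= L * `|x - y|.
  move=> x0 xy; have R0 : 0 <= L * `|x - y| by rewrite mulr_ge0// ltW.
  have y0 : 0 <= y by exact: le_trans xy.
  have [y2|y2] := leP y 2^-1.
    by rewrite !h1 ?subrr ?normr0// ?x0 ?y0// (le_trans xy).
  have [x2|x2] := leP 2 x.
    by rewrite !h2 ?subrr ?normr0// (le_trans x2).
  pose x' := Num.max x 2^-1; pose y' := Num.min y 2.
  have half2 : 2^-1 < 2 :> R by rewrite (@lt_trans _ _ 1)// ?invf_lt1// ltr1n.
  have hx : h x = h x'.
    rewrite /x'; case: (leP x 2^-1) => // xh.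
    by rewrite !h1 ?x0 ?xh// lexx andbT.
  have hy : h y = h y'.
    rewrite /y'; case: (leP y 2) => // yh.
    by rewrite !h2// ltW.
  have xy' : x' <= y'.
    by rewrite /x' /y' ge_max !le_min xy (ltW x2) (ltW y2) (ltW half2).
  have dxy : `|x' - y'| <= `|x - y|.
    rewrite distrC (distrC x) !ger0_norm ?subr_ge0// lerB//.
      by rewrite /y' ge_min lexx.
    by rewrite /x' le_max lexx.
  rewrite hx hy; apply: le_trans (ler_wpM2l (ltW L0) dxy).
  move: xy'; rewrite le_eqVlt => /predU1P[->|xy'].
    by rewrite !subrr normr0 mulr0.
  have x'0 : 0 < x' by rewrite /x' lt_max invr_gt0 ltr0n orbT.
  have [||s] := @MVT R h (derive1 h) x' y' xy'.
  - by move=> s; rewrite in_itv/= => /andP[xs _]; apply: der; exact: lt_trans xs.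
  - apply: continuous_in_subspaceT => s; rewrite inE/= in_itv/= => /andP[xs _].
    apply: differentiable_continuous; apply/derivable1_diffP.
    by have [] := der s (lt_le_trans x'0 xs).
  rewrite in_itv/= => /andP[xs sy] E.
  rewrite distrC E normrM (distrC x') ler_wpM2r// ler_wpDr//.
  apply: hc; rewrite in_itv/=; apply/andP; split.
    by rewrite (le_trans _ (ltW xs))// /x' le_max lexx orbT.
  by rewrite (le_trans (ltW sy))// /y' ge_min lexx orbT.
exists L => //; split.
- move=> x; rewrite h0//=; have -> : 1 = h 0 :> R by rewrite h1 ?lexx ?invr_ge0 ?ler0n.
  exact: hdec.
- move=> x y; apply: (@le_trans _ _ (L * `| `|x| - `|y| |)); last first.
    by rewrite ler_wpM2l ?(ltW L0)// ler_dist_dist.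
  have [xy|/ltW xy] := leP `|x| `|y|; first exact: lip.
  by rewrite distrC (distrC `|x|); exact: lip.
- by move=> x /andP[x0 x2]; rewrite ger0_norm// h1// x0.
- by move=> x x2; rewrite ger0_norm ?h2// (le_trans _ x2).
Qed.

Lemma measurable_lipschitz (f : R -> R) L :
  (forall x y, `|f x - f y| <= L * `|x - y|) -> measurable_fun setT f.
Proof.
move=> fL; apply: continuous_measurable_fun => x.
apply/cvgrPdist_le => e e0.
have L0 : 0 < `|L| + 1 by rewrite ltr_wpDl.
near=> y; apply: le_trans (fL _ _) _.
apply: (@le_trans _ _ ((`|L| + 1) * `|x - y|)).
  by rewrite ler_wpM2r// (le_trans (ler_norm _))// lerDl.
rewrite -ler_pdivlMl//.
near: y; apply: cvgr_dist_le; first exact: cvg_id.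
by rewrite mulr_gt0 ?invr_gt0.
Unshelve. all: by end_near. Qed.

Lemma measurable_invr : measurable_fun setT (fun x : R => x^-1).
Proof.
(* The inverse as a power on each half-line; at 0 both indicators vanish, in agreement with the
   convention for the inverse of 0. *)
rewrite (_ : (fun x => _) = fun x : R =>
  (0 < x)%R%:R * x `^ (- 1) - (x < 0)%R%:R * (- x) `^ (- 1)).
  apply: measurable_funB; apply: measurable_funM.
  - by apply: measurable_natr; exact: measurable_fun_ltr.
  - exact: measurable_powR.
  - by apply: measurable_natr; exact: measurable_fun_ltr.
  - by apply: (measurableT_comp (measurable_powR _)).
apply/funext => x; case: (ltgtP x 0) => x0 /=.
- by rewrite mul0r add0r mul1r powR_inv1 ?oppr_ge0 ?(ltW x0)// invrN opprK.
- by rewrite mul0r subr0 mul1r powR_inv1 ?(ltW x0).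
- by rewrite x0 invr0 !mul0r subrr.
Qed.

End cutoff_functions.

(** * Averages at scale t and their two-sided bounds *)

Section averages.
Context {d : measure_display} {R : realType} {X : metricMeasurableType d R}.
Variables (m : {measure set X -> \bar R}) (N c : R) (H : R -> R) (L : R).
Hypotheses (X_borel : borel_measurable X) (N_gt0 : 0 < N)
  (m_regular : ahlfors_regular m N) (c_gt0 : 0 < c)
  (m_ball : forall (x : X) r, 0 < r -> (m (ball x r) <= (c * r `^ N)%:E)%E)
  (m_ball_ge : forall (x : X) r, 0 < r -> ((c^-1 * r `^ N)%:E <= m (ball x r))%E)
  (L_gt0 : 0 < L) (HL : lipschitz_cutoff H L).
Local Notation mu := (@lebesgue_measure R).
Local Notation P := (`]0%R, +oo[%classic : set R).

Let H01 r : 0 <= H r <= 1. Proof. by have [] := HL. Qed.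
Let H0 r : 0 <= H r. Proof. by have /andP[] := H01 r. Qed.
Let mH : measurable_fun setT H.
Proof. by have [_ /measurable_lipschitz] := HL. Qed.

Let Hnear r : 0 <= r -> H r <= (r < 2)%R%:R.
Proof.
move=> r0; case: ltP => r2; first by have /andP[] := H01 r.
by have [_ _ _ ->] := HL.
Qed.

Let Hnear_t (x z : X) t : 0 < t ->
  H (mdist x z / t) <= (mdist x z < 2 * t)%R%:R.
Proof.
by move=> t0; rewrite -ltr_pdivrMr//; apply: Hnear; rewrite divr_ge0 ?mdist_ge0// ltW.
Qed.

Let Hone (x z : X) t : 0 < t ->
  (mdist x z < t / 2)%R%:R <= H (mdist x z / t).
Proof.
move=> t0; case: ltP => // xz; have [_ _ -> //] := HL.
by rewrite divr_ge0 ?mdist_ge0 ?(ltW t0)//= ler_pdivrMr// mulrC ltW.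
Qed.

Lemma measurable_cutoff_dist d' (T : measurableType d') (f g : T -> X) (h : T -> R) :
  measurable_fun setT f -> measurable_fun setT g -> measurable_fun setT h ->
  measurable_fun setT (fun w => H (mdist (f w) (g w) / h w)).
Proof.
move=> mf mg mh; apply: (measurableT_comp mH); apply: measurable_funM.
  exact: (measurableT_comp (measurable_mdist X_borel m_regular)
    (measurable_fun_pair mf mg)).
by apply: (measurableT_comp measurable_invr).
Qed.

(** Two centres, because a difference such as H(d(x, w) / t) - H(d(y, w) / t) lives on the union of
    two balls. For a single ball the lemma is used with equal centres, at the price of a factor
    2. *)
Lemma bounded_ball_integral (F : X -> R) (x y : X) r K :
  measurable_fun setT F -> 0 < r -> 0 <= K ->
  (forall z, `|F z| <= K * ((mdist x z < r)%R%:R + (mdist y z < r)%R%:R)) ->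
  m.-integrable setT (EFin \o F) /\
  `| \int[m]_z F z | <= 2 * K * (c * r `^ N).
Proof.
move=> mF r0 K0 FK.
have mb (w : X) : measurable_fun setT (fun z : X => (mdist w z < r)%R%:R : R).
  apply: measurable_natr; apply: measurable_fun_ltr => //.
  exact: measurable_mdistr.
have bound : (\int[m]_z `|F z|%:E <= (2 * K * (c * r `^ N))%:E)%E.
  apply: (@le_trans _ _ (\int[m]_z (K *
      ((mdist x z < r)%R%:R + (mdist y z < r)%R%:R))%:E)%E).
    apply: ge0_le_integral => //.
    - by apply/measurable_EFinP; apply: measurableT_comp.
    - apply/measurable_EFinP; apply: measurable_funM => //.
      exact: measurable_funD.
    - by move=> z _; rewrite lee_fin.
  rewrite ge0_integralZl_real//; last exact: measurable_funD.
  under eq_integral do rewrite EFinD.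
  rewrite ge0_integralD//; last 2 first.
  - by apply/measurable_EFinP; exact: mb.
  - by apply/measurable_EFinP; exact: mb.
  rewrite !integral_ball_indic// -mulrA mulrCA EFinM.
  apply: lee_wpmul2l; first by rewrite lee_fin.
  by rewrite mulr_natl mulr2n EFinD leeD// m_ball.
have iF : m.-integrable setT (EFin \o F).
  apply/integrableP; split; first exact/measurable_EFinP.
  by apply: le_lt_trans bound _; rewrite ltry.
split => //; have := le_normr_Rintegral measurableT iF.
move=> /le_trans; apply; rewrite -lee_fin /Rintegral fineK//.
by rewrite fin_num_abs gee0_abs ?integral_ge0// (le_lt_trans bound)// ltry.
Qed.

Let avg := approx_avg m N H.

(** Point, scale and averaged function all move with w, since [approx_psi] averages a function that
    itself depends on the scale. *)
Lemma measurable_avg d' (T : measurableType d') (f : T -> X) (h : T -> R)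
    (F : X -> T -> R) :
  measurable_fun setT f -> measurable_fun setT h ->
  measurable_fun [set: T * X] (fun w => F w.2 w.1) -> (forall z w, 0 <= F z w) ->
  measurable_fun setT (fun w => avg (h w) (fun z => F z w) (f w)).
Proof.
move=> mf mh mF F0; apply: measurable_funM.
  by apply: (measurableT_comp (measurable_powR _)).
apply: (measurableT_comp (@fine_measurable R setT measurableT)).
apply: (@measurable_tonelli _ _ _ _ _ m (ahlfors_sigma_finite X_borel m_regular)
  setT (fun w z => (H (mdist (f w) z / h w) * F z w)%:E)) => //.
- apply: measurable_funTS; apply/measurable_EFinP; apply: measurable_funM => //.
  by apply: measurable_cutoff_dist => //; exact: measurableT_comp.
- by move=> w z _; rewrite lee_fin mulr_ge0.
Qed.

Lemma avg_ge0 (t : R) (F : X -> R) (x : X) : (forall z, 0 <= F z) -> 0 <= avg t F x.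
Proof.
move=> F0; rewrite mulr_ge0 ?powR_ge0//; apply: Rintegral_ge0 => z _.
by rewrite mulr_ge0.
Qed.

(** H vanishes from 2 on and equals 1 up to 1/2, whence the powers 2^N and 2^(-N); the leading 2
    comes from the bound with two centres. *)
Let Cup := 2 * (c * 2 `^ N).
Let Clo := c^-1 * 2 `^ (- N).
Let Cup0 : 0 < Cup. Proof. by rewrite !mulr_gt0 ?powR_gt0. Qed.
Let Clo0 : 0 < Clo. Proof. by rewrite mulr_gt0 ?invr_gt0 ?powR_gt0. Qed.

Let scale_ball (t s : R) : 0 < t -> 0 < s -> t `^ (- N) * (s * t) `^ N = s `^ N.
Proof.
move=> t0 s0; rewrite powRM ?(ltW t0) ?(ltW s0)// mulrCA -powR_add// addNr.
by rewrite powRr0 mulr1.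
Qed.

Let avg_integrable (t : R) (F : X -> R) (x : X) (K : R) :
  0 < t -> measurable_fun setT F -> 0 <= K ->
  (forall z, `|F z| <= K) ->
  m.-integrable setT (EFin \o (fun z => H (mdist x z / t) * F z)) /\
  `|avg t F x| <= K * Cup.
Proof.
move=> t0 mF K0 FK.
have [||||iF bF] := @bounded_ball_integral
  (fun z => H (mdist x z / t) * F z) x x (2 * t) K.
- by apply: measurable_funM => //; exact: measurable_cutoff_dist.
- by rewrite mulr_gt0.
- exact: K0.
- move=> z; rewrite normrM mulrC ler_pM//.
  rewrite (ger0_norm (H0 _)); apply: le_trans (Hnear_t _ _ t0) _.
  by rewrite lerDl.
split => //; rewrite /avg /approx_avg normrM (ger0_norm (powR_ge0 _ _)).
apply: le_trans (ler_wpM2l (powR_ge0 _ _) bF) _.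
rewrite [leLHS](_ : _ = 2 * K * (c * (t `^ (- N) * (2 * t) `^ N))); last by ring.
by rewrite scale_ball// /Cup le_eqVlt; apply/orP; left; apply/eqP; ring.
Qed.

Lemma avg_le (t : R) (F : X -> R) (x : X) (K : R) :
  0 < t -> measurable_fun setT F -> 0 <= K ->
  (forall z, 0 <= F z <= K) -> avg t F x <= K * Cup.
Proof.
move=> t0 mF K0 FK; have [|_] := avg_integrable x t0 mF K0 _.
  by move=> z; have /andP[F0 FKz] := FK z; rewrite ger0_norm.
exact: le_trans (ler_norm _).
Qed.

(** K is absent from the conclusion: it guarantees that the integral is finite, since the
    real-valued integral of a non-negative function with infinite integral would be 0. *)
Lemma avg_ge (t : R) (F : X -> R) (x : X) (K k : R) :
  0 < t -> measurable_fun setT F -> 0 <= k ->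
  (forall z, k <= F z <= K) -> k * Clo <= avg t F x.
Proof.
move=> t0 mF k0 FK.
have K0 : 0 <= K by have /andP[/(le_trans k0)/le_trans/[apply]] := FK x.
have FK' z : `|F z| <= K.
  by have /andP[kF FKz] := FK z; rewrite ger0_norm// (le_trans k0).
have [iF _] := avg_integrable x t0 mF K0 FK'.
have t2 : 0 < t / 2 by rewrite divr_gt0.
have mb : measurable_fun setT (fun z => (mdist x z < t / 2)%R%:R : R).
  apply: measurable_natr; apply: measurable_fun_ltr => //.
  exact: measurable_mdistr.
have : ((k * (c^-1 * (t / 2) `^ N))%:E <=
    (\int[m]_z (H (mdist x z / t) * F z))%R%:E)%E.
  rewrite /Rintegral fineK; last exact: integrable_fin_num.
  apply: (@le_trans _ _ (\int[m]_z (k * (mdist x z < t / 2)%R%:R)%:E)%E).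
    rewrite ge0_integralZl_real// integral_ball_indic// EFinM.
    by apply: lee_wpmul2l => //; exact: m_ball_ge.
  apply: ge0_le_integral => //.
  - by move=> z _; rewrite lee_fin mulr_ge0.
  - by apply/measurable_EFinP; exact: measurable_funM.
  - by case/integrableP: iF.
  - move=> z _; have /andP[kF _] := FK z.
    by rewrite lee_fin mulrC ler_pM// Hone.
rewrite lee_fin => H1; apply: le_trans (ler_wpM2l (powR_ge0 t (- N)) H1).
rewrite [leRHS](_ : _ = k * (c^-1 * (t `^ (- N) * (2^-1 * t) `^ N))); last first.
  by rewrite (mulrC _ t); ring.
rewrite scale_ball// ?invr_gt0// /Clo.
by rewrite -[2^-1]powR_inv1// -powRrM mulN1r.
Qed.

End averages.

(** * Size and Lipschitz bounds for the approximation of the identity *)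

Section kernel_estimates.
Context {d : measure_display} {R : realType} {X : metricMeasurableType d R}.
Variables (m : {measure set X -> \bar R}) (N c : R) (H : R -> R) (L : R).
Hypotheses (X_borel : borel_measurable X) (N_gt0 : 0 < N)
  (m_regular : ahlfors_regular m N) (c_gt0 : 0 < c)
  (m_ball : forall (x : X) r, 0 < r -> (m (ball x r) <= (c * r `^ N)%:E)%E)
  (m_ball_ge : forall (x : X) r, 0 < r -> ((c^-1 * r `^ N)%:E <= m (ball x r))%E)
  (L_gt0 : 0 < L) (HL : lipschitz_cutoff H L).
Local Notation mu := (@lebesgue_measure R).
Local Notation P := (`]0%R, +oo[%classic : set R).

Local Notation avg := (approx_avg m N H).
Local Notation phi := (approx_phi m N H).
Local Notation psi := (approx_psi m N H).
Local Notation ker := (approx_kernel m N H).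
Let Cup := 2 * (c * 2 `^ N).
Let Clo := c^-1 * 2 `^ (- N).
Let Cup0 : 0 < Cup. Proof. by rewrite !mulr_gt0 ?powR_gt0. Qed.
Let Clo0 : 0 < Clo. Proof. by rewrite mulr_gt0 ?invr_gt0 ?powR_gt0. Qed.
(** A bound for psi: phi is at least 1 / Cup, so its averages are at least Clo / Cup. *)
Let Q := (Cup^-1 * Clo)^-1.
Let Q0 : 0 < Q. Proof. by rewrite invr_gt0 mulr_gt0 ?invr_gt0. Qed.

Let H01 r : 0 <= H r <= 1. Proof. by have [] := HL. Qed.
Let H0 r : 0 <= H r. Proof. by have /andP[] := H01 r. Qed.

Let mcst1 d' (T : measurableType d') : measurable_fun [set: T] (cst 1 : T -> R).
Proof. exact: measurable_cst. Qed.

Let avg1_bounds (t : R) (x : X) : 0 < t -> Clo <= avg t (cst 1) x <= Cup.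
Proof.
move=> t0; apply/andP; split.
- rewrite -[Clo]mul1r.
  apply: (avg_ge X_borel m_regular m_ball m_ball_ge HL x (K := 1)) => //.
  by move=> z; rewrite lexx.
- rewrite -[Cup]mul1r.
  apply: (avg_le X_borel m_regular m_ball HL x) => //.
  by move=> z; rewrite /= ler01 lexx.
Qed.

Let phi_bounds (t : R) (x : X) : 0 < t -> Cup^-1 <= phi x t <= Clo^-1.
Proof.
move=> t0; have /andP[lo hi] := avg1_bounds x t0.
have a0 : 0 < avg t (cst 1) x by exact: lt_le_trans lo.
by rewrite /approx_phi !lef_pV2 ?posrE// lo hi.
Qed.

Let phi_ge0 t x : 0 <= phi x t.
Proof. by rewrite invr_ge0; apply: (avg_ge0 _ _ HL). Qed.

Let measurable_phi d' (T : measurableType d') (f : T -> X) (h : T -> R) :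
  measurable_fun setT f -> measurable_fun setT h ->
  measurable_fun setT (fun w => phi (f w) (h w)).
Proof.
move=> mf mh; apply: (measurableT_comp measurable_invr).
exact: (measurable_avg X_borel m_regular HL (F := fun=> fun=> 1) mf mh).
Qed.

Let psi_ge0 t x : 0 <= psi x t.
Proof.
rewrite invr_ge0; apply: (avg_ge0 _ _ HL) => z; rewrite invr_ge0.
exact: (avg_ge0 _ _ HL).
Qed.

Let measurable_psi d' (T : measurableType d') (f : T -> X) (h : T -> R) :
  measurable_fun setT f -> measurable_fun setT h ->
  measurable_fun setT (fun w => psi (f w) (h w)).
Proof.
move=> mf mh; apply: (measurableT_comp measurable_invr).
apply: (measurable_avg X_borel m_regular HL (F := fun z w => phi z (h w)) mf mh) => //.
by apply: measurable_phi => //; exact: measurableT_comp.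
Qed.

Let psi_le (t : R) (x : X) : 0 < t -> psi x t <= Q.
Proof.
move=> t0; rewrite /Q /approx_psi.
have lo : Cup^-1 * Clo <= avg t (fun y => phi y t) x.
  apply: (avg_ge X_borel m_regular m_ball m_ball_ge HL x (K := Clo^-1)) => //.
  - exact: measurable_phi.
  - by rewrite invr_ge0 ltW.
  - by move=> z; exact: phi_bounds.
have l0 : 0 < Cup^-1 * Clo by rewrite mulr_gt0 ?invr_gt0.
by rewrite lef_pV2 ?posrE// (lt_le_trans l0).
Qed.

Let I (x z : X) (t : R) : R :=
  \int[m]_w (H (mdist x w / t) * H (mdist z w / t) * psi w t).

Let kerE x z t : ker x z t = phi x t * phi z t / t `^ (2 * N) * I x z t.
Proof. by []. Qed.

Let I_ge0 x z t : 0 <= I x z t.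
Proof. by apply: Rintegral_ge0 => w _; rewrite !mulr_ge0. Qed.

Lemma approx_kernel_ge0 x z t : 0 <= ker x z t.
Proof. by rewrite kerE mulr_ge0// divr_ge0 ?powR_ge0// mulr_ge0. Qed.

Let mdist_integrand (x : X) (t : R) :
  measurable_fun setT (fun w => H (mdist x w / t)).
Proof. exact: (measurable_cutoff_dist X_borel m_regular HL). Qed.

(** Balls of radius 2 t about points at distance at least 4 t are disjoint, which is the origin of
    the 4 in [ball_kernel]. *)
Let far_apart (x z w : X) (t : R) : 0 < t -> 4 * t <= mdist x z ->
  H (mdist x w / t) * H (mdist z w / t) = 0.
Proof.
move=> t0 xz; have [_ _ _ Hfar] := HL.
have [xw|xw] := leP (2 * t) (mdist x w).
  by rewrite Hfar ?mul0r// ler_pdivlMr.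
rewrite (Hfar (mdist z w / t)) ?mulr0// ler_pdivlMr// .
have := metric_triangle x w z; rewrite (metric_sym w z) => tri.
by move: (le_trans xz tri); lra.
Qed.

Let near_bound (x w : X) (t : R) : 0 < t ->
  H (mdist x w / t) <= (mdist x w < 2 * t)%R%:R.
Proof.
move=> t0; case: ltP => xw; first by have /andP[] := H01 (mdist x w / t).
by have [_ _ _ ->] := HL; rewrite ?ler_pdivlMr.
Qed.

Let I_integrable x z t : 0 < t ->
  m.-integrable setT (EFin \o
    (fun w => H (mdist x w / t) * H (mdist z w / t) * psi w t)) /\
  I x z t <= Q * Cup * (t `^ N * (mdist x z < 4 * t)%R%:R).
Proof.
move=> t0.
have mF : measurable_fun setT
    (fun w => H (mdist x w / t) * H (mdist z w / t) * psi w t).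
  by apply: measurable_funM; [exact: measurable_funM|exact: measurable_psi].
have t2 : 0 < 2 * t by rewrite mulr_gt0.
have [|iF bF] := bounded_ball_integral X_borel m_ball (x := x) (y := x) mF t2 (ltW Q0).
  move=> w; rewrite ger0_norm ?mulr_ge0// mulrC ler_pM ?mulr_ge0//.
    exact: psi_le.
  apply: (@le_trans _ _ (H (mdist x w / t))); last first.
    by apply: le_trans (near_bound _ _ t0) _; rewrite lerDl.
  by rewrite ler_piMr//; have /andP[] := H01 (mdist z w / t).
split => //; have [xz|xz] := leP (4 * t) (mdist x z).
  rewrite /= !mulr0 /I /Rintegral integral0_eq// => w _.
  by rewrite far_apart// mul0r.
rewrite mulr1; apply: le_trans (ler_norm _) _; apply: le_trans bF _.
rewrite powRM ?(ltW t0)// le_eqVlt; apply/orP; left; apply/eqP.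
by rewrite /Cup; ring.
Qed.

Let H_lip (x y w : X) (t : R) : 0 < t ->
  `|H (mdist x w / t) - H (mdist y w / t)| <= L * (mdist x y / t).
Proof.
move=> t0; have [_ Hlip _ _] := HL; apply: le_trans (Hlip _ _) _.
rewrite ler_wpM2l ?(ltW L_gt0)// -mulrBl normrM (gtr0_norm (x := t^-1)) ?invr_gt0//.
rewrite ler_wpM2r ?invr_ge0 ?(ltW t0)//.
have := metric_triangle x y w; have := metric_triangle y x w.
rewrite (metric_sym y x) ler_norml => h1 h2; apply/andP; split.
  by move: h1; lra.
by move: h2; lra.
Qed.

Let H_lip_near (x y w : X) (t : R) : 0 < t ->
  `|H (mdist x w / t) - H (mdist y w / t)| <=
  L * (mdist x y / t) * ((mdist x w < 2 * t)%R%:R + (mdist y w < 2 * t)%R%:R).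
Proof.
move=> t0; have [_ _ _ Hfar] := HL.
have D0 : 0 <= L * (mdist x y / t).
  by rewrite mulr_ge0 ?(ltW L_gt0)// divr_ge0 ?mdist_ge0// ltW.
apply: (@le_trans _ _ (L * (mdist x y / t) *
    ((mdist x w < 2 * t) || (mdist y w < 2 * t))%:R)); last first.
  rewrite ler_wpM2l//; case: (_ < _); case: (_ < _) => //=.
  - by rewrite lerDl.
  - by rewrite addr0.
  - by rewrite add0r.
  - by rewrite addr0.
case: (boolP ((mdist x w < 2 * t) || (mdist y w < 2 * t))) => [_|];
  first by rewrite /= mulr1 H_lip.
rewrite negb_or -!leNgt => /andP[xw yw].
by rewrite !Hfar ?ler_pdivlMr// subrr normr0 mulr0.
Qed.

Let avg1_lip (x y : X) (t : R) : 0 < t ->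
  `|avg t (cst 1) x - avg t (cst 1) y| <= L * Cup * (mdist x y / t).
Proof.
move=> t0.
have m1 (z : X) : measurable_fun setT (fun w => H (mdist z w / t) * cst 1 w).
  by apply: measurable_funM.
have t2 : 0 < 2 * t by rewrite mulr_gt0.
have D0 : 0 <= L * (mdist x y / t).
  by rewrite mulr_ge0 ?(ltW L_gt0)// divr_ge0 ?mdist_ge0// ltW.
have i1 (z : X) : m.-integrable setT (EFin \o (fun w => H (mdist z w / t) * cst 1 w)).
  have [|//] := bounded_ball_integral X_borel m_ball (x := z) (y := z) (m1 z) t2 (@ler01 R).
  move=> w; rewrite mulr1 mul1r ger0_norm//; apply: le_trans (near_bound _ _ t0) _.
  by rewrite lerDl.
rewrite /approx_avg -mulrBr normrM (ger0_norm (powR_ge0 _ _)) -RintegralB//.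
have [||_ bF] := bounded_ball_integral X_borel m_ball (x := x) (y := y)
  (F := fun w => H (mdist x w / t) * cst 1 w - H (mdist y w / t) * cst 1 w) _ t2 D0.
- by apply: measurable_funB; exact: m1.
- by move=> w; rewrite !mulr1; exact: H_lip_near.
apply: le_trans (ler_wpM2l (powR_ge0 _ _) bF) _.
rewrite powRM ?(ltW t0)//.
rewrite [leLHS](_ : _ = L * Cup * (mdist x y / t) * (t `^ (- N) * t `^ N)); last first.
  by rewrite /Cup; ring.
by rewrite -powR_add// addNr powRr0 mulr1.
Qed.

(** From 1 / A - 1 / B = (B - A) / (A B), with both averages bounded below by [Clo]. *)
Let phi_lip (x y : X) (t : R) : 0 < t ->
  `|phi x t - phi y t| <= Clo^-1 * Clo^-1 * (L * Cup * (mdist x y / t)).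
Proof.
move=> t0.
have /andP[lox _] := avg1_bounds x t0; have /andP[loy _] := avg1_bounds y t0.
have ax : 0 < avg t (cst 1) x by exact: lt_le_trans lox.
have ay : 0 < avg t (cst 1) y by exact: lt_le_trans loy.
rewrite (_ : phi x t - phi y t =
    phi x t * phi y t * (avg t (cst 1) y - avg t (cst 1) x)); last first.
  by rewrite /approx_phi; field; rewrite !gt_eqF.
have /andP[_ px] := phi_bounds x t0; have /andP[_ py] := phi_bounds y t0.
rewrite normrM ler_pM//; last by rewrite distrC avg1_lip.
by rewrite normrM !ger0_norm// ler_pM.
Qed.

(** Only the factor H(d(x, w) / t) changes, and the others confine w to the ball of radius 2 t about
    z, whose volume gives t^N. If z is at distance at least 4 t from both x and y, both integrals
    vanish. *)
Let I_lip (x y z : X) (t : R) : 0 < t ->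
  `|I x z t - I y z t| <= L * Q * Cup * (mdist x y / t) *
    (t `^ N * ((mdist x z < 4 * t)%R%:R + (mdist y z < 4 * t)%R%:R)).
Proof.
move=> t0; have t2 : 0 < 2 * t by rewrite mulr_gt0.
have D0 : 0 <= L * (mdist x y / t) * Q.
  by rewrite mulr_ge0 ?(ltW Q0)// mulr_ge0 ?(ltW L_gt0)// divr_ge0 ?mdist_ge0// ltW.
have E0 : 0 <= L * Q * Cup * (mdist x y / t) * t `^ N.
  rewrite mulr_ge0 ?powR_ge0// mulr_ge0 ?divr_ge0 ?mdist_ge0 ?(ltW t0)//.
  by rewrite mulr_ge0 ?(ltW Cup0)// mulr_ge0 ?(ltW Q0) ?(ltW L_gt0).
rewrite mulrA; apply: (@le_trans _ _ (L * Q * Cup * (mdist x y / t) * t `^ N *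
    ((mdist x z < 4 * t) || (mdist y z < 4 * t))%:R)); last first.
  rewrite ler_wpM2l//; case: (_ < _); case: (_ < _) => //=.
  - by rewrite lerDl.
  - by rewrite addr0.
  - by rewrite add0r.
  - by rewrite addr0.
case: (boolP ((mdist x z < 4 * t) || (mdist y z < 4 * t))) => [_|]; last first.
  rewrite negb_or -!leNgt => /andP[xz yz].
  rewrite /I /Rintegral !integral0_eq ?subrr ?normr0 ?mulr0//= => w _.
    by rewrite far_apart// mul0r.
  by rewrite far_apart// mul0r.
rewrite /= mulr1 -RintegralB//; last 2 first.
- by have [] := I_integrable x z t0.
- by have [] := I_integrable y z t0.
have mF (y' : X) : measurable_fun setT
    (fun w => H (mdist y' w / t) * H (mdist z w / t) * psi w t).
  by apply: measurable_funM; [exact: measurable_funM|exact: measurable_psi].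
have [||_ bF] := bounded_ball_integral X_borel m_ball (x := z) (y := z)
  (F := fun w => H (mdist x w / t) * H (mdist z w / t) * psi w t -
    H (mdist y w / t) * H (mdist z w / t) * psi w t) _ t2 D0.
- by apply: measurable_funB; exact: mF.
- move=> w; rewrite -!(mulrA _ (H (mdist z w / t))) -mulrBl normrM -[leRHS]mulrA.
  rewrite ler_pM//; first exact: H_lip.
  rewrite ger0_norm ?mulr_ge0// mulrC ler_pM//; first exact: psi_le.
  by apply: le_trans (near_bound _ _ t0) _; rewrite lerDl.
apply: le_trans bF _; rewrite powRM ?(ltW t0)//.
by rewrite le_eqVlt; apply/orP; left; apply/eqP; rewrite /Cup; ring.
Qed.

Let K1 := Clo^-1 * Clo^-1 * Q * Cup.
(** The two summands are those of the product rule for phi x * I x z; the outer [Clo^-1] bounds the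
    common factor phi z. *)
Let K2 := Clo^-1 * (Clo^-1 * Clo^-1 * (L * Cup) * (Q * Cup) + Clo^-1 * (L * Q * Cup)).
Let K10 : 0 < K1.
Proof.
have C0 : 0 < Clo^-1 by rewrite invr_gt0.
by apply: mulr_gt0 => //; apply: mulr_gt0 => //; exact: mulr_gt0.
Qed.
Let K20 : 0 < K2.
Proof.
have C0 : 0 < Clo^-1 by rewrite invr_gt0.
apply: mulr_gt0 => //; apply: addr_gt0.
  by apply: mulr_gt0; apply: mulr_gt0 => //; exact: mulr_gt0.
by apply: mulr_gt0 => //; apply: mulr_gt0 => //; exact: mulr_gt0.
Qed.

Definition kernel_constant : R := K1 + K2.

Lemma kernel_constant_gt0 : 0 < kernel_constant.
Proof. exact: addr_gt0. Qed.

Let powR2N (t : R) : 0 < t -> t `^ N / t `^ (2 * N) = t `^ (- N).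
Proof.
by move=> t0; rewrite -powRN -powR_add//; congr (_ `^ _); ring.
Qed.

Lemma approx_kernel_le x z (t : R) : 0 < t ->
  ker x z t <= kernel_constant * ball_kernel N x z t.
Proof.
move=> t0; apply: (@le_trans _ _ (K1 * ball_kernel N x z t)); last first.
  by rewrite ler_wpM2r ?ball_kernel_ge0// lerDl ltW.
have [_ Ile] := I_integrable x z t0.
have /andP[_ px] := phi_bounds x t0; have /andP[_ pz] := phi_bounds z t0.
rewrite kerE; apply: (@le_trans _ _ (Clo^-1 * Clo^-1 / t `^ (2 * N) *
    (Q * Cup * (t `^ N * (mdist x z < 4 * t)%R%:R)))).
  rewrite ler_pM//; first by rewrite divr_ge0 ?powR_ge0// mulr_ge0.
  by rewrite ler_wpM2r ?invr_ge0 ?powR_ge0// ler_pM.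
rewrite /ball_kernel -powR2N// /K1 le_eqVlt; apply/orP; left; apply/eqP.
by ring.
Qed.

Lemma approx_kernel_lip x y z (t : R) : 0 < t ->
  `|ker x z t - ker y z t| <= kernel_constant * (mdist x y / t) *
    (ball_kernel N x z t + ball_kernel N y z t).
Proof.
move=> t0; have D0 : 0 <= mdist x y / t by rewrite divr_ge0 ?mdist_ge0// ltW.
apply: (@le_trans _ _ (K2 * (mdist x y / t) *
    (ball_kernel N x z t + ball_kernel N y z t))); last first.
  rewrite ler_wpM2r ?addr_ge0 ?ball_kernel_ge0// ler_wpM2r// /kernel_constant.
  by rewrite lerDr ltW.
have [_ Ile] := I_integrable x z t0.
have /andP[_ pz] := phi_bounds z t0; have /andP[_ py] := phi_bounds y t0.
rewrite !kerE (_ : _ - _ = phi z t / t `^ (2 * N) *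
  ((phi x t - phi y t) * I x z t + phi y t * (I x z t - I y z t))); last by ring.
set nx := (mdist x z < 4 * t)%R%:R in Ile *.
pose ny : R := (mdist y z < 4 * t)%R%:R.
apply: (@le_trans _ _ (Clo^-1 / t `^ (2 * N) *
   (Clo^-1 * Clo^-1 * (L * Cup * (mdist x y / t)) * (Q * Cup * (t `^ N * (nx + ny))) +
    Clo^-1 * (L * Q * Cup * (mdist x y / t) * (t `^ N * (nx + ny)))))).
  rewrite normrM ler_pM//.
    by rewrite ger0_norm ?divr_ge0 ?powR_ge0// ler_wpM2r ?invr_ge0 ?powR_ge0.
  apply: le_trans (ler_normD _ _) _; rewrite lerD//.
    rewrite normrM ler_pM// ?phi_lip// ger0_norm//; apply: le_trans Ile _.
    apply: ler_wpM2l; first by apply: mulr_ge0; exact: ltW.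
    by apply: ler_wpM2l; rewrite ?powR_ge0// lerDl.
  by rewrite normrM ler_pM// ?I_lip// ger0_norm.
rewrite /ball_kernel -/nx -/ny -powR2N// /K2 le_eqVlt; apply/orP; left; apply/eqP.
by ring.
Qed.

Lemma measurable_approx_kernel x d' (T : measurableType d') (f : T -> X) (h : T -> R) :
  measurable_fun setT f -> measurable_fun setT h ->
  measurable_fun setT (fun w => ker x (f w) (h w)).
Proof.
move=> mf mh; apply: measurable_funM.
  apply: measurable_funM.
    by apply: measurable_funM; exact: measurable_phi.
  by apply: (measurableT_comp measurable_invr); apply: (measurableT_comp (measurable_powR _)).
apply: (measurableT_comp (@fine_measurable R setT measurableT)).
apply: (@measurable_tonelli _ _ _ _ _ m (ahlfors_sigma_finite X_borel m_regular)
  setT (fun w z => (H (mdist x z / h w) * H (mdist (f w) z / h w) *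
    psi z (h w))%:E)) => //; last first.
  by move=> w z _; rewrite lee_fin !mulr_ge0.
apply: measurable_funTS; apply/measurable_EFinP; apply: measurable_funM => //.
  apply: measurable_funM.
    by apply: (measurable_cutoff_dist X_borel m_regular HL) => //; exact: measurableT_comp.
  by apply: (measurable_cutoff_dist X_borel m_regular HL) => //; exact: measurableT_comp.
by apply: measurable_psi => //; exact: measurableT_comp.
Qed.

End kernel_estimates.

(** * Domination of the Bessel potential and its splitting by scales *)

Section bessel.
Context {d : measure_display} {R : realType} {X : metricMeasurableType d R}.
Variables (m : {measure set X -> \bar R}) (N c : R) (H : R -> R) (L : R).
Hypotheses (X_borel : borel_measurable X) (N_gt0 : 0 < N)
  (m_regular : ahlfors_regular m N) (c_gt0 : 0 < c)
  (m_ball : forall (x : X) r, 0 < r -> (m (ball x r) <= (c * r `^ N)%:E)%E)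
  (m_ball_ge : forall (x : X) r, 0 < r -> ((c^-1 * r `^ N)%:E <= m (ball x r))%E)
  (L_gt0 : 0 < L) (HL : lipschitz_cutoff H L).
Local Notation mu := (@lebesgue_measure R).
Local Notation P := (`]0%R, +oo[%classic : set R).

Variable alpha : R.
Hypothesis alpha_gt0 : 0 < alpha.
Local Notation ker := (approx_kernel m N H).
Local Notation pot := (ball_potential m N).
Local Notation S := (kernel_constant N c L).

(** A majorant of t^alpha (1 + t^alpha)^(-2) / t, since (1 + t^alpha)^2 is at least 1 and at least
    t^(2 alpha). The minimum of the two extreme powers lies below all intermediate ones, so each
    estimate can select the power it needs. *)
Definition bessel_weight (t : R) : R :=
  Num.min (t `^ (alpha - 1)) (t `^ (- alpha - 1)).
Local Notation W := bessel_weight.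

Lemma bessel_weight_ge0 t : 0 <= W t.
Proof. by rewrite le_min !powR_ge0. Qed.

Lemma measurable_bessel_weight : measurable_fun setT W.
Proof. by apply: measurable_minr; exact: measurable_powR. Qed.

Lemma bessel_weight_le (b t : R) : - alpha <= b <= alpha -> 0 < t ->
  W t <= t `^ (b - 1).
Proof.
move=> /andP[b1 b2] t0; rewrite ge_min; apply/orP.
have [t1|t1] := leP t 1.
  by left; rewrite ger_powR ?t0// lerB.
by right; rewrite ler_powR ?(ltW t1)// lerB.
Qed.

Lemma bessel_weight_ge (t : R) : 0 < t -> t `^ alpha / (1 + t `^ alpha) ^+ 2 / t <= W t.
Proof.
move=> t0; have ta0 : 0 < t `^ alpha by exact: powR_gt0.
have t1 : t^-1 = t `^ (- 1) by rewrite powR_inv1// ltW.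
have D0 : 0 < (1 + t `^ alpha) ^+ 2 by rewrite exprn_gt0// addr_gt0.
rewrite le_min t1 !(powR_add _ (- 1))// !ler_wpM2r ?powR_ge0//=.
  rewrite powRN ler_pdivrMr// ler_pdivlMl// -expr2.
  by rewrite ler_sqr ?nnegrE ?addr_ge0 ?(ltW ta0)// lerDr.
rewrite ler_pdivrMr// ler_peMr ?(ltW ta0)//.
by rewrite -[leLHS](expr1n _ 2) ler_sqr ?nnegrE ?addr_ge0 ?(ltW ta0)// lerDl ltW.
Qed.

(* The factor [e] selects a range of scales [t]: it is [1], [cut_lo r] or
   [cut_hi r]. *)
Definition bessel_integrand (e : R -> R) (x z : X) (t : R) : R :=
  e t * (t `^ alpha / (1 + t `^ alpha) ^+ 2 * ker x z t / t).

Definition cut_kernel (e : R -> R) (x z : X) : \bar R :=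
  (\int[mu]_(t in P) (bessel_integrand e x z t)%:E)%E.

Definition cut_potential (e : R -> R) (g : X -> R) (x : X) : \bar R :=
  (\int[m]_z ((g z)%:E * cut_kernel e x z))%E.

Lemma bessel_integrand_ge0 (e : R -> R) (x z : X) (t : R) :
  (forall t, 0 <= e t) -> 0 < t -> 0 <= bessel_integrand e x z t.
Proof.
move=> e0 t0; rewrite mulr_ge0// divr_ge0 ?(ltW t0)// mulr_ge0 ?(approx_kernel_ge0 m N HL)//.
by rewrite divr_ge0 ?powR_ge0// exprn_ge0// addr_ge0 ?powR_ge0.
Qed.

Let integrand_factor (t s : R) : 0 < t ->
  t `^ alpha / (1 + t `^ alpha) ^+ 2 * s / t = t `^ alpha / (1 + t `^ alpha) ^+ 2 / t * s.
Proof. by move=> t0; rewrite mulrAC. Qed.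

Lemma bessel_integrand_le (e : R -> R) (x z : X) (t : R) :
  (forall t, 0 <= e t) -> 0 < t ->
  bessel_integrand e x z t <= S * (e t * W t * ball_kernel N x z t).
Proof.
move=> e0 t0; rewrite /bessel_integrand integrand_factor// mulrA.
rewrite [leRHS](_ : _ = e t * W t * (S * ball_kernel N x z t)); last by ring.
apply: ler_pM.
- rewrite mulr_ge0// divr_ge0 ?(ltW t0)// divr_ge0 ?powR_ge0//.
  by rewrite exprn_ge0// addr_ge0 ?powR_ge0.
- exact: (approx_kernel_ge0 m N HL).
- by rewrite ler_wpM2l// bessel_weight_ge.
- exact: (approx_kernel_le X_borel m_regular c_gt0 m_ball m_ball_ge L_gt0 HL).
Qed.

Lemma measurable_bessel_integrand (e : R -> R) (x : X)
    d' (T : measurableType d') (f : T -> X) (k : T -> R) :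
  measurable_fun setT e -> measurable_fun setT f -> measurable_fun setT k ->
  measurable_fun setT (fun w => bessel_integrand e x (f w) (k w)).
Proof.
move=> me mf mk.
have mka : measurable_fun setT (fun w => k w `^ alpha).
  by apply: (measurableT_comp (measurable_powR _)).
apply: measurable_funM; first exact: measurableT_comp.
apply: measurable_funM; last by apply: (measurableT_comp measurable_invr).
apply: measurable_funM; last exact:
  (measurable_approx_kernel X_borel m_regular HL x mf mk).
apply: measurable_funM => //; apply: (measurableT_comp measurable_invr).
by apply: measurable_funX; exact: measurable_funD.
Qed.

Let smu : sigma_finite setT mu := @sigma_finiteT _ _ _ mu.

Lemma cut_kernel_ge0 (e : R -> R) (x z : X) :
  (forall t, 0 <= e t) -> (0 <= cut_kernel e x z)%E.
Proof.
move=> e0; apply: integral_ge0 => t /=; rewrite in_itv/= andbT => t0.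
by rewrite lee_fin bessel_integrand_ge0.
Qed.

Lemma measurable_cut_kernel (e : R -> R) (x : X) :
  measurable_fun setT e -> (forall t, 0 <= e t) ->
  measurable_fun setT (cut_kernel e x).
Proof.
move=> me e0; apply: measurable_tonelli => //.
- apply: measurable_funTS; apply/measurable_EFinP.
  by apply: measurable_bessel_integrand.
- by move=> z t /=; rewrite in_itv/= andbT => t0; rewrite lee_fin bessel_integrand_ge0.
Qed.

Lemma measurable_weighted (e : R -> R) (g : X -> R) :
  measurable_fun setT e -> measurable_fun setT g ->
  measurable_fun [set: X * R] (fun w => e w.2 * W w.2 * `|g w.1|).
Proof.
move=> me mg; apply: measurable_funM.
  apply: measurable_funM; first exact: (measurableT_comp me).
  by apply: (measurableT_comp measurable_bessel_weight).
by apply: measurableT_comp => //; exact: (measurableT_comp mg).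
Qed.

Let abs_cut_potential (e : R -> R) (g : X -> R) (x : X) :
  measurable_fun setT e -> (forall t, 0 <= e t) ->
  measurable_fun setT g ->
  (\int[m]_z `|(g z)%:E * cut_kernel e x z| <=
   S%:E * pot (fun z t => e t * W t * `|g z|)%R x)%E.
Proof.
move=> me e0 mg; have S0 := kernel_constant_gt0 N c_gt0 L_gt0.
have mB := measurable_weighted me mg.
have B0 (z : X) t : 0 <= e t * W t * `|g z|.
  by rewrite mulr_ge0// mulr_ge0// bessel_weight_ge0.
rewrite -(ball_potentialZ X_borel m_regular) ?(ltW S0)//.
apply: ge0_le_integral => //.
- apply: measurableT_comp => //; apply: emeasurable_funM; first exact/measurable_EFinP.
  exact: measurable_cut_kernel.
- apply: (measurable_ball_inner X_borel m_regular).
    by apply: measurable_funM.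
  by move=> z t; rewrite mulr_ge0// ltW.
move=> z _; rewrite abseM (gee0_abs (cut_kernel_ge0 _ _ _))//=.
have mi : measurable_fun P (fun t => bessel_integrand e x z t).
  by apply: measurable_funTS; exact: measurable_bessel_integrand.
rewrite -ge0_integralZl_real//; last first.
  by move=> t /=; rewrite in_itv/= andbT => t0; exact: bessel_integrand_ge0.
apply: ge0_le_integral => //.
- move=> t /=; rewrite in_itv/= andbT => t0.
  by rewrite lee_fin mulr_ge0// bessel_integrand_ge0.
- by apply/measurable_EFinP; exact: measurable_funM.
- apply: (measurable_ball_slice X_borel m_regular (B := fun z t =>
    S * (e t * W t * `|g z|))).
  by apply: measurable_funM.
move=> t /=; rewrite in_itv/= andbT => t0; rewrite lee_fin.
rewrite [leRHS](_ : _ = `|g z| * (S * (e t * W t * ball_kernel N x z t))); last by ring.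
by rewrite ler_wpM2l// bessel_integrand_le.
Qed.

Lemma integrable_cut_potential (e : R -> R) (g : X -> R) (x : X) :
  measurable_fun setT e -> (forall t, 0 <= e t) ->
  measurable_fun setT g ->
  (pot (fun z t => e t * W t * `|g z|)%R x < +oo)%E ->
  m.-integrable setT (fun z => (g z)%:E * cut_kernel e x z)%E.
Proof.
move=> me e0 mg poty; apply/integrableP; split.
  apply: emeasurable_funM; first exact/measurable_EFinP.
  exact: measurable_cut_kernel.
apply: le_lt_trans (abs_cut_potential x me e0 mg) _.
by rewrite lte_mul_pinfty// lee_fin ltW// kernel_constant_gt0.
Qed.

Lemma cut_potential_le (e : R -> R) (g : X -> R) (x : X) :
  measurable_fun setT e -> (forall t, 0 <= e t) ->
  measurable_fun setT g ->
  (`|cut_potential e g x| <= S%:E * pot (fun z t => e t * W t * `|g z|)%R x)%E.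
Proof.
move=> me e0 mg; apply: le_trans (abs_cut_potential x me e0 mg).
apply: le_abse_integral => //; apply: emeasurable_funM; first exact/measurable_EFinP.
exact: measurable_cut_kernel.
Qed.

(** True at every x: where the integral defining the potential does not converge absolutely, the
    right-hand side is +oo. *)
Lemma bessel_potential_le (g : X -> R) (x : X) : measurable_fun setT g ->
  (`|bessel_potential m N H alpha g x| <=
   (alpha * S)%:E * pot (fun z t => W t * `|g z|)%R x)%E.
Proof.
move=> mg; pose one : R -> R := cst 1.
have kE z : (bessel_kernel m N H alpha x z = alpha%:E * cut_kernel one x z)%E.
  congr (_ * _)%E; apply: eq_integral => t _.
  by rewrite /bessel_integrand /one /= mul1r.
have mk : measurable_fun setT (cut_kernel one x).
  by apply: measurable_cut_kernel => //; exact: measurable_cst.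
have k0 z : (0 <= cut_kernel one x z)%E by exact: cut_kernel_ge0.
have potE : pot (fun z t => W t * `|g z|) x = pot (fun z t => one t * W t * `|g z|) x.
  suff -> : (fun (z : X) t => W t * `|g z|) = fun z t => one t * W t * `|g z| by [].
  by apply/funext => z; apply/funext => t; rewrite /one /= mul1r.
rewrite EFinM -muleA potE.
have mgk : measurable_fun setT (fun z => (g z)%:E * cut_kernel one x z)%E.
  by apply: emeasurable_funM mk; exact/measurable_EFinP.
apply: (@le_trans _ _ (\int[m]_z (alpha%:E * `|(g z)%:E * cut_kernel one x z|))%E).
  apply: le_trans; first apply: (le_abse_integral m measurableT).
    apply: emeasurable_funM; first exact/measurable_EFinP.
    by rewrite (funext kE); exact: measurable_funeM.
  rewrite le_eqVlt; apply/orP; left; apply/eqP; apply: eq_integral => z _.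
  by rewrite kE muleCA abseM [X in (X * _)%E = _]gee0_abs// lee_fin ltW.
have mabs : measurable_fun setT (fun z => `|(g z)%:E * cut_kernel one x z|)%E.
  exact: (measurableT_comp _ mgk).
have alphaE : (0 <= alpha%:E)%E by rewrite lee_fin ltW.
rewrite (ge0_integralZl m measurableT mabs (fun _ _ => abse_ge0 _) alphaE).
apply: lee_wpmul2l; first by rewrite lee_fin ltW.
exact: abs_cut_potential.
Qed.

Definition cut_lo (r t : R) : R := (t <= r)%R%:R.
Definition cut_hi (r t : R) : R := (r < t)%R%:R.

Lemma measurable_cut_lo r : measurable_fun setT (cut_lo r).
Proof. by apply: measurable_natr; exact: measurable_fun_ler. Qed.
Lemma measurable_cut_hi r : measurable_fun setT (cut_hi r).
Proof. by apply: measurable_natr; exact: measurable_fun_ltr. Qed.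

Let lo0 r t : 0 <= cut_lo r t. Proof. by []. Qed.
Let hi0 r t : 0 <= cut_hi r t. Proof. by []. Qed.

(** Finiteness of the dominating potential makes both ranges of scales integrable, which allows
    their integrals to be added for a g of varying sign. *)
Lemma bessel_potential_split (g : X -> R) (x : X) (r : R) : measurable_fun setT g ->
  (pot (fun z t => W t * `|g z|)%R x < +oo)%E ->
  (bessel_potential m N H alpha g x =
   alpha%:E * (cut_potential (cut_lo r) g x + cut_potential (cut_hi r) g x))%E.
Proof.
move=> mg poty.
have cut1 t : cut_lo r t + cut_hi r t = 1.
  by rewrite /cut_lo /cut_hi; case: leP => _ /=; rewrite ?addr0 ?add0r.
have finite (e :
    R -> R) : measurable_fun setT e -> (forall t, 0 <= e t) -> (forall t, e t <= 1) ->
    (pot (fun z t => e t * W t * `|g z|)%R x < +oo)%E.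
  move=> me e0 e1; apply: le_lt_trans poty.
  apply: (le_ball_potential X_borel m_regular) => //.
  - exact: measurable_weighted.
  - apply: measurable_funM; first exact: (measurableT_comp measurable_bessel_weight).
    by apply: measurableT_comp => //; exact: (measurableT_comp mg).
  - by move=> z t; rewrite mulr_ge0// mulr_ge0// bessel_weight_ge0.
  - by move=> z t; rewrite mulr_ge0// bessel_weight_ge0.
  - by move=> z t t0; rewrite ler_wpM2r// ler_piMl// bessel_weight_ge0.
have mlo := measurable_cut_lo r; have mhi := measurable_cut_hi r.
have ilo : m.-integrable setT (fun z => (g z)%:E * cut_kernel (cut_lo r) x z)%E.
  apply: (integrable_cut_potential mlo (lo0 r) mg); apply: (finite _ mlo (lo0 r)) => t.
  by rewrite /cut_lo; case: (t <= r).
have ihi : m.-integrable setT (fun z => (g z)%:E * cut_kernel (cut_hi r) x z)%E.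
  apply: (integrable_cut_potential mhi (hi0 r) mg); apply: (finite _ mhi (hi0 r)) => t.
  by rewrite /cut_hi; case: (r < t).
rewrite /cut_potential -(integralD measurableT ilo ihi).
rewrite -(integralZl measurableT (integrableD measurableT ilo ihi)).
apply: eq_integral => z _.
rewrite -ge0_muleDr ?cut_kernel_ge0// muleCA; congr (_ * (_ * _))%E.
rewrite /cut_kernel -ge0_integralD//; last 4 first.
- by move=> t /=; rewrite in_itv/= andbT => t0; rewrite lee_fin bessel_integrand_ge0.
- by apply: measurable_funTS; apply/measurable_EFinP; exact: measurable_bessel_integrand.
- by move=> t /=; rewrite in_itv/= andbT => t0; rewrite lee_fin bessel_integrand_ge0.
- by apply: measurable_funTS; apply/measurable_EFinP; exact: measurable_bessel_integrand.
apply: eq_integral => t _; rewrite -EFinD /bessel_integrand -mulrDl.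
by rewrite cut1 mul1r.
Qed.

End bessel.

(** * Oscillation of the Bessel potential on a ball *)

Section oscillation.
Context {d : measure_display} {R : realType} {X : metricMeasurableType d R}.
Variables (m : {measure set X -> \bar R}) (N c : R) (H : R -> R) (L : R).
Hypotheses (X_borel : borel_measurable X) (N_gt0 : 0 < N)
  (m_regular : ahlfors_regular m N) (c_gt0 : 0 < c)
  (m_ball : forall (x : X) r, 0 < r -> (m (ball x r) <= (c * r `^ N)%:E)%E)
  (m_ball_ge : forall (x : X) r, 0 < r -> ((c^-1 * r `^ N)%:E <= m (ball x r))%E)
  (L_gt0 : 0 < L) (HL : lipschitz_cutoff H L).
Local Notation mu := (@lebesgue_measure R).
Local Notation P := (`]0%R, +oo[%classic : set R).

Variable alpha : R.
Hypothesis alpha_gt0 : 0 < alpha.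
Local Notation ker := (approx_kernel m N H).
Local Notation pot := (ball_potential m N).
Local Notation S := (kernel_constant N c L).
Local Notation W := (bessel_weight alpha).
Local Notation K := (cut_kernel m N H alpha).
Local Notation V := (cut_potential m N H alpha).
Local Notation integrand := (bessel_integrand m N H alpha).

Let S0 : 0 < S. Proof. exact: kernel_constant_gt0. Qed.
Let hi0 r t : 0 <= cut_hi r t :> R. Proof. by []. Qed.
Let lo0 r t : 0 <= cut_lo r t :> R. Proof. by []. Qed.
Let mhi (r : R) := measurable_cut_hi r.
Let mW : measurable_fun setT W := measurable_bessel_weight alpha.

Let minteg (r : R) x z : measurable_fun P (fun t => integrand (cut_hi r) x z t).
Proof.
apply: measurable_funTS.
exact: (measurable_bessel_integrand X_borel m_regular HL).
Qed.

(** Kernels at two points can be subtracted once they are finite. Above the scale r the integrand is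
    at most S t^(-(alpha + N) - 1), also on the diagonal. *)
Let integrable_hi (r : R) x z : 0 < r ->
  mu.-integrable P (EFin \o integrand (cut_hi r) x z).
Proof.
move=> r0; apply/integrableP; split; first by apply/measurable_EFinP; exact: minteg.
have aN : 0 < alpha + N by rewrite addr_gt0.
apply: (@le_lt_trans _ _ (S%:E * (r `^ (- (alpha + N)) / (alpha + N))%:E)%E);
  last first.
  by rewrite -EFinM ltry.
apply: (@le_trans _ _ (\int[mu]_(t in P)
    (S * ((r < t)%R%:R * t `^ (- (alpha + N) - 1)))%:E)%E).
  apply: ge0_le_integral => //.
  - by apply/measurable_EFinP; apply: measurableT_comp => //; exact: minteg.
  - apply/measurable_EFinP; apply: measurable_funTS.
    apply: measurable_funM => //; apply: measurable_funM; last exact: measurable_powR.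
    exact: mhi.
  move=> t; rewrite /= in_itv/= andbT => t0; rewrite lee_fin.
  rewrite ger0_norm ?(bessel_integrand_ge0 m N HL)//.
  apply: le_trans (bessel_integrand_le X_borel m_regular c_gt0 m_ball m_ball_ge L_gt0
    HL alpha x z (hi0 r) t0) _.
  rewrite ler_pM2l// -mulrA ler_wpM2l//.
  rewrite (_ : - (alpha + N) - 1 = (- alpha - 1) - N); last by ring.
  rewrite powR_add// ler_pM ?bessel_weight_ge0 ?ball_kernel_ge0//.
    by apply: bessel_weight_le => //; rewrite lexx/= ge0_cp// ltW.
  by rewrite /ball_kernel ler_piMr ?powR_ge0//; case: (_ < _).
rewrite ge0_integralZl_real ?(ltW S0)//; last 2 first.
- by move=> t _; rewrite mulr_ge0 ?powR_ge0.
- apply: measurable_funTS; apply: measurable_funM; last exact: measurable_powR.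
  exact: mhi.
apply: lee_wpmul2l; first by rewrite lee_fin ltW.
exact: integral_powR_gt.
Qed.

Let K_fin (r : R) x z : 0 < r -> K (cut_hi r) x z \is a fin_num.
Proof. by move=> r0; apply: integrable_fin_num => //; exact: integrable_hi. Qed.

(** The weight that remains at scales above r when the Lipschitz bound of the kernel has supplied
    the factor d(x, y) / t. *)
Let u (r t : R) : R := cut_hi r t * (W t * t `^ (- 1)).

Let u0 r t : 0 <= u r t.
Proof. by rewrite mulr_ge0// mulr_ge0 ?powR_ge0// bessel_weight_ge0. Qed.

Let mu_ r : measurable_fun setT (u r).
Proof.
apply: measurable_funM; first exact: mhi.
by apply: measurable_funM => //; exact: measurable_powR.
Qed.

Let K_lip (r : R) x y z : 0 < r ->
  (`|K (cut_hi r) x z - K (cut_hi r) y z| <= \int[mu]_(t in P)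
    (S * mdist x y * u r t * (ball_kernel N x z t + ball_kernel N y z t))%:E)%E.
Proof.
move=> r0; rewrite /cut_kernel -integralB_EFin//; last 2 first.
- exact: integrable_hi.
- exact: integrable_hi.
have mB :
    measurable_fun P (fun t => integrand (cut_hi r) x z t - integrand (cut_hi r) y z t).
  by apply: measurable_funB; exact: minteg.
have mk (v w : X) : measurable_fun P (fun t => ball_kernel N v w t).
  by apply: measurable_funTS; exact: (measurable_ball_kernel X_borel m_regular).
apply: le_trans; first apply: (le_abse_integral mu (measurable_itv _)).
  exact/measurable_EFinP.
apply: ge0_le_integral => //.
- by apply/measurable_EFinP; exact: (measurableT_comp _ mB).
- apply/measurable_EFinP; apply: measurable_funM; last first.
    by apply: measurable_funD; exact: mk.
  apply: measurable_funM => //; apply: measurable_funTS; exact: mu_.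
move=> t; rewrite /= in_itv/= andbT => t0; rewrite lee_fin.
rewrite (_ : _ - _ = cut_hi r t * (t `^ alpha / (1 + t `^ alpha) ^+ 2 / t) *
  (ker x z t - ker y z t)); last by rewrite /bessel_integrand; ring.
have w0 : 0 <= t `^ alpha / (1 + t `^ alpha) ^+ 2 / t.
  rewrite divr_ge0 ?(ltW t0)// divr_ge0 ?powR_ge0// exprn_ge0// addr_ge0//.
  exact: powR_ge0.
rewrite normrM ger0_norm; last by rewrite mulr_ge0.
apply: (@le_trans _ _ (cut_hi r t * W t * (S * (mdist x y / t) *
    (ball_kernel N x z t + ball_kernel N y z t)))).
  apply: ler_pM => //; first exact: mulr_ge0.
    by apply: ler_wpM2l => //; exact: bessel_weight_ge.
  exact: (approx_kernel_lip X_borel m_regular c_gt0 m_ball m_ball_ge L_gt0 HL).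
rewrite /u powR_inv1 ?(ltW t0)// le_eqVlt; apply/orP; left; apply/eqP.
by ring.
Qed.

Let mprod (v : R -> R) (g : X -> R) : measurable_fun setT v -> measurable_fun setT g ->
  measurable_fun [set: X * R] (fun w => v w.2 * `|g w.1|).
Proof.
move=> mv mg; apply: measurable_funM; first exact: (measurableT_comp mv).
by apply: measurableT_comp => //; exact: (measurableT_comp mg).
Qed.

Let cut_potential_lip (g : X -> R) (x y : X) (r : R) : measurable_fun setT g -> 0 < r ->
  (pot (fun z t => cut_hi r t * W t * `|g z|)%R x < +oo)%E ->
  (pot (fun z t => cut_hi r t * W t * `|g z|)%R y < +oo)%E ->
  (`|V (cut_hi r) g x - V (cut_hi r) g y| <= (S * mdist x y)%:E *
    (pot (fun z t => u r t * `|g z|)%R x + pot (fun z t => u r t * `|g z|)%R y))%E.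
Proof.
move=> mg r0 px py.
have ix := integrable_cut_potential X_borel m_regular c_gt0 m_ball m_ball_ge L_gt0
  HL (mhi r) (hi0 r) mg px.
have iy := integrable_cut_potential X_borel m_regular c_gt0 m_ball m_ball_ge L_gt0
  HL (mhi r) (hi0 r) mg py.
have mB := mprod (mu_ r) mg.
have B0 (z : X) t : 0 <= u r t * `|g z| by rewrite mulr_ge0.
have SD0 : 0 <= S * mdist x y by rewrite mulr_ge0 ?mdist_ge0// ltW.
pose B (z : X) t := S * mdist x y * (u r t * `|g z|).
have mSB : measurable_fun [set: X * R] (fun w => B w.1 w.2) by exact: measurable_funM.
have SB0 (z : X) t : 0 <= B z t by rewrite mulr_ge0.
have potZ v : ((S * mdist x y)%:E * pot (fun z t => u r t * `|g z|)%R v = pot B v)%E.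
  by rewrite -(@ball_potentialZ _ _ _ m N X_borel m_regular
    (fun z t => u r t * `|g z|) _ v mB B0 SD0).
have -> : ((S * mdist x y)%:E * (pot (fun z t => u r t * `|g z|)%R x +
    pot (fun z t => u r t * `|g z|)%R y) = pot B x + pot B y)%E.
  by rewrite -(potZ x) -(potZ y); apply: ge0_muleDr; exact: ball_potential_ge0.
rewrite /cut_potential -(integralB measurableT ix iy).
have mxy := measurable_int _ (integrableB measurableT ix iy).
apply: le_trans (le_abse_integral m measurableT mxy) _.
have in0 v w : (0 <= \int[mu]_(t in P) (B w t * ball_kernel N v w t)%:E)%E.
  by apply: integral_ge0 => t _; rewrite lee_fin mulr_ge0 ?ball_kernel_ge0.
have min v := measurable_ball_inner X_borel m_regular mSB SB0 v.
rewrite /ball_potential -(ge0_integralD _ measurableT (fun w _ => in0 x w) (min x)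
  (fun w _ => in0 y w) (min y)).
apply: (ge0_le_integral _ measurableT) => //.
- exact: (measurableT_comp _ mxy).
- exact: emeasurable_funD.
move=> z _ /=; have msl v := measurable_ball_slice X_borel m_regular mSB v z.
have sl0 v t : P t -> (0 <= (B z t * ball_kernel N v z t)%:E)%E.
  by move=> _; rewrite lee_fin mulr_ge0 ?ball_kernel_ge0.
have -> : (\int[mu]_(t in P) (B z t * ball_kernel N x z t)%:E +
    \int[mu]_(t in P) (B z t * ball_kernel N y z t)%:E =
    \int[mu]_(t in P) (B z t * ball_kernel N x z t + B z t * ball_kernel N y z t)%:E)%E.
  under [RHS]eq_integral do rewrite EFinD.
  by rewrite ge0_integralD//; first [exact: sl0|exact: msl].
rewrite -muleBr//; last by rewrite fin_num_adde_defr// K_fin.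
rewrite abseM; apply: (@le_trans _ _ (`|g z|%:E * \int[mu]_(t in P)
    (S * mdist x y * u r t * (ball_kernel N x z t + ball_kernel N y z t))%:E)%E).
  by apply: lee_wpmul2l => //; exact: K_lip.
rewrite -ge0_integralZl_real//; last 2 first.
- by move=> t _; rewrite mulr_ge0 ?addr_ge0 ?ball_kernel_ge0// mulr_ge0.
- apply: measurable_funTS; apply: measurable_funM.
    by apply: measurable_funM => //; exact: mu_.
  by apply: measurable_funD; exact: (measurable_ball_kernel X_borel m_regular).
rewrite le_eqVlt; apply/orP; left; apply/eqP; apply: eq_integral => t _.
by rewrite /B; congr EFin; ring.
Qed.

Let far_potential_le (v : R -> R) (b : R) (g : X -> R) p G y r : 1 < p ->
  measurable_fun setT v -> (forall t, 0 <= v t) -> 0 < b -> 0 < r ->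
  (forall t, 0 < t -> v t * t `^ (- (N / p)) <= (r < t)%R%:R * t `^ (- b - 1)) ->
  measurable_fun setT g -> 0 < G -> (\int[m]_z (`|g z| `^ p)%:E <= (G `^ p)%:E)%E ->
  (pot (fun z t => v t * `|g z|)%R y <=
    ((c + 1) * 4 `^ (N - N / p) * G * (r `^ (- b) / b))%:E)%E.
Proof.
move=> p1 mv v0 b0 r0 vb mg G0 gG.
have mag : measurable_fun setT (fun z => `|g z|) by exact: measurableT_comp.
have ag0 z : 0 <= `|g z| by [].
have := potential_far_le X_borel m_regular c_gt0 m_ball y p1 mv v0 mag ag0 G0 gG.
move/le_trans; apply; rewrite [leRHS]EFinM; apply: lee_wpmul2l.
  by rewrite lee_fin mulr_ge0 ?(ltW G0)// mulr_ge0 ?powR_ge0// addr_ge0// ltW.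
apply: le_trans (integral_powR_gt b0 r0); apply: ge0_le_integral => //.
- by move=> t _; rewrite lee_fin mulr_ge0 ?powR_ge0.
- apply/measurable_EFinP; apply: measurable_funTS; apply: measurable_funM.
    exact: mv.
  exact: measurable_powR.
- apply/measurable_EFinP; apply: measurable_funTS.
  by apply: measurable_funM; [exact: mhi|exact: measurable_powR].
by move=> t; rewrite /= in_itv/= andbT => t0; rewrite lee_fin vb.
Qed.

(** At large scales the Lipschitz bound and Hoelder's inequality leave t^(alpha - N/p - 2),
    integrable at infinity because alpha - N/p < 1; the resulting r^(alpha - N/p - 1) meets the
    factor d(x, y) <= r. Small scales stay a potential on the right, to be averaged over the ball
    for BMO and bounded pointwise for the Hoelder norm. *)
Lemma bessel_potential_oscillation p : 1 < p -> alpha - N / p < 1 ->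
  exists2 C : R, 0 < C & forall (g : X -> R) (G : R), measurable_fun setT g ->
    0 < G -> (\int[m]_z (`|g z| `^ p)%:E <= (G `^ p)%:E)%E ->
    forall y r, 0 < r -> exists l : R, forall x, mdist x y <= r ->
    (pot (fun z t => W t * `|g z|)%R x < +oo)%E ->
    (`|bessel_potential m N H alpha g x - l%:E| <=
      C%:E * (pot (fun z t => cut_lo r t * t `^ (alpha - 1) * `|g z|)%R x +
        (G * r `^ (alpha - N / p))%:E))%E.
Proof.
move=> p1 d1; have p0 : 0 < p by exact: lt_trans p1.
pose dl := alpha - N / p; have d1' : 0 < 1 - dl by rewrite subr_gt0.
pose Kp := (c + 1) * 4 `^ (N - N / p).
have Kp0 : 0 < Kp by rewrite mulr_gt0 ?powR_gt0// addr_gt0.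
(* The 2 counts the points x and y, [Kp] comes from Hoelder's inequality on balls, and 1 / (1 - dl)
   from the integral over the scales above r. *)
pose C2 := 2 * Kp / (1 - dl).
have C20 : 0 < C2 by rewrite divr_gt0// mulr_gt0.
exists (alpha * S * (1 + C2)); first by rewrite mulr_gt0 ?addr_gt0// mulr_gt0.
move=> g G mg G0 gG y r r0.
have Np : 0 < N / p by rewrite divr_gt0.
(* The decay t^(-alpha - 1) of the weight makes the scales above r converge at every point. *)
have pfar v : (pot (fun z t => cut_hi r t * W t * `|g z|)%R v < +oo)%E.
  apply: le_lt_trans (ltry _).
  apply: (@far_potential_le (fun t => cut_hi r t * W t) (alpha + N / p) g p G v r) => //.
  - by apply: measurable_funM => //; exact: mhi.
  - by move=> t; rewrite mulr_ge0// bessel_weight_ge0.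
  - by rewrite addr_gt0.
  - move=> t t0; rewrite -mulrA ler_wpM2l//.
    rewrite (_ : - (alpha + N / p) - 1 = - alpha - 1 + - (N / p)); last by ring.
    rewrite [leRHS]powR_add// ler_wpM2r ?powR_ge0//.
    by apply: bessel_weight_le => //; rewrite lexx/= ge0_cp// ltW.
have pu v : (pot (fun z t => u r t * `|g z|)%R v <=
    (Kp * G * (r `^ (- (1 - dl)) / (1 - dl)))%:E)%E.
  apply: (@far_potential_le (u r) (1 - dl) g p G v r p1 (mu_ r) (u0 r) d1' r0 _ mg G0 gG).
  move=> t t0; rewrite /u -mulrA ler_wpM2l// -mulrA -powR_add//.
  apply: (@le_trans _ _ (t `^ (alpha - 1) * t `^ (- 1 + - (N / p)))).
    rewrite ler_wpM2r ?powR_ge0//; apply: bessel_weight_le => //.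
    by rewrite lexx andbT ge0_cp// ltW.
  by rewrite -powR_add// le_eqVlt; apply/orP; left; apply/eqP; congr (_ `^ _); rewrite /dl; ring.
have Vfin v : V (cut_hi r) g v \is a fin_num.
  apply: integrable_fin_num => //.
  exact: (integrable_cut_potential X_borel m_regular c_gt0 m_ball m_ball_ge L_gt0
    HL (mhi r) (hi0 r) mg (pfar v)).
(* Only the scales above r enter l: the full potential at the centre y may be infinite. *)
exists (alpha * fine (V (cut_hi r) g y)) => x xy px.
rewrite (bessel_potential_split X_borel m_regular c_gt0 m_ball m_ball_ge L_gt0 HL
  r mg px).
have mlo := measurable_cut_lo r.
have Vlo : (`|V (cut_lo r) g x| <=
    S%:E * pot (fun z t => cut_lo r t * t `^ (alpha - 1) * `|g z|)%R x)%E.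
  apply: le_trans (cut_potential_le X_borel m_regular c_gt0 m_ball m_ball_ge L_gt0
    HL alpha x mlo (lo0 r) mg) _.
  apply: lee_wpmul2l; first by rewrite lee_fin ltW.
  apply: (le_ball_potential X_borel m_regular).
  - apply: (@mprod (fun t => cut_lo r t * W t)) => //.
    by apply: measurable_funM.
  - apply: (@mprod (fun t => cut_lo r t * t `^ (alpha - 1))) => //.
    by apply: measurable_funM => //; exact: measurable_powR.
  - by move=> z t; rewrite mulr_ge0// mulr_ge0// bessel_weight_ge0.
  - by move=> z t; rewrite mulr_ge0// mulr_ge0// powR_ge0.
  - move=> z t t0; rewrite ler_wpM2r// ler_wpM2l//; apply: bessel_weight_le => //.
    by rewrite lexx andbT ge0_cp// ltW.
have Vhi : (`|V (cut_hi r) g x - V (cut_hi r) g y| <=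
    (S * (C2 * (G * r `^ dl)))%:E)%E.
  apply: le_trans (cut_potential_lip mg r0 (pfar x) (pfar y)) _.
  apply: (@le_trans _ _ ((S * r)%:E * (Kp * G * (r `^ (- (1 - dl)) / (1 - dl)) +
      Kp * G * (r `^ (- (1 - dl)) / (1 - dl)))%R%:E)%E).
    apply: lee_pmul => //.
    - by rewrite lee_fin mulr_ge0 ?mdist_ge0// ltW.
    - by rewrite adde_ge0// ball_potential_ge0// => z t; rewrite mulr_ge0.
    - by rewrite lee_fin ler_wpM2l// ltW.
    - by rewrite EFinD leeD.
  rewrite -EFinM lee_fin (_ : r `^ dl = r * r `^ (- (1 - dl))); last first.
    rewrite -{2}(powRr1 (ltW r0)) -powR_add//; congr (_ `^ _); ring.
  by rewrite /C2 le_eqVlt; apply/orP; left; apply/eqP; ring.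
set p1x := pot (fun z t => cut_lo r t * _ * _) x in Vlo *.
have p1x0 : (0 <= p1x)%E.
  by apply: ball_potential_ge0 => z t; rewrite !mulr_ge0 ?powR_ge0.
have C0 : 0 < alpha * S * (1 + C2) by rewrite mulr_gt0 ?addr_gt0// mulr_gt0.
move: p1x p1x0 Vlo => [P1| |]// P10 Vlo; last first.
  by rewrite addye// gt0_muley ?lte_fin// leey.
rewrite lee_fin in P10.
move: (Vfin x) (Vfin y) Vhi; case: (V (cut_hi r) g x) => // vx _.
case: (V (cut_hi r) g y) => // vy _ Vhi.
move: Vlo; case: (V (cut_lo r) g x) => [vl| |]// Vlo.
rewrite -!EFinD -!EFinM lee_fin /=.
rewrite -EFinM lee_fin /= in Vlo; rewrite -EFinB lee_fin /= in Vhi.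
rewrite (_ : _ - _ = alpha * (vl + (vx - vy))); last by ring.
rewrite normrM gtr0_norm// -!mulrA ler_pM2l//.
apply: le_trans (ler_normD _ _) _.
apply: (@le_trans _ _ (S * P1 + S * (C2 * (G * r `^ dl)))); first by rewrite lerD.
rewrite -mulrDr ler_pM2l// mulrDr !mulrDl !mul1r -/dl.
have E0 : 0 <= G * r `^ dl by rewrite mulr_ge0 ?powR_ge0// ltW.
have CP : 0 <= C2 * P1 by rewrite mulr_ge0// ltW.
by lra.
Qed.

End oscillation.

(** * From integrals of powers to norms, and the criterion for an embedding *)

Section Lnorm_lemmas.
Context {d : measure_display} {T : measurableType d} {R : realType}.
Variable m : {measure set T -> \bar R}.

Let Lnorm_poweR (f : T -> R) (p : R) : p != 0 ->
  (\int[m]_z (`|f z| `^ p)%:E = 'N[m]_p%:E[EFin \o f] `^ p)%E.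
Proof.
by move=> p0; rewrite poweR_Lnorm//; apply: eq_integral => z _ /=.
Qed.

Lemma integral_powR_Lnorm_le (f : T -> R) (p G : R) : 0 < p -> 0 <= G ->
  ('N[m]_p%:E[EFin \o f] <= G%:E)%E ->
  (\int[m]_z (`|f z| `^ p)%:E <= (G `^ p)%:E)%E.
Proof.
move=> p0 G0 fG; rewrite Lnorm_poweR ?gt_eqF//.
rewrite -poweR_EFin gt0_ler_poweR ?(ltW p0)// in_itv/= ?leey ?andbT ?Lnorm_ge0//.
Qed.

Lemma Lnorm_integral_powR_le (f : T -> R) (p G : R) : 0 < p -> 0 <= G ->
  (\int[m]_z (`|f z| `^ p)%:E <= (G `^ p)%:E)%E ->
  ('N[m]_p%:E[EFin \o f] <= G%:E)%E.
Proof.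
move=> p0 G0; rewrite Lnorm_poweR ?gt_eqF// => fG.
have p'0 : 0 <= p^-1 by rewrite invr_ge0 ltW.
have := @gt0_ler_poweR R p^-1 p'0 ('N[m]_p%:E[EFin \o f] `^ p)%E (G `^ p)%:E.
rewrite !in_itv/= !leey !andbT poweR_ge0 lee_fin powR_ge0 => /(_ isT isT fG).
rewrite -poweRrM mulfV ?gt_eqF// poweRe1 ?Lnorm_ge0//.
by rewrite -powRrM mulfV ?gt_eqF// powRr1.
Qed.

End Lnorm_lemmas.

Section criterion.
Context {d : measure_display} {R : realType} {X : metricMeasurableType d R}.
Variables (m : {measure set X -> \bar R}) (N : R) (h : R -> R) (alpha p : R).
Hypothesis p_gt0 : 0 < p.

(* Linearity of the potential operator is not needed: the norm of a difference
   of two members is small only if the difference is itself a potential. *)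
Lemma embedding_of_bound (B : fun_space X R) :
  (exists2 C : R, 0 < C & forall (f g : X -> R) (G : R),
    measurable_fun setT f -> measurable_fun setT g ->
    EFin \o f = bessel_potential m N h alpha g %[ae m] -> 0 < G ->
    (\int[m]_z (`|g z| `^ p)%:E <= (G `^ p)%:E)%E ->
    members B f /\ (fnorm B f <= (C * G)%:E)%E) ->
  potential_space m N h alpha p \hookrightarrow B.
Proof.
move=> [C C0 bound].
have Lp (g : X -> R) : g \in Lfun m p%:E ->
    measurable_fun setT g /\ ('N[m]_p%:E[EFin \o g] < +oo)%E.
  by rewrite inE => /andP[/[!inE]/= mg gfin].
split.
  move=> f [mf [g [gp fg]]]; have [mg gfin] := Lp _ gp.
  (* The 1 keeps G positive when g vanishes almost everywhere. *)
  pose G := fine 'N[m]_p%:E[EFin \o g] + 1.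
  have n0 : (0 <= 'N[m]_p%:E[EFin \o g])%E by exact: Lnorm_ge0.
  have G0 : 0 < G by rewrite ltr_wpDl// fine_ge0.
  apply: (bound f g G mf mg fg G0 _).1.
  apply: integral_powR_Lnorm_le => //; first exact: ltW.
  by rewrite -[leLHS]fineK ?ge0_fin_numE// lee_fin lerDl.
(* The 2 leaves room to pass from the non-strict bound C * G to a strict one. *)
move=> f [mf _] e e0; exists (e / (2 * C)); first by rewrite divr_gt0// mulr_gt0.
move=> g [mg _] /=; set nf := ('N[m]_p%:E[_])%E => small.
have nf0 : (0 <= nf)%E by exact: Lnorm_ge0.
have : (ereal_inf [set ('N[m]_p%:E[EFin \o g0])%E |
    g0 in is_bessel_potential m N h alpha p (g \- f)%R] < (e / (2 * C))%:E)%E.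
  by apply: le_lt_trans small; rewrite leeDr.
move=> /ereal_inf_lt[_ [w [wp fw] <-] wlt].
have [mw _] := Lp _ wp.
have e2 : 0 < e / (2 * C) by rewrite divr_gt0// mulr_gt0.
have wle := integral_powR_Lnorm_le p_gt0 (ltW e2) (ltW wlt).
have mgf : measurable_fun setT (g \- f)%R by exact: measurable_funB.
have [_] := bound _ w _ mgf mw fw e2 wle.
move=> /le_lt_trans; apply; rewrite lte_fin.
rewrite (_ : C * _ = e / 2); last by field; rewrite gt_eqF.
by rewrite ltr_pdivrMr// ltr_pMr// ltr1n.
Qed.

End criterion.

(** * Change of the cutoff on the negative half-line *)

Section cutoff_change.
Context {d : measure_display} {R : realType} {X : metricMeasurableType d R}.
Variables (m : {measure set X -> \bar R}) (N : R) (h k : R -> R).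
Hypothesis hk : forall x, 0 <= x -> h x = k x.

Let hkE (x z : X) (t : R) : 0 < t -> h (mdist x z / t) = k (mdist x z / t).
Proof. by move=> t0; rewrite hk// divr_ge0 ?mdist_ge0// ltW. Qed.

Let avgE (t : R) (F1 F2 : X -> R) x : 0 < t -> F1 =1 F2 ->
  approx_avg m N h t F1 x = approx_avg m N k t F2 x.
Proof.
move=> t0 F12; rewrite /approx_avg.
have -> : \int[m]_y (h (mdist x y / t) * F1 y) = \int[m]_y (k (mdist x y / t) * F2 y).
  by apply: eq_Rintegral => z _; rewrite (hkE x z t0) F12.
exact: erefl.
Qed.

Let phiE x (t : R) : 0 < t -> approx_phi m N h x t = approx_phi m N k x t.
Proof. by move=> t0; rewrite /approx_phi (avgE x t0 (frefl _)). Qed.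

Let psiE x (t : R) : 0 < t -> approx_psi m N h x t = approx_psi m N k x t.
Proof.
by move=> t0; rewrite /approx_psi (avgE x t0 (fun y => phiE y t0)).
Qed.

Let kerE x z (t : R) : 0 < t ->
  approx_kernel m N h x z t = approx_kernel m N k x z t.
Proof.
move=> t0.
have intE : \int[m]_w (h (mdist x w / t) * h (mdist z w / t) * approx_psi m N h w t) =
    \int[m]_w (k (mdist x w / t) * k (mdist z w / t) * approx_psi m N k w t).
  apply: eq_Rintegral => w _.
  by rewrite (psiE w t0) (hkE x w t0) (hkE z w t0).
rewrite /approx_kernel (phiE x t0) (phiE z t0).
exact: (congr1 (fun v => approx_phi m N k x t * approx_phi m N k z t / t `^ (2 * N) * v) intE).
Qed.

Let bessel_kernelE alpha x z :
  bessel_kernel m N h alpha x z = bessel_kernel m N k alpha x z.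
Proof.
have intE : (\int[lebesgue_measure]_(t in `]0%R, +oo[)
      (t `^ alpha / (1 + t `^ alpha) ^+ 2 * approx_kernel m N h x z t / t)%:E =
    \int[lebesgue_measure]_(t in `]0%R, +oo[)
      (t `^ alpha / (1 + t `^ alpha) ^+ 2 * approx_kernel m N k x z t / t)%:E)%E.
  apply: eq_integral => t; rewrite inE/= in_itv/= andbT => t0.
  by rewrite (kerE x z t0).
exact: (congr1 (fun v => alpha%:E * v)%E intE).
Qed.

(** The kernel integrates over t > 0, where the cutoff is evaluated at quotients d(x, z) / t >= 0
    only. *)
Lemma eq_bessel_potential alpha (g : X -> R) :
  bessel_potential m N h alpha g = bessel_potential m N k alpha g.
Proof.
apply/funext => x; rewrite /bessel_potential.
by apply: eq_integral => z _; rewrite bessel_kernelE.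
Qed.

End cutoff_change.

(** * Bounds for Bessel potentials in L^p, L^q and L^oo *)

Section embeddings.
Context {d : measure_display} {R : realType} {X : metricMeasurableType d R}.
Variables (m : {measure set X -> \bar R}) (N c : R) (H : R -> R) (L : R).
Hypotheses (X_borel : borel_measurable X) (N_gt0 : 0 < N)
  (m_regular : ahlfors_regular m N) (c_gt0 : 0 < c)
  (m_ball : forall (x : X) r, 0 < r -> (m (ball x r) <= (c * r `^ N)%:E)%E)
  (m_ball_ge : forall (x : X) r, 0 < r -> ((c^-1 * r `^ N)%:E <= m (ball x r))%E)
  (L_gt0 : 0 < L) (HL : lipschitz_cutoff H L).
Local Notation mu := (@lebesgue_measure R).
Local Notation P := (`]0%R, +oo[%classic : set R).

Variables (alpha p : R).
Hypotheses (alpha_gt0 : 0 < alpha) (p_gt1 : 1 < p).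
Local Notation pot := (ball_potential m N).
Local Notation S := (kernel_constant N c L).
Local Notation W := (bessel_weight alpha).
Local Notation J := (bessel_potential m N H alpha).

Let p0 : 0 < p. Proof. exact: lt_trans p_gt1. Qed.
Let S0 : 0 < S. Proof. exact: kernel_constant_gt0. Qed.
Let aS0 : 0 < alpha * S. Proof. exact: mulr_gt0. Qed.
Let W0 t : 0 <= W t. Proof. exact: bessel_weight_ge0. Qed.
Let mW : measurable_fun setT W := measurable_bessel_weight alpha.

(* Splits the integral of the weight at [t = 1], where the minimum defining it
   switches from one power to the other. *)
Lemma bessel_weight_integral b : 0 <= b -> b < alpha ->
  (\int[mu]_(t in P) (W t * t `^ (- b))%:E <=
   ((alpha - b)^-1 + (alpha + b)^-1)%:E)%E.
Proof.
move=> b0 ba.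
have ab1 : 0 < alpha - b by rewrite subr_gt0.
have ab2 : 0 < alpha + b by rewrite ltr_pwDl.
have mlo : measurable_fun P (fun t => (t <= 1)%R%:R * t `^ (alpha - b - 1)).
  apply: measurable_funTS; apply: measurable_funM; last exact: measurable_powR.
  by apply: measurable_natr; exact: measurable_fun_ler.
have mhi : measurable_fun P (fun t => (1 < t)%R%:R * t `^ (- (alpha + b) - 1)).
  apply: measurable_funTS; apply: measurable_funM; last exact: measurable_powR.
  by apply: measurable_natr; exact: measurable_fun_ltr.
apply: (@le_trans _ _ (\int[mu]_(t in P) ((t <= 1)%R%:R * t `^ (alpha - b - 1) +
    (1 < t)%R%:R * t `^ (- (alpha + b) - 1))%:E)%E).
  apply: ge0_le_integral => //.
  - by move=> t _; rewrite lee_fin mulr_ge0 ?powR_ge0.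
  - apply/measurable_EFinP; apply: measurable_funTS; apply: measurable_funM.
      exact: mW.
    exact: measurable_powR.
  - by apply/measurable_EFinP; exact: measurable_funD.
  move=> t; rewrite /= in_itv/= andbT => t0; rewrite lee_fin.
  have [t1|t1] := leP t 1; rewrite ?mul1r ?mul0r ?addr0 ?add0r.
  - rewrite (_ : alpha - b - 1 = alpha - 1 - b); last by ring.
    rewrite (powR_add (alpha - 1))// ler_wpM2r ?powR_ge0//.
    by apply: bessel_weight_le => //; rewrite lexx andbT ge0_cp// ltW.
  - rewrite (_ : - (alpha + b) - 1 = - alpha - 1 - b); last by ring.
    rewrite (powR_add (- alpha - 1))// ler_wpM2r ?powR_ge0//.
    by apply: bessel_weight_le => //; rewrite lexx/= ge0_cp// ltW.
under eq_integral do rewrite EFinD.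
rewrite ge0_integralD//; last 4 first.
- by move=> t _; rewrite lee_fin mulr_ge0 ?powR_ge0.
- exact/measurable_EFinP.
- by move=> t _; rewrite lee_fin mulr_ge0 ?powR_ge0.
- exact/measurable_EFinP.
have := leeD (integral_powR_le ab1 (@ltr01 R)) (integral_powR_gt ab2 (@ltr01 R)).
by rewrite !powR1 !mul1r.
Qed.

Let ae_domination (f g : X -> R) : measurable_fun setT g ->
  EFin \o f = J g %[ae m] ->
  {ae m, forall x, (`|f x|%:E <=
    (alpha * S)%:E * pot (fun z t => W t * `|g z|)%R x)%E}.
Proof.
move=> mg; apply: filterS => x /(_ I) fx.
have -> : (`|f x|%:E = `|J g x|)%E by rewrite -fx.
exact: (bessel_potential_le X_borel m_regular c_gt0 m_ball m_ball_ge L_gt0 HL).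
Qed.

(** Here the weight itself is used, which is integrable at both ends; the power with b = 0 would be
    1 / t, integrable at neither. *)
Lemma bessel_bound_pp : exists2 C : R, 0 < C & forall (f g : X -> R) (G : R),
  measurable_fun setT f -> measurable_fun setT g -> EFin \o f = J g %[ae m] ->
  0 < G -> (\int[m]_z (`|g z| `^ p)%:E <= (G `^ p)%:E)%E ->
  (\int[m]_z (`|f z| `^ p)%:E <= ((C * G) `^ p)%:E)%E.
Proof.
pose I := alpha^-1 + alpha^-1.
have I0 : 0 < I by rewrite addr_gt0// invr_gt0.
have WI : (\int[mu]_(t in P) (W t)%:E <= I%:E)%E.
  have := bessel_weight_integral (lexx 0) alpha_gt0; rewrite subr0 addr0 oppr0.
  by under eq_integral do rewrite powRr0 mulr1.
have [C C0 HC] := strong_type_pp X_borel m_regular c_gt0 m_ball p_gt1 mW W0 I0 WI aS0.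
exists (C `^ p^-1); first exact: powR_gt0.
move=> f g G mf mg fg G0 gG.
have := HC _ _ (measurable_norm_comp mf) (fun x => normr_ge0 (f x)) (measurable_norm_comp mg)
  (fun x => normr_ge0 (g x)) (ae_domination mg fg).
move=> /le_trans; apply; rewrite powRM ?powR_ge0 ?(ltW G0)//.
rewrite -powRrM mulVf ?gt_eqF// powRr1 ?(ltW C0)// EFinM.
by apply: lee_wpmul2l => //; rewrite lee_fin ltW.
Qed.

(** The exponent N / p - N / q lies in ]0, alpha], so the weight may be replaced by the
    corresponding single power. The value alpha, which is the critical exponent, is treated like the
    others. *)
Lemma bessel_bound_pq q : p < q -> N / p - N / q <= alpha ->
  exists2 C : R, 0 < C & forall (f g : X -> R) (G : R),
  measurable_fun setT f -> measurable_fun setT g -> EFin \o f = J g %[ae m] ->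
  0 < G -> (\int[m]_z (`|g z| `^ p)%:E <= (G `^ p)%:E)%E ->
  (\int[m]_z (`|f z| `^ q)%:E <= ((C * G) `^ q)%:E)%E.
Proof.
move=> pq aq; have q0 : 0 < q by exact: lt_trans pq.
have [C C0 HC] := hls_normalized X_borel N_gt0 m_regular c_gt0 m_ball p_gt1 pq aS0.
exists (C `^ q^-1); first exact: powR_gt0.
move=> f g G mf mg fg G0 gG.
have G'0 : 0 <= G^-1 by rewrite invr_ge0 ltW.
pose v t := t `^ (N / p - N / q - 1).
have mv : measurable_fun setT v by exact: measurable_powR.
have v0 t : 0 <= v t by exact: powR_ge0.
have mscale (g' :
    X -> R) : measurable_fun setT g' -> measurable_fun setT (fun z => G^-1 * `|g' z|).
  by move=> mg'; apply: measurable_funM => //; exact: measurable_norm_comp.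
have mpow (g' :
    X -> R) r : measurable_fun setT g' -> measurable_fun setT (fun z => `|g' z| `^ r).
  by move=> mg'; apply: (measurableT_comp (measurable_powR _)) => //; exact: measurable_norm_comp.
have scaleE (g' : X -> R) r : measurable_fun setT g' ->
    (\int[m]_z ((G^-1 * `|g' z|) `^ r)%:E =
     (G^-1 `^ r)%:E * \int[m]_z (`|g' z| `^ r)%:E)%E.
  move=> mg'; have mgr := mpow _ r mg'.
  rewrite -(ge0_integralZl_real m measurableT (powR_ge0 _ _) _ mgr); last first.
    by move=> z _; exact: powR_ge0.
  by apply: eq_integral => z _; rewrite powRM.
have G1 r : G^-1 `^ r * G `^ r = 1.
  by rewrite -powRM ?(ltW G0)// mulVf ?gt_eqF// powR1.
rewrite powRM ?powR_ge0 ?(ltW G0)// -powRrM mulVf ?gt_eqF// powRr1 ?(ltW C0)//.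
(* Multiplying and dividing by G^q brings in f / G and g / G, to which the normalized inequality
   applies. *)
have GV V : V = ((G `^ q)%:E * ((G^-1 `^ q)%:E * V))%E :> \bar R.
  by rewrite muleA -EFinM mulrC G1 mul1e.
rewrite [leLHS]GV mulrC EFinM.
apply: lee_wpmul2l; first by rewrite lee_fin powR_ge0.
rewrite -scaleE//; apply: (HC _ (fun z => G^-1 * `|g z|)).
- exact: mscale.
- by move=> z; rewrite mulr_ge0.
- exact: mscale.
- by move=> z; rewrite mulr_ge0.
- rewrite scaleE// -(G1 p) EFinM; apply: lee_wpmul2l => //.
  by rewrite lee_fin powR_ge0.
apply: filterS (ae_domination mg fg) => x fx.
have B0 (z : X) t : 0 <= v t * `|g z| by rewrite mulr_ge0.
have mB := measurable_tensor mv (measurable_norm_comp mg).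
apply: (@le_trans _ _ ((alpha * S)%:E * pot (fun z t => G^-1 * (v t * `|g z|))%R x)%E);
  last first.
  have -> : (fun (z : X) t => G^-1 * (v t * `|g z|)) =
    (fun z t => t `^ (N / p - N / q - 1) * (G^-1 * `|g z|)).
    by apply/funext => z; apply/funext => t; rewrite mulrCA.
  exact: lexx.
rewrite (@ball_potentialZ _ _ _ m N X_borel m_regular (fun z t => v t * `|g z|) _ x mB B0 G'0).
rewrite muleCA EFinM; apply: lee_wpmul2l; first by rewrite lee_fin.
apply: le_trans fx _; apply: lee_wpmul2l; first by rewrite lee_fin ltW.
apply: (le_ball_potential X_borel m_regular) => //.
- exact: (@measurable_tensor _ _ _ _ _ W (fun z => `|g z|) mW (measurable_norm_comp mg)).
- by move=> z t; rewrite mulr_ge0.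
move=> z t t0; rewrite ler_wpM2r//; apply: bessel_weight_le => //.
have q'p : 0 <= N / p - N / q.
  by rewrite subr_ge0 ler_pM2l// lef_pV2 ?posrE// ltW.
by rewrite aq andbT (le_trans _ q'p)// oppr_le0 ltW.
Qed.

(** Hoelder's inequality at every scale: N / p < alpha makes W t * t^(-N/p) integrable down to 0.
    The bound on the dominating potential is recorded as well, because the oscillation estimate asks
    for its finiteness. *)
Lemma bessel_bound_sup : N / p < alpha ->
  exists2 C : R, 0 < C & forall (g : X -> R) (G : R),
  measurable_fun setT g ->
  0 < G -> (\int[m]_z (`|g z| `^ p)%:E <= (G `^ p)%:E)%E ->
  forall x, (pot (fun z t => W t * `|g z|)%R x <= (C * G)%:E)%E /\
            (`|J g x| <= (C * G)%:E)%E.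
Proof.
move=> Np; have Np0 : 0 <= N / p by rewrite divr_ge0// ltW.
pose I := (alpha - N / p)^-1 + (alpha + N / p)^-1.
have I0 : 0 < I by rewrite addr_gt0// invr_gt0 ?subr_gt0// ltr_pwDl.
pose C := (c + 1) * 4 `^ (N - N / p) * I.
have C0 : 0 < C by rewrite mulr_gt0// mulr_gt0 ?powR_gt0// addr_gt0.
exists (C + alpha * S * C); first by rewrite addr_gt0// mulr_gt0.
move=> g G mg G0 gG x.
have bound : (pot (fun z t => W t * `|g z|)%R x <= (C * G)%:E)%E.
  have := potential_far_le X_borel m_regular c_gt0 m_ball x p_gt1 mW W0 (measurable_norm_comp mg)
    (fun z => normr_ge0 (g z)) G0 gG.
  move=> /le_trans; apply.
  rewrite (_ : C * G = (c + 1) * 4 `^ (N - N / p) * G * I) ?[leRHS]EFinM; last first.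
    by rewrite /C; ring.
  apply: lee_wpmul2l; last exact: bessel_weight_integral.
  by rewrite lee_fin mulr_ge0 ?(ltW G0)// mulr_ge0 ?powR_ge0// addr_ge0// ltW.
split.
  apply: le_trans bound _; rewrite lee_fin ler_wpM2r ?(ltW G0)// lerDl.
  by rewrite mulr_ge0 ?ltW.
apply: le_trans (bessel_potential_le X_borel m_regular c_gt0 m_ball m_ball_ge L_gt0
  HL alpha_gt0 x mg) _.
apply: (@le_trans _ _ ((alpha * S)%:E * (C * G)%:E)%E).
  by apply: lee_wpmul2l => //; rewrite lee_fin ltW.
by rewrite -EFinM lee_fin mulrA ler_wpM2r ?(ltW G0)// lerDr ltW.
Qed.

End embeddings.

(** * Mean oscillation measured from an arbitrary constant *)

Section oscillation_lemma.
Context {d : measure_display} {T : measurableType d} {R : realType}.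
Variable m : {measure set T -> \bar R}.

Lemma integrable_cst_finite (B : set T) (l b : R) :
  measurable B -> m B = b%:E -> m.-integrable B (EFin \o cst l).
Proof.
move=> mB mBb; apply/integrableP; split; first exact/measurable_EFinP.
by under eq_integral do rewrite /=; rewrite integral_cst// mBb -EFinM ltry.
Qed.

Lemma integrable_of_oscillation (B : set T) (f : T -> R) (l b K : R) :
  measurable B -> m B = b%:E -> measurable_fun setT f ->
  (\int[m]_(x in B) `|f x - l|%:E <= K%:E)%E ->
  m.-integrable B (EFin \o f).
Proof.
move=> mB mBb mf fK.
have il := integrable_cst_finite l mB mBb.
have ifl : m.-integrable B (EFin \o (fun x => f x - l)).
  apply/integrableP; split.
    by apply/measurable_EFinP; apply: measurable_funTS; exact: measurable_funB.
  exact: le_lt_trans fK (ltry _).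
have := integrableD mB ifl il.
by apply: eq_integrable => // x _ /=; rewrite -EFinD subrK.
Qed.
End oscillation_lemma.

Section mean_oscillation.
Context {d : measure_display} {R : realType} {X : metricMeasurableType d R}.
Variable m : {measure set X -> \bar R}.

(** The mean is at distance at most the average of |f - l| from l, so exchanging l for the mean at
    most doubles the bound. *)
Lemma mean_oscillation_le (B : set X) (f : X -> R) (l b K : R) :
  measurable B -> m B = b%:E -> 0 < b -> measurable_fun setT f ->
  (\int[m]_(x in B) `|f x - l|%:E <= K%:E)%E ->
  (mean_oscillation m B f <= (2 * K / b)%:E)%E.
Proof.
move=> mB mBb b0 mf fK.
have mfl (s : R) : measurable_fun B (fun x => `|f x - s|).
  by apply: measurable_funTS; apply: measurableT_comp => //; exact: measurable_funB.
have ifB := integrable_of_oscillation mB mBb mf fK.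
have il := integrable_cst_finite l mB mBb.
have ifl : m.-integrable B (EFin \o (fun x => f x - l)).
  by have := integrableB mB ifB il; apply: eq_integrable.
have meanE : mean m B f - l = b^-1 * \int[m]_(x in B) (f x - l).
  rewrite RintegralB// Rintegral_cst// /mean mBb /= mulrBr mulrCA mulVf ?gt_eqF//.
  by rewrite mulr1.
have meanl : `|l - mean m B f| <= b^-1 * K.
  rewrite distrC meanE normrM gtr0_norm ?invr_gt0// ler_pM2l ?invr_gt0//.
  apply: le_trans (le_normr_Rintegral mB ifl) _.
  rewrite -lee_fin /Rintegral fineK// ge0_fin_numE ?integral_ge0//.
  exact: le_lt_trans fK (ltry _).
rewrite /mean_oscillation mBb /=.
have H : (\int[m]_(y in B) `|f y - mean m B f|%:E <= (2 * K)%:E)%E.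
  apply: (@le_trans _ _ (\int[m]_(y in B) (`|f y - l| + b^-1 * K)%:E)%E).
    apply: ge0_le_integral => //.
    - exact/measurable_EFinP.
    - by apply/measurable_EFinP; exact: measurable_funD.
    move=> y _; rewrite lee_fin (_ : _ - _ = (f y - l) + (l - mean m B f)).
      by rewrite (le_trans (ler_normD _ _))// lerD2l.
    by rewrite addrA subrK.
  under eq_integral do rewrite EFinD.
  have K0 : 0 <= b^-1 * K by exact: le_trans meanl.
  rewrite ge0_integralD//; last exact/measurable_EFinP.
  rewrite integral_cst// mBb -EFinM mulrAC mulVf ?gt_eqF// mul1r.
  by rewrite mulr_natl mulr2n EFinD leeD2r.
apply: (@le_trans _ _ (b^-1%:E * (2 * K)%:E)%E).
  by apply: lee_wpmul2l => //; rewrite lee_fin invr_ge0 ltW.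
by rewrite -EFinM mulrC.
Qed.

End mean_oscillation.

(** * Bounds for Bessel potentials in BMO and in Hoelder spaces *)

Section oscillation_embeddings.
Context {d : measure_display} {R : realType} {X : metricMeasurableType d R}.
Variables (m : {measure set X -> \bar R}) (N c : R) (H : R -> R) (L : R).
Hypotheses (X_borel : borel_measurable X) (N_gt0 : 0 < N)
  (m_regular : ahlfors_regular m N) (c_gt0 : 0 < c)
  (m_ball : forall (x : X) r, 0 < r -> (m (ball x r) <= (c * r `^ N)%:E)%E)
  (m_ball_ge : forall (x : X) r, 0 < r -> ((c^-1 * r `^ N)%:E <= m (ball x r))%E)
  (L_gt0 : 0 < L) (HL : lipschitz_cutoff H L).
Local Notation mu := (@lebesgue_measure R).
Local Notation P := (`]0%R, +oo[%classic : set R).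

Variables (alpha p : R).
Hypotheses (alpha_gt0 : 0 < alpha) (p_gt1 : 1 < p).
Local Notation pot := (ball_potential m N).
Local Notation W := (bessel_weight alpha).
Local Notation J := (bessel_potential m N H alpha).
Local Notation c4 := (c * 4 `^ N).

Let p0 : 0 < p. Proof. exact: lt_trans p_gt1. Qed.
Let Np0 : 0 < N / p. Proof. exact: divr_gt0. Qed.

Let v (r t : R) : R := cut_lo r t * t `^ (alpha - 1).
Let v0 r t : 0 <= v r t. Proof. by rewrite mulr_ge0 ?powR_ge0. Qed.
Let mv r : measurable_fun setT (v r).
Proof.
by apply: measurable_funM; [exact: measurable_cut_lo|exact: measurable_powR].
Qed.

(** For x in the ball, t <= r and d(x, z) < 4 t force d(y, z) < 5 r, so g may be cut off to the ball
    of radius 5 r before the L^1 bound is applied. A pointwise use of Hoelder's inequality would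
    leave t^(alpha - N/p - 1), which diverges at 0 when alpha = N / p. *)
Let near_potential_ball_le (g : X -> R) (G : R) (y : X) (r : R) :
  measurable_fun setT g -> 0 < G -> 0 < r ->
  (\int[m]_z (`|g z| `^ p)%:E <= (G `^ p)%:E)%E ->
  (\int[m]_(x in ball y r) pot (fun z t => v r t * `|g z|)%R x <=
   (c4 * (r `^ alpha / alpha * ((c + 1) * G * (5 * r) `^ (N - N / p))))%:E)%E.
Proof.
move=> mg G0 r0 gG.
pose g1 z := (mdist y z < 5 * r)%R%:R * `|g z|.
have mg1 : measurable_fun setT g1.
  apply: measurable_funM; last exact: measurable_norm_comp.
  by apply: measurable_natr; apply: measurable_fun_ltr => //; exact: measurable_mdistr.
have g10 z : 0 <= g1 z by rewrite mulr_ge0.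
have mB1 := measurable_tensor (mv r) (measurable_norm_comp mg).
have mB2 := measurable_tensor (mv r) mg1.
have B10 (z : X) t : 0 <= v r t * `|g z| by rewrite mulr_ge0.
have B20 (z : X) t : 0 <= v r t * g1 z by rewrite mulr_ge0.
have mpot := measurable_ball_potential X_borel m_regular mB2 B20.
have r5 : 0 < 5 * r by rewrite mulr_gt0.
have mball := measurable_ball_borel X_borel y r.
apply: (@le_trans _ _ (\int[m]_(x in ball y r) pot (fun z t => v r t * g1 z)%R x)%E).
  apply: (ge0_le_integral m mball).
  - by move=> x _; exact: ball_potential_ge0.
  - apply: measurable_funTS; exact: (measurable_ball_potential X_borel m_regular mB1 B10).
  - exact: measurable_funTS.
  move=> x; rewrite ballEmdist/= => yx.
  apply: (le_ball_potential_near X_borel m_regular mB1 mB2 B10 B20) => z t t0 xz.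
  rewrite /v /cut_lo; have [tr|] := leP t r; last by rewrite !mul0r.
  rewrite mul1r ler_wpM2l ?powR_ge0// /g1.
  suff -> : mdist y z < 5 * r by rewrite mul1r.
  have := metric_triangle y x z; move: yx xz tr; lra.
apply: (@le_trans _ _ (\int[m]_x pot (fun z t => v r t * g1 z)%R x)%E).
  apply: (ge0_subset_integral m mball measurableT) => //.
  by move=> x _; exact: ball_potential_ge0.
have c40 : 0 <= c4 by rewrite mulr_ge0 ?powR_ge0// ltW.
apply: le_trans (integral_potential_le X_borel m_regular c_gt0 m_ball (mv r) (v0 r) mg1 g10) _.
rewrite [leRHS]EFinM; apply: lee_wpmul2l => //.
rewrite EFinM; apply: lee_pmul.
- by apply: integral_ge0 => t _; rewrite lee_fin.
- by apply: integral_ge0 => z _; rewrite lee_fin.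
- exact: integral_powR_le.
- exact: (integral_ball_le X_borel m_ball y p_gt1 (measurable_norm_comp mg)).
Qed.

(** From |g| <= 1 + |g|^p: the potential of 1 is bounded, and that of |g|^p is integrable, hence
    finite almost everywhere. *)
Let ae_potential_finite (g : X -> R) (G : R) : measurable_fun setT g -> 0 < G ->
  (\int[m]_z (`|g z| `^ p)%:E <= (G `^ p)%:E)%E ->
  {ae m, forall x, (pot (fun z t => W t * `|g z|)%R x < +oo)%E}.
Proof.
move=> mg G0 gG.
have W0 t := bessel_weight_ge0 alpha t.
have mW := measurable_bessel_weight alpha.
have mgp : measurable_fun setT (fun z => `|g z| `^ p).
  by apply: (measurableT_comp (measurable_powR _)); exact: measurable_norm_comp.
have gp0 z : 0 <= `|g z| `^ p by exact: powR_ge0.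
have mBp := measurable_tensor mW mgp.
have Bp0 (z : X) t : 0 <= W t * `|g z| `^ p by rewrite mulr_ge0.
pose W1 := (alpha - 0)^-1 + (alpha + 0)^-1.
have WI : (\int[mu]_(t in P) (W t)%:E <= W1%:E)%E.
  have := bessel_weight_integral alpha_gt0 (lexx 0) alpha_gt0.
  by under eq_integral do rewrite oppr0 powRr0 mulr1.
have W10 : 0 <= W1 by rewrite /W1 subr0 addr0 addr_ge0// invr_ge0 ltW.
have c40 : 0 <= c4 by rewrite mulr_ge0 ?powR_ge0// ltW.
have finp : {ae m, forall x, (pot (fun z t => W t * `|g z| `^ p)%R x < +oo)%E}.
  have ip : m.-integrable setT (pot (fun z t => W t * `|g z| `^ p)%R).
    apply/integrableP; split.
      exact: (measurable_ball_potential X_borel m_regular mBp Bp0).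
    under eq_integral do rewrite (gee0_abs (ball_potential_ge0 m N Bp0 _)).
    apply: le_lt_trans (integral_potential_le X_borel m_regular c_gt0 m_ball mW W0 mgp gp0) _.
    apply: (@le_lt_trans _ _ (c4%:E * (W1%:E * (G `^ p)%:E))%E).
      apply: lee_wpmul2l => //; apply: lee_pmul => //.
      - by apply: integral_ge0 => t _; rewrite lee_fin.
      - by apply: integral_ge0 => z _; rewrite lee_fin.
    by rewrite -!EFinM ltry.
  apply: filterS (integrable_ae measurableT ip) => x /(_ I).
  by rewrite ge0_fin_numE// ball_potential_ge0.
apply: filterS finp => x finx.
have mcst : measurable_fun [set: X * R] (fun w => W w.2 * 1).
  by apply: measurable_funM => //; exact: (measurableT_comp mW).
have B10 (z : X) t : 0 <= W t * 1 by rewrite mulr1.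
apply: (@le_lt_trans _ _ (pot (fun=> fun t => W t * 1)%R x +
    pot (fun z t => W t * `|g z| `^ p)%R x)%E).
  rewrite -(@ball_potentialD _ _ _ _ _ X_borel m_regular (fun=> fun t => W t * 1)
    (fun z t => W t * `|g z| `^ p) x mcst mBp B10 Bp0).
  apply: (le_ball_potential X_borel m_regular).
  - exact: (measurable_tensor mW (measurable_norm_comp mg)).
  - exact: measurable_funD.
  - by move=> z t; rewrite mulr_ge0.
  - by move=> z t; rewrite addr_ge0 ?(B10 z).
  - move=> z t t0; rewrite -mulrDr ler_wpM2l//.
    have := le_truncation (normr_ge0 (g z)) (@ltr01 R) (ltW p_gt1).
    by rewrite powR1 mul1r.
apply: lte_add_pinfty; last exact: finx.
apply: le_lt_trans (potential_cst_le X_borel m_regular c_gt0 m_ball x mW W0 (@ler01 R)) _.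
apply: (@le_lt_trans _ _ ((c4 * 1)%:E * W1%:E)%E).
  by apply: lee_wpmul2l => //; rewrite lee_fin mulr1.
by rewrite -EFinM ltry.
Qed.

(** For alpha = N / p the contribution of large scales is the constant G, and that of small scales,
    averaged over the ball, has order r^alpha r^(N - N/p) r^(-N) = 1. *)
Lemma bessel_bound_BMO : alpha = N / p ->
  exists2 C : R, 0 < C & forall (f g : X -> R) (G : R),
  measurable_fun setT f -> measurable_fun setT g -> EFin \o f = J g %[ae m] ->
  0 < G -> (\int[m]_z (`|g z| `^ p)%:E <= (G `^ p)%:E)%E ->
  forall y r, 0 < r -> m.-integrable (ball y r) (EFin \o f) /\
    (mean_oscillation m (ball y r) f <= (C * G)%:E)%E.
Proof.
move=> ap.
have [|C1 C10 osc] := bessel_potential_oscillation X_borel N_gt0 m_regular c_gt0 m_ball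
  m_ball_ge L_gt0 HL alpha_gt0 p_gt1; first by rewrite ap subrr.
have aN : 0 <= N - N / p by rewrite subr_ge0 ler_pdivrMr// ler_pMr// ltW.
(* The first summand comes from the scales up to r, the second from integrating the constant G over
   the ball. *)
pose D := c4 * (alpha^-1 * ((c + 1) * 5 `^ (N - N / p))) + c.
have D0 : 0 < D.
  by rewrite ltr_wpDl// !mulr_ge0 ?powR_ge0 ?invr_ge0 ?addr_ge0// ltW.
(* The 2 is the passage from l to the mean, and c the lower bound for the measure of the ball. *)
exists (2 * (C1 * D) * c); first by rewrite mulr_gt0// mulr_gt0// mulr_gt0.
move=> f g G mf mg fg G0 gG y r r0.
have [l lP] := osc g G mg G0 gG y r r0.
have mball := measurable_ball_borel X_borel y r.
have B0 (z : X) t : 0 <= v r t * `|g z| by rewrite mulr_ge0.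
have mB := measurable_tensor (mv r) (measurable_norm_comp mg).
have mpot := measurable_ball_potential X_borel m_regular mB B0.
have rN0 : 0 < r `^ N by exact: powR_gt0.
have fl : (\int[m]_(x in ball y r) `|f x - l|%:E <= (C1 * D * G * r `^ N)%:E)%E.
  apply: (@le_trans _ _ (\int[m]_(x in ball y r)
      (C1%:E * (pot (fun z t => v r t * `|g z|)%R x + G%:E)))%E).
    apply: ae_ge0_le_integral => //.
    - apply/measurable_EFinP; apply: measurable_funTS.
      by apply: measurableT_comp => //; exact: measurable_funB.
    - move=> x _; rewrite mule_ge0 ?lee_fin ?(ltW C10)// adde_ge0 ?lee_fin ?(ltW G0)//.
      exact: ball_potential_ge0.
    - by apply: measurable_funeM; apply: emeasurable_funD => //; exact: measurable_funTS.
    apply: filterS2 fg (ae_potential_finite mg G0 gG) => x /(_ I) fx finx.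
    rewrite ballEmdist/= => yx.
    have := lP x; rewrite metric_sym (ltW yx) => /(_ isT finx).
    by rewrite -fx /= ap subrr powRr0 mulr1 -ap.
  have pot0 x :
      (0 <= pot (fun z t => v r t * `|g z|)%R x)%E by exact: ball_potential_ge0.
  rewrite ge0_integralZl//; last 3 first.
  - by apply: emeasurable_funD => //; exact: measurable_funTS.
  - by move=> x _; rewrite adde_ge0 ?lee_fin ?(ltW G0).
  - by rewrite lee_fin ltW.
  rewrite ge0_integralD//; last 2 first.
  - exact: measurable_funTS.
  - by move=> x _; rewrite lee_fin ltW.
  rewrite integral_cst//.
  have Hn := near_potential_ball_le y mg G0 r0 gG.
  have Hb : (G%:E * m (ball y r) <= (G * (c * r `^ N))%:E)%E.
    by rewrite [leRHS]EFinM; apply: lee_wpmul2l; [rewrite lee_fin ltW|exact: m_ball].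
  have E : C1 * D * G * r `^ N = C1 * ((c4 * (r `^ alpha / alpha *
      ((c + 1) * G * (5 * r) `^ (N - N / p)))) + G * (c * r `^ N)).
    rewrite powRM ?(ltW r0)// (_ : r `^ N = r `^ alpha * r `^ (N - N / p)).
      by rewrite /D; ring.
    by rewrite -powR_add// ap addrC subrK.
  rewrite E [leRHS]EFinM; apply: lee_wpmul2l; first by rewrite lee_fin ltW.
  by rewrite EFinD; exact: leeD.
have mb_fin : m (ball y r) \is a fin_num.
  by rewrite ge0_fin_numE//; exact: le_lt_trans (m_ball y r0) (ltry _).
have mbE : m (ball y r) = (fine (m (ball y r)))%:E by rewrite fineK.
have b_ge : c^-1 * r `^ N <= fine (m (ball y r)).
  by rewrite -lee_fin fineK//; exact: m_ball_ge.
have cr0 : 0 < c^-1 * r `^ N by rewrite mulr_gt0// invr_gt0.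
have b0 : 0 < fine (m (ball y r)) by exact: lt_le_trans b_ge.
split; first exact: (integrable_of_oscillation mball mbE mf fl).
apply: le_trans (mean_oscillation_le mball mbE b0 mf fl) _.
rewrite lee_fin ler_pdivrMr//.
apply: (@le_trans _ _ (2 * (C1 * D) * c * G * (c^-1 * r `^ N))).
  rewrite le_eqVlt; apply/orP; left; apply/eqP; field; exact: lt0r_neq0.
by rewrite ler_wpM2l// mulr_ge0 ?(ltW G0)// !mulr_ge0 ?ltW.
Qed.

(** The potential is finite everywhere, so [J g] itself is the representative sought. For x <> y the
    oscillation estimate on the ball about y of radius d(x, y) compares both values with the same l,
    which gives 2 * D; [C2] bounds the supremum. *)
Lemma bessel_bound_Hoelder : N / p < alpha -> alpha < 1 + N / p ->
  exists2 C : R, 0 < C & forall (f g : X -> R) (G : R),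
  measurable_fun setT f -> measurable_fun setT g -> EFin \o f = J g %[ae m] ->
  0 < G -> (\int[m]_z (`|g z| `^ p)%:E <= (G `^ p)%:E)%E ->
  exists2 f' : X -> R, (Hoelder_norm (alpha - N / p) f' <= (C * G)%:E)%E &
    f = f' %[ae m].
Proof.
move=> Npa aNp; pose dl := alpha - N / p.
have dl0 : 0 < dl by rewrite subr_gt0.
have dl1 : dl < 1 by rewrite ltrBlDr.
have [C1 C10 osc] := bessel_potential_oscillation X_borel N_gt0 m_regular c_gt0 m_ball
  m_ball_ge L_gt0 HL alpha_gt0 p_gt1 dl1.
have [C2 C20 sup] := bessel_bound_sup X_borel N_gt0 m_regular c_gt0 m_ball m_ball_ge
  L_gt0 HL alpha_gt0 p_gt1 Npa.
pose Kp := (c + 1) * 4 `^ (N - N / p).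
have Kp0 : 0 < Kp by rewrite mulr_gt0 ?powR_gt0// addr_gt0.
pose D := C1 * (Kp / dl + 1).
have D0 : 0 < D by rewrite mulr_gt0// addr_gt0// divr_gt0.
exists (C2 + 2 * D); first by rewrite addr_gt0// mulr_gt0.
move=> f g G mf mg fg G0 gG.
have JC x := (sup g G mg G0 gG x).2.
have potC x : (pot (fun z t => W t * `|g z|)%R x < +oo)%E.
  exact: le_lt_trans (sup g G mg G0 gG x).1 (ltry _).
have Jfin x : J g x \is a fin_num.
  by rewrite fin_num_abs; exact: le_lt_trans (JC x) (ltry _).
pose f' x := fine (J g x).
have f'E x : J g x = (f' x)%:E by rewrite fineK.
exists f'; last by apply: filterS fg => x /(_ I) fx _; rewrite /f' -fx.
have near_le x r : 0 < r -> (pot (fun z t => v r t * `|g z|)%R x <=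
    (Kp * G * (r `^ dl / dl))%:E)%E.
  move=> r0; have := potential_far_le X_borel m_regular c_gt0 m_ball x p_gt1 (mv r) (v0 r)
    (measurable_norm_comp mg) (fun z => normr_ge0 (g z)) G0 gG.
  move/le_trans; apply; rewrite [leRHS]EFinM; apply: lee_wpmul2l.
    by rewrite lee_fin mulr_ge0// ltW.
  apply: le_trans (integral_powR_le dl0 r0).
  rewrite le_eqVlt; apply/orP; left; apply/eqP; apply: eq_integral => t.
  rewrite inE/= in_itv/= andbT => t0; congr EFin.
  rewrite /v -mulrA -powR_add//; congr (_ * _ `^ _).
  by rewrite /dl; ring.
rewrite mulrDl EFinD; apply: leeD; apply: ge_ereal_sup.
  by move=> _ [x _ <-]; have := JC x; rewrite f'E.
move=> _ [x [y /eqP xy ->]].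
have r0 : 0 < mdist x y by rewrite mdist_gt0.
rewrite lee_fin ler_pdivrMr ?powR_gt0//.
have [l lP] := osc g G mg G0 gG y _ r0.
have bound w : mdist w y <= mdist x y -> `|f' w - l| <= D * G * mdist x y `^ dl.
  move=> wy; have := lP w wy (potC w); rewrite f'E => /le_trans H1.
  rewrite -lee_fin; apply: H1.
  apply: (@le_trans _ _ (C1%:E * ((Kp * G * (mdist x y `^ dl / dl))%:E +
      (G * mdist x y `^ dl)%:E))%E).
    apply: lee_wpmul2l; first by rewrite lee_fin ltW.
    by apply: leeD => //; exact: near_le.
  rewrite -EFinD -EFinM lee_fin le_eqVlt; apply/orP; left; apply/eqP.
  by rewrite /D; ring.
have := bound x (lexx _); have := bound y; rewrite mdistxx mdist_ge0 => /(_ isT) H1 H2.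
move: (f' x) (f' y) H1 H2 => a b H1 H2.
rewrite (_ : a - b = (a - l) - (b - l)); last by rewrite opprB addrA subrK.
apply: le_trans (ler_normB _ _) _; apply: le_trans (lerD H2 H1) _.
by clearbody D; rewrite le_eqVlt; apply/orP; left; apply/eqP; ring.
Qed.

End oscillation_embeddings.

(** * The embeddings *)

Unset Implicit Arguments.

Theorem theorem4p12 (R : realType) (d : measure_display)
    (X : metricMeasurableType d R) (m : {measure set X -> \bar R})
    (N : R) (h : R -> R) (p alpha : R)
    (X_borel : borel_measurable X)
    (m_infinite : m [set: X] = +oo%E)
    (N_gt0 : 0 < N)
    (m_regular : ahlfors_regular m N)
    (h_cutoff : cutoff h)
    (p_gt1 : 1 < p)
    (alpha_gt0 : 0 < alpha) :
  [/\ p < N / alpha ->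
        forall pstar q : R, pstar^-1 = p^-1 - alpha / N ->
          p <= q <= pstar ->
          potential_space m N h alpha p \hookrightarrow Lebesgue_space m q%:E,
      p = N / alpha ->
        (forall q : R, p <= q ->
          potential_space m N h alpha p \hookrightarrow Lebesgue_space m q%:E)
        /\ (alpha < 1 ->
          potential_space m N h alpha p \hookrightarrow BMO_space m) &
      N / alpha < p ->
        (forall q : \bar R, (p%:E <= q)%E ->
          potential_space m N h alpha p \hookrightarrow Lebesgue_space m q)
        /\ (alpha < 1 + N / p ->
          potential_space m N h alpha p \hookrightarrow
            Hoelder_space m (alpha - N / p))].
Proof.
have [c c0 m_bounds] := m_regular.
have m_ball (x : X) r : 0 < r -> (m (ball x r) <= (c * r `^ N)%:E)%E.
  by move=> r0; have /andP[] := m_bounds x r r0.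
have m_ball_ge (x : X) r : 0 < r -> ((c^-1 * r `^ N)%:E <= m (ball x r))%E.
  by move=> r0; have /andP[] := m_bounds x r r0.
have [L L0 HL] := cutoff_lipschitz h_cutoff.
(* The even extension of h: it agrees with h on [0, +oo[ and is Lipschitz on the whole line. *)
pose H (x : R) := h `|x|.
have JE g : bessel_potential m N h alpha g = bessel_potential m N H alpha g.
  by apply: eq_bessel_potential => x x0; rewrite /H ger0_norm.
have {}HL : lipschitz_cutoff H L by exact: HL.
clearbody H.
have p0 : 0 < p by exact: lt_trans p_gt1.
have Lspace q : 0 < q -> (exists2 C : R, 0 < C & forall (f g : X -> R) (G : R),
    measurable_fun setT f -> measurable_fun setT g ->
    EFin \o f = bessel_potential m N H alpha g %[ae m] ->
    0 < G -> (\int[m]_z (`|g z| `^ p)%:E <= (G `^ p)%:E)%E ->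
    (\int[m]_z (`|f z| `^ q)%:E <= ((C * G) `^ q)%:E)%E) ->
    potential_space m N h alpha p \hookrightarrow Lebesgue_space m q%:E.
  move=> q0 [C C0 bound]; apply: (embedding_of_bound p0); exists C; first exact: C0.
  move=> f g G mf mg.
  rewrite JE => fg G0 gG.
  have fle : ('N[m]_q%:E[EFin \o f] <= (C * G)%:E)%E.
    apply: Lnorm_integral_powR_le => //; first by rewrite mulr_ge0 ?ltW.
    exact: (bound f g G mf mg fg G0 gG).
  split => //; rewrite /= inE/=; apply/andP; split; rewrite inE//=.
  exact: le_lt_trans fle (ltry _).
(* The common form of the conditions on a finite q: it amounts to q <= p^* in the subcritical case,
   and holds for every q >= p as soon as N / p <= alpha. *)
have Lq q : p <= q -> N / p - N / q <= alpha ->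
    potential_space m N h alpha p \hookrightarrow Lebesgue_space m q%:E.
  rewrite le_eqVlt => /predU1P[<- _|pq aq].
    apply: Lspace => //.
    exact: (bessel_bound_pp X_borel m_regular c0 m_ball m_ball_ge L0 HL alpha_gt0 p_gt1).
  apply: Lspace; first exact: lt_trans pq.
  exact: (bessel_bound_pq X_borel N_gt0 m_regular c0 m_ball m_ball_ge L0 HL alpha_gt0
    p_gt1).
split.
- move=> pNa s q sE /andP[pq qs].
  have q0 : 0 < q by exact: lt_le_trans pq.
  apply: Lq => //.
  (* Here s is p^*, positive because 0 < q <= s; multiplied by N, this inequality becomes N / p - N
     / q <= alpha. *)
  have : s^-1 <= q^-1 by rewrite lef_pV2 ?posrE// (lt_le_trans q0).
  rewrite sE -(ler_pM2l N_gt0) mulrBr mulrCA mulfV ?gt_eqF// mulr1.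
  by rewrite lerBlDr -lerBlDl.
- move=> pNa; split.
    move=> q pq; apply: Lq => //.
    have q0 : 0 < q by exact: lt_le_trans pq.
    rewrite (_ : N / p = alpha); last by rewrite pNa; field; rewrite !gt_eqF.
    by rewrite gerBl divr_ge0// ltW.
  move=> _; apply: (embedding_of_bound p0).
  have aE : alpha = N / p by rewrite pNa; field; rewrite !gt_eqF.
  have [C C0 bound] := bessel_bound_BMO X_borel N_gt0 m_regular c0 m_ball m_ball_ge L0
    HL alpha_gt0 p_gt1 aE.
  exists C; first exact: C0.
  move=> f g G mf mg; rewrite JE => fg G0 gG.
  have B := bound f g G mf mg fg G0 gG.
  have norm_le : (BMO_norm m f <= (C * G)%:E)%E.
    by apply: ge_ereal_sup => _ [x [r r0 ->]]; exact: (B x r r0).2.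
  split => //; split => //; first by move=> x r r0; exact: (B x r r0).1.
  exact: le_lt_trans norm_le (ltry _).
- move=> Nap.
  have Npa : N / p < alpha by rewrite ltr_pdivrMr// mulrC -ltr_pdivrMr.
  split.
    move=> [q| |] // pq.
      rewrite lee_fin in pq; apply: Lq => //.
      have q0 : 0 < q by exact: lt_le_trans pq.
      by rewrite lerBlDr (le_trans (ltW Npa))// lerDl divr_ge0// ltW.
    apply: (embedding_of_bound p0).
    have [C C0 bound] := bessel_bound_sup X_borel N_gt0 m_regular c0 m_ball m_ball_ge
      L0 HL alpha_gt0 p_gt1 Npa.
    exists C; first exact: C0.
  move=> f g G mf mg; rewrite JE => fg G0 gG.
    have fle : ('N[m]_+oo[EFin \o f] <= (C * G)%:E)%E.
      (* The L^oo norm is the essential supremum when X has positive measure and 0 otherwise; the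
         second value is trivially below the bound. *)
      rewrite unlock /Lnorm; case: ifPn => _; last by rewrite lee_fin mulr_ge0 ?ltW.
      apply/ess_supP; apply: filterS fg => x /(_ I) fx.
      by have := (bound g G mg G0 gG x).2; rewrite -fx.
    split => //; rewrite /= inE/=; apply/andP; split; rewrite inE//=.
    exact: le_lt_trans fle (ltry _).
  move=> aNp; apply: (embedding_of_bound p0).
  have [C C0 bound] := bessel_bound_Hoelder X_borel N_gt0 m_regular c0 m_ball m_ball_ge
    L0 HL alpha_gt0 p_gt1 Npa aNp.
  exists C; first exact: C0.
  move=> f g G mf mg; rewrite JE => fg G0 gG.
  have [f' f'le ff'] := bound f g G mf mg fg G0 gG.
  split.
    by split => //; exists f' => //; exact: le_lt_trans f'le (ltry _).
  by apply: le_trans f'le; apply: ereal_inf_lbound; exists f'.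
Qed.
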